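(* Let $F$ be a number field and let $K/F$ and $L/F$ be finite extensions (inside a fixed algebraic closure of $F$) with $[K:F]\le 5$ and $[L:F]\le 5$. If $K$ and $L$ are locally GCD equivalent over $F$, then $K$ and $L$ are $F$-isomorphic.
   Context: For a finite extension $M/F$ of number fields and a prime ideal $\mathfrak{p}\subset\mathcal{O}_F$ unramified in $M$, write $\mathfrak{p}\mathcal{O}_M=\mathfrak{q}_1\cdots\mathfrak{q}_t$ and let $f_{i,M}(\mathfrak{p})$ be the inertia degree of $\mathfrak{q}_i$ over $\mathfrak{p}$; the splitting type of $\mathfrak{p}$ in $M$ is the tuple $f_M(\mathfrak{p})=(f_{1,M}(\mathfrak{p}),\ldots,f_{t,M}(\mathfrak{p}))$ (sorted increasingly). Two finite extensions $K/F$, $L/F$ are locally GCD equivalent over $F$ if for every prime $\mathfrak{p}\subset\mathcal{O}_F$ unramified in both $K$ and $L$ one has $\gcd(f_{1,K}(\mathfrak{p}),\ldots,f_{t,K}(\mathfrak{p}))=\gcd(f_{1,L}(\mathfrak{p}),\ldots,f_{t',L}(\mathfrak{p}))$. *)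

(* Defs.v *)
(* Number fields are modelled as subfields of a common
   finite-dimensional extension E of Q (E : fieldExtType rat). *)
From HB Require Import structures.
From mathcomp Require Import all_boot all_order all_algebra all_fingroup all_field.
Set Implicit Arguments. Unset Strict Implicit. Unset Printing Implicit Defensive.
Import GRing.Theory.
Local Open Scope ring_scope.

Section NT.
Variable E : fieldExtType rat.

Definition integral (x : E) : Prop :=
  exists p : {poly int}, p \is monic /\ root (map_poly (fun z : int => z%:~R) p) x.

Definition ring_of_integers (M : {subfield E}) (x : E) : Prop :=
  x \in M /\ integral x.

Definition nz_prime_ideal (R I : E -> Prop) : Prop :=
  (forall x, I x -> R x) /\ I 0 /\
  (forall x y, I x -> I y -> I (x + y)) /\
  (forall r x, R r -> I x -> I (r * x)) /\
  ~ I 1 /\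
  (forall x y, R x -> R y -> I (x * y) -> I x \/ I y) /\
  (exists x, I x /\ x <> 0).

Definition prime_of (F : {subfield E}) (P : E -> Prop) : Prop :=
  nz_prime_ideal (ring_of_integers F) P.

Definition lies_over (F M : {subfield E}) (P Q : E -> Prop) : Prop :=
  nz_prime_ideal (ring_of_integers M) Q /\
  (forall x, ring_of_integers F x -> (Q x <-> P x)).

Definition in_ideal_sq (Q : E -> Prop) (x : E) : Prop :=
  exists s : seq (E * E),
    (forall ab, ab \in s -> Q ab.1 /\ Q ab.2) /\ x = \sum_(ab <- s) ab.1 * ab.2.

(* P is unramified in M: every ramification index e(Q|P) equals 1,
   i.e. P O_M is not contained in Q^2 for any Q above P *)
Definition unramified_in (F M : {subfield E}) (P : E -> Prop) : Prop :=
  forall Q, lies_over F M P Q -> exists x, P x /\ ~ in_ideal_sq Q x.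

Definition resid_card (R I : E -> Prop) (n : nat) : Prop :=
  exists s : seq E,
    [/\ size s = n,
        (forall x, x \in s -> R x),
        (forall i j, (i < j < n)%N -> ~ I (nth 0 s i - nth 0 s j))
      & forall x, R x -> exists2 i, (i < n)%N & I (x - nth 0 s i)].

(* f is the inertia degree f(Q|P) = [O_M/Q : O_F/P], i.e. N(Q) = N(P)^f *)
Definition inertia_degree (F M : {subfield E}) (P Q : E -> Prop) (f : nat) : Prop :=
  exists n : nat, resid_card (ring_of_integers F) P n /\
                  resid_card (ring_of_integers M) Q (n ^ f).

Definition is_gcd_split (F M : {subfield E}) (P : E -> Prop) (g : nat) : Prop :=
  forall d : nat, (d %| g)%N <->
    (forall Q f, lies_over F M P Q -> inertia_degree F M P Q f -> (d %| f)%N).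

Definition locally_gcd_equivalent (F K L : {subfield E}) : Prop :=
  forall P, prime_of F P -> unramified_in F K P -> unramified_in F L P ->
    forall g, is_gcd_split F K P g <-> is_gcd_split F L P g.

Definition F_isomorphic (F K L : {subfield E}) : Prop :=
  exists f : 'End(E), kHom F K f /\ (f @: K)%VS = L.

End NT.

(* Main.v *)
Require Import Defs.
From HB Require Import structures.
From mathcomp Require Import all_boot all_order all_algebra all_fingroup all_solvable all_field.
From mathcomp Require Import zify ring lra.
From mathcomp Require Import boolp reals exp Rstruct.

(** Let [N] be a normal closure over Q, and for a subfield [S] write [H_S] for the
    group of automorphisms of [N] over [S].  If [a] in [H_K] has prime power order [l^e]
    and fixes no [F]-conjugate of [L], a prime of [N] whose Frobenius generates [<a>]
    lies over a prime [P] of [F] with a degree-one prime of [K] above it, while all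
    inertia degrees in [L] are divisible by [l].  So gcd equivalence forces every
    element of prime power order of [H_K] to be conjugate in [H_F] into [H_L], and
    conversely; for subgroups of index at most 5 this makes [H_K] and [H_L] conjugate.

    Such Frobenius elements exist by an elementary density argument.  For a monic
    irreducible integer polynomial [f] let [S_f(x)] be the sum of [n_f(p) log p / p]
    over the primes [p < x], with [n_f(p)] the number of roots of [f] modulo [p].
    Then [S_f(x)] is asymptotic to [log x]: bound from above and below the logarithms
    of the norms of the elements (or differences of elements) of a box in Z[X]/(f).
    If no prime had a Frobenius generating a conjugate of [<a>], then the polynomials
    [f1, f2] generating the fixed fields of [a] and [a^l] would satisfy
    [n_f2 = l n_f1], contradicting [S_f1 ~ S_f2 ~ log x]. *)

Set Implicit Arguments. Unset Strict Implicit. Unset Printing Implicit Defensive.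
Import Order.TTheory GRing.Theory Num.Theory.

(** * Groups of index at most five *)

Local Open Scope group_scope.

(** The analysis takes place over Q only. Since the Frobenius of the chosen place of [N] fixes [F]
    and [K], the primes of [F] and [K] below that place both have residue field F_p, so rational
    primes and integer polynomials carry all the information. The comparison uses explicit
    constants: 7/8 S_f2 <= log x + O(1) and 15/16 log x <= 9/8 S_f1 + O(1). With 2 S_f1 <= S_f2 they
    bound log x, because 2 (5/6) > 8/7. The first comes from pigeonhole: points of a box collide
    modulo every degree-one prime. The second comes from packing: an ideal of large index contains
    few points of a box. Finitely many primes are discarded repeatedly. At the others the polynomial
    stays separable modulo [p], so integral elements are polynomials in [x] up to a denominator
    prime to [p], and ideals are handled through F_p[X]. On the group side the obstacle is that a
    permutation group may lack a common fixed point although each element of prime power order has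
    one, as for a cyclic group of order 6 on 2 + 3 points. Up to five points this orbit pattern is
    the only one that escapes the derangement argument; it is excluded by a normality argument. *)

Lemma dvdn5 d : (d %| 5)%N -> (d == 1%N) || (d == 5).
Proof. by have /primeP[_ h] : prime 5 by []; apply: h. Qed.

Section FixedPoints.
Variables (aT : finGroupType) (rT : finType) (to : {action aT &-> rT}).
Variables (A : {group aT}) (X : {set rT}).
Hypothesis actX : [acts A, on X | to].

Lemma orbit_sub_X x : x \in X -> orbit to A x \subset X.
Proof. by move=> xX; rewrite acts_sub_orbit. Qed.

(* A Sylow [l]-subgroup has no fixed point; if each of its elements had one, each
   would have at least [l], and Burnside's lemma would give more than [n / l] orbits. *)
Lemma pelt_derangement l : prime l -> (0 < #|X| <= l ^ 2)%N ->
  (forall x, x \in X -> (l %| #|orbit to A x|)%N) ->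
  exists2 a, a \in A & l.-elt a /\ (forall x, x \in X -> to x a != x).
Proof.
move=> pl /andP[X0 Xl] dvd_orb.
have [S sylS] := Sylow_exists l A; have sSA := pHall_sub sylS; have lS := pHall_pgroup sylS.
have actS : [acts S, on X | to] := subset_trans sSA actX.
have fixS x : x \in X -> (l <= #|orbit to S x|)%N.
  move=> xX; have orbS : #|orbit to S x| = #|S : 'C_S[x | to]| by rewrite card_orbit.
  have [[|e] oe] : {e | #|orbit to S x| = (l ^ e)%N}.
  - by apply: p_natP; rewrite orbS; apply: pnat_dvd lS; apply: dvdn_indexg.
  - have cS : S \subset 'C_A[x | to].
      have /eqP : #|S : 'C_S[x | to]| = 1%N by rewrite -orbS oe.
      by rewrite indexg_eq1 !subsetI sSA subxx.
    have ldiv : (l %| #|A : S|)%N.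
      by rewrite -(Lagrange_index (subsetIl A 'C[x | to]) cS) dvdn_mulr // -card_orbit dvd_orb.
    have /and3P[_ _ /(pnat_dvd ldiv)] := sylS.
    by rewrite pnatE // !inE eqxx.
  by rewrite oe expnS leq_pmulr // expn_gt0 prime_gt0.
(* The number of fixed points of an [l]-group is congruent to [#|X|] modulo [l]. As [S] itself fixes
   nothing, [l] divides [#|X|], so an element with one fixed point has at least [l]. *)
have dvd_fix a : a \in S -> (l %| #|'Fix_(X | to)[a]|)%N = (l %| #|X|)%N.
  move=> aS; have la : l.-group <[a]> by apply: pgroupS lS; rewrite cycle_subG.
  have actA : [acts <[a]>, on X | to] by apply: subset_trans actS; rewrite cycle_subG.
  have := pgroup_fix_mod la actA; rewrite afix_cycle_in ?inE // => e.
  by rewrite /dvdn e.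
have lX : (l %| #|X|)%N.
  have := pgroup_fix_mod lS actS.
  have -> : 'Fix_(X | to)(S) = set0.
    apply/setP => x; rewrite in_setI in_set0; apply/negP => /andP[xX /orbit1P o1].
    by have := fixS x xX; rewrite o1 cards1 leqNgt prime_gt1.
  by rewrite cards0 mod0n => /eqP.
pose r := #|orbit to S @: X|.
have rl : (r * l <= #|X|)%N.
  rewrite -(acts_sum_card_orbit actS) /r -sum_nat_const; apply: leq_sum => _ /imsetP[x xX ->].
  exact: fixS.
have burn := Frobenius_Cauchy actS; rewrite -/r in burn.
case: (pickP (fun a => (a \in S) && ('Fix_(X | to)[a] == set0))) => [a /andP[aS /eqP fa]|none].
  exists a; first exact: (subsetP sSA).
  split; first exact: mem_p_elt lS aS.
  move=> x xX; apply/eqP => e; have : x \in 'Fix_(X | to)[a] by rewrite !inE xX sub1set inE e eqxx.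
  by rewrite fa inE.
have ge a : a \in S -> (l <= #|'Fix_(X | to)[a]|)%N.
  move=> aS; have := none a; rewrite /= aS /= => /negbT; rewrite -card_gt0 => f0.
  by apply: dvdn_leq => //; rewrite dvd_fix.
(* Burnside, with the identity fixing all of [X]. As [r * l <= #|X| <= l ^ 2], this forces [r = l]
   and [#|X| = l ^ 2], whence [l ^ 2 <= l]. *)
have : (l * #|S|.-1 + #|X| <= r * #|S|)%N.
  rewrite -burn (bigD1 1) //= addnC leq_add //.
    have -> : 'Fix_(X | to)[1] = X; last by [].
    by apply/setIidPl/subsetP => x _; rewrite inE sub1set inE act1.
  have -> : #|S|.-1 = #|S :\ 1| by rewrite [in LHS](cardsD1 1) group1.
  rewrite mulnC -sum_nat_const; under [leqRHS]eq_bigl => a do rewrite andbC.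
  rewrite (eq_bigl (fun a => (a != 1) && (a \in S))); last by move=> a; rewrite !inE.
  by apply: leq_sum => a /andP[_ aS]; apply: ge.
have l1 := prime_gt1 pl; have S0 := cardG_gt0 S.
have lX' : (l <= #|X|)%N by apply: dvdn_leq.
move: (#|S|) S0 (#|X|) X0 Xl lX' rl => c c0 n n0 nl ln rl.
move=> h; nia.
Qed.
Lemma orbit_eq_or_small x y : x \in X -> y \in X ->
  orbit to A x = orbit to A y \/ (#|orbit to A x| + #|orbit to A y| <= #|X|)%N.
Proof.
move=> xX yX; have [xy|xy] := boolP (x \in orbit to A y); [left | right].
  by apply/orbit_eqP.
have dis : orbit to A x :&: orbit to A y = set0.
  apply/setP => z; rewrite in_setI in_set0; apply/negP => /andP[zx zy].
  case/negP: xy; apply/orbit_eqP; by move/orbit_eqP: zx => <-; apply/orbit_eqP.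
rewrite -cardsUI dis cards0 addn0; apply: subset_leq_card.
by rewrite subUset !orbit_sub_X.
Qed.

(** Next to an orbit of size 3 at most one point is left, which would be fixed; so that orbit is
    everything and 3 works. Otherwise all orbits have size 2 or 4. The bound 4 is sharp: five points
    allow 2 + 3. *)
Lemma small_orbits_prime : (0 < #|X| <= 4)%N -> (forall x, x \in X -> (1 < #|orbit to A x|)%N) ->
  exists2 l, prime l & (#|X| <= l ^ 2)%N /\ forall x, x \in X -> (l %| #|orbit to A x|)%N.
Proof.
move=> /andP[/card_gt0P[x0 x0X] X4] o1.
have ole x : x \in X -> (#|orbit to A x| <= #|X|)%N.
  by move=> xX; apply/subset_leq_card/orbit_sub_X.
have h0 := o1 _ x0X; have h1 := ole _ x0X.
have [o3|o3] := eqVneq #|orbit to A x0| 3.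
  exists 3 => //; split=> [|x xX]; first by lia.
  have [->|] := orbit_eq_or_small xX x0X; first by rewrite o3.
  by have := o1 _ xX; lia.
exists 2 => //; split=> // x xX.
have [->|] := orbit_eq_or_small xX x0X.
  by move: h0 h1 o3; move: #|orbit to A x0| => o; case: o => [|[|[|[|[|o]]]]] //; lia.
by have := o1 _ xX; move: h0; move: #|orbit to A x0| #|orbit to A x| => o o'; case: o' => [|[|[|o']]] //; lia.
Qed.

End FixedPoints.

Section Conjugacy.
Variables (gT : finGroupType) (G : {group gT}).
Implicit Types A B : {group gT}.

Definition locally_conj (A B : {group gT}) :=
  forall l a, prime l -> a \in A -> l.-elt a -> exists2 g, g \in G & a \in B :^ g.

Lemma rcoset_fixed B g a : (B :* g :* a == B :* g) = (a \in B :^ g).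
Proof.
have E : ((g * a)%g \in B :* g) = (a \in B :^ g).
  by rewrite mem_rcoset mem_conjg conjgE invgK mulgA.
by rewrite -rcosetM -E; apply/eqP/idP => [<-|h]; [apply: rcoset_refl | apply/rcoset_eqP].
Qed.

Lemma fixed_rcoset A B : (exists2 x, x \in rcosets B G & #|orbit 'Rs A x| <= 1)%N ->
  exists2 g, g \in G & A \subset B :^ g.
Proof.
move=> [_ /rcosetsP[g gG ->] o1]; exists g => //; apply/subsetP => a aA.
rewrite -rcoset_fixed.
have sub : orbit 'Rs A (B :* g) \subset [set (B :* g : {set gT})].
  have := orbit_refl 'Rs A (B :* g : {set gT}); rewrite -sub1set => h.
  by have /eqP <- : [set (B :* g : {set gT})] == orbit 'Rs A (B :* g) by rewrite eqEcard h cards1.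
have : (B :* g :* a : {set gT}) \in orbit 'Rs A (B :* g).
  by have := mem_orbit 'Rs (B :* g : {set gT}) aA; rewrite /= rcosetE.
by move/(subsetP sub); rewrite inE.
Qed.

(** Local conjugacy gives each [l]-element of [A] a fixed coset of [B], which contradicts the
    derangement. *)
Lemma locally_conj_prime A B l : A \subset G -> locally_conj A B -> prime l ->
  (#|G : B| <= l ^ 2)%N -> (forall x, x \in rcosets B G -> l %| #|orbit 'Rs A x|)%N -> False.
Proof.
move=> sAG loc pl Xl dv.
have actA : [acts A, on rcosets B G | 'Rs] := subset_trans sAG (actsRs_rcosets B G).
have [|a aA [la der]] := pelt_derangement actA pl _ dv.
  by rewrite Xl indexg_gt0.
have [g gG] := loc l a pl aA la; rewrite -rcoset_fixed => /eqP e.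
have gB : (B :* g : {set gT}) \in rcosets B G by apply/rcosetsP; exists g.
by have := der _ gB; rewrite /= rcosetE e eqxx.
Qed.

Lemma locally_conj_small A B : A \subset G -> (#|G : B| <= 4)%N -> locally_conj A B ->
  exists2 g, g \in G & A \subset B :^ g.
Proof.
move=> sAG B4 loc; apply: fixed_rcoset.
have actA : [acts A, on rcosets B G | 'Rs] := subset_trans sAG (actsRs_rcosets B G).
case: (pickP (fun x : {set gT} => (x \in rcosets B G) && (#|orbit 'Rs A x| <= 1)%N)).
  by move=> x /andP[xX o1]; exists x.
move=> none; have o1 x : x \in rcosets B G -> (1 < #|orbit 'Rs A x|)%N.
  by move=> xX; have := none x; rewrite xX /= ltnNge => ->.
have [|l pl [Xl dv]] := small_orbits_prime actA _ o1; first by rewrite indexg_gt0.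
by case: (locally_conj_prime sAG loc pl Xl dv).
Qed.

Lemma not_transitive5 A B : A \subset G -> locally_conj A B -> #|G : B| = 5 ->
  (exists2 x, x \in rcosets B G & #|orbit 'Rs A x| = 5) -> False.
Proof.
move=> sAG loc B5 [x xX ox].
have actA : [acts A, on rcosets B G | 'Rs] := subset_trans sAG (actsRs_rcosets B G).
apply: (locally_conj_prime sAG loc (l := 5)) => //; first by rewrite B5.
move=> y yX; have [->|] := orbit_eq_or_small actA yX xX; first by rewrite ox.
rewrite ox -[X in (_ <= X)%N]/(#|G : B|) B5.
have : (0 < #|orbit 'Rs A y|)%N by apply/card_gt0P; exists y; apply: orbit_refl.
by case: #|orbit 'Rs A y| => // o _; rewrite addSn addnC.
Qed.

Lemma card_orbit_rcoset A B g : #|orbit 'Rs A (B :* g)| = #|A : A :&: B :^ g|.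
Proof.
rewrite card_orbit; congr #|_ : _|; congr (_ :&: _).
by apply/setP => a; rewrite !inE sub1set inE /= rcosetE rcoset_fixed.
Qed.

(** Rules out the orbit pattern 2 + 3. The stabilizer [A0] of a point in an orbit of size 2 has
    index 2 in [A] and in [B :^ g], which have equal orders, so it is normal in both and in their
    join. The index 5 being prime, the join is [G]; hence [A0] lies in every conjugate of [B]. *)
Lemma index5_orbits_bound A B g h : A \subset G -> B \subset G -> #|G : A| = 5 -> #|G : B| = 5 ->
  g \in G -> h \in G -> #|A : A :&: B :^ g| = 2 -> (#|A : A :&: B :^ h| <= 2)%N.
Proof.
move=> sAG sBG A5 B5 gG hG i2; pose A0 := (A :&: B :^ g)%G.
have sB1G : B :^ g \subset G by rewrite -(conjGid gG) conjSg.
have cAB : #|A| = #|B :^ g|.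
  rewrite cardJg; apply/eqP; rewrite -(eqn_pmul2r (isT : 0 < 5)%N) -{1}A5 -B5.
  by rewrite !Lagrange.
have i2' : #|(B :^ g)%G : A0| = 2.
  apply/eqP; rewrite -(eqn_pmul2l (cardG_gt0 A0)) (Lagrange (subsetIr _ _)) -i2 (Lagrange (subsetIl _ _)).
  by rewrite cAB.
have nA : A0 <| A by apply: index2_normal => //; apply: subsetIl.
have nB : A0 <| (B :^ g)%G by apply: index2_normal => //; apply: subsetIr.
pose J := (A <*> (B :^ g))%G.
have sJG : J \subset G by rewrite join_subG sAG.
have sAJ : A \subset J by apply: joing_subl.
have sGJ : G \subset J.
  have := Lagrange_index sJG sAJ; rewrite A5 => e.
  have : (#|G : J| %| 5)%N by rewrite -e dvdn_mulr.
  move=> /dvdn5/orP[|/eqP J5]; first by rewrite indexg_eq1.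
  move: e; rewrite J5 => /eqP; rewrite -{2}[5]muln1 eqn_pmul2l // indexg_eq1 => sJA.
  have sBA : B :^ g \subset A by apply: subset_trans sJA; apply: joing_subr.
  have eAB : B :^ g = A by apply/eqP; rewrite eqEcard sBA cAB leqnn.
  by move: i2; rewrite eAB setIid indexgg.
have nG : G \subset 'N(A0).
  by apply: subset_trans sGJ _; rewrite join_subG (normal_norm nA) (normal_norm nB).
rewrite -i2; apply: dvdn_leq; first exact: indexg_gt0.
apply: indexgS; rewrite subsetI subsetIl /=.
have kG : (g^-1 * h)%g \in G by rewrite groupM ?groupV.
have e : (A :&: B :^ g) :^ (g^-1 * h) = A :&: B :^ g := normP (subsetP nG _ kG).
have -> : B :^ h = (B :^ g) :^ (g^-1 * h) by rewrite -conjsgM mulKVg.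
by rewrite -e conjSg subsetIr.
Qed.

Lemma conj_of_locally_conj A B : A \subset G -> B \subset G ->
  (#|G : A| <= 5)%N -> (#|G : B| <= 5)%N -> locally_conj A B -> locally_conj B A ->
  exists2 g, g \in G & A :=: B :^ g.
Proof.
move=> sAG sBG A5 B5 locAB locBA.
have fin g : g \in G -> A \subset B :^ g -> (#|G : A| <= #|G : B|)%N -> A :=: B :^ g.
  move=> gG sAB le; apply/eqP; rewrite eqEcard sAB cardJg /=.
  by rewrite -(leq_pmul2r (indexg_gt0 G B)) (Lagrange sBG) -(Lagrange sAG) leq_mul2l le orbT.
have le_of_sub (C D : {group gT}) g : C \subset G -> D \subset G -> g \in G -> C \subset D :^ g ->
    (#|G : D| %| #|G : C|)%N.
  move=> sCG sDG gG sCD.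
  have <- : #|G : D :^ g| = #|G : D| by rewrite -{1}(conjGid gG) indexJg.
  exact: (@indexgS _ G C (D :^ g)%G sCD).
have [B4|B4] := leqP #|G : B| 4; have [A4|A4] := leqP #|G : A| 4.
- have [g gG sAB] := locally_conj_small sAG B4 locAB.
  have [h hG sBA] := locally_conj_small sBG A4 locBA.
  exists g => //; apply: fin => //; apply: dvdn_leq => //.
  exact: (le_of_sub B A h).
(* Mixed case: [A] lies in a conjugate of [B], whose index then divides 5 and so is 1. But [B = G]
   is transitive on the five cosets of [A]. *)
- have eA : #|G : A| = 5 by lia.
  have [g gG sAB] := locally_conj_small sAG B4 locAB.
  have := le_of_sub _ _ _ sAG sBG gG sAB; rewrite eA => /dvdn5/orP[|/eqP]; last by lia.
  rewrite indexg_eq1 => sGB; case: (not_transitive5 sBG locBA eA).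
  exists (A :* 1 : {set gT}); first by apply/rcosetsP; exists 1%g.
  by rewrite card_orbit_rcoset conjsg1 (_ : B :=: G) ?(setIidPr sAG) //; apply/eqP; rewrite eqEsubset sBG.
- have eB : #|G : B| = 5 by lia.
  have [g gG sBA] := locally_conj_small sBG A4 locBA.
  have := le_of_sub _ _ _ sBG sAG gG sBA; rewrite eB => /dvdn5/orP[|/eqP]; last by lia.
  rewrite indexg_eq1 => sGA; case: (not_transitive5 sAG locAB eB).
  exists (B :* 1 : {set gT}); first by apply/rcosetsP; exists 1%g.
  by rewrite card_orbit_rcoset conjsg1 (_ : A :=: G) ?(setIidPr sBG) //; apply/eqP; rewrite eqEsubset sAG.
have eA : #|G : A| = 5 by lia.
have eB : #|G : B| = 5 by lia.
suff [g gG sAB] : exists2 g, g \in G & A \subset B :^ g by exists g => //; apply: fin => //; rewrite eA eB.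
apply: fixed_rcoset.
case: (pickP (fun x : {set gT} => (x \in rcosets B G) && (#|orbit 'Rs A x| <= 1)%N)).
  by move=> x /andP[xX o1]; exists x.
move=> none; have o1 x : x \in rcosets B G -> (1 < #|orbit 'Rs A x|)%N.
  by move=> xX; have := none x; rewrite xX /= ltnNge => ->.
have actA : [acts A, on rcosets B G | 'Rs] := subset_trans sAG (actsRs_rcosets B G).
have X5 : #|rcosets B G| = 5 by exact: eB.
(* Without a fixed coset the orbits have size at least 2. Since 5 is odd, some orbit does not have
   size 2; it is not everything either, so the orbits have sizes 3 and 2. *)
have [x3 x3X o3] : exists2 x, x \in rcosets B G & #|orbit 'Rs A x| != 2.
  case: (pickP (fun x : {set gT} => (x \in rcosets B G) && (#|orbit 'Rs A x| != 2))).
    by move=> x /andP[xX o2]; exists x.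
  move=> all2; have := acts_sum_card_orbit actA; rewrite X5.
  rewrite (eq_bigr (fun=> 2)) ?sum_nat_const => [|_ /imsetP[x xX ->]]; first by lia.
  by have := all2 x; rewrite xX /= => /negbFE/eqP.
have [x2 x2X x23] : exists2 x, x \in rcosets B G & x \notin orbit 'Rs A x3.
  case: (pickP (fun x : {set gT} => (x \in rcosets B G) && (x \notin orbit 'Rs A x3))).
    by move=> x /andP[xX o2]; exists x.
  move=> alln; case: (not_transitive5 sAG locAB eB); exists x3 => //; rewrite -X5.
  congr #|pred_of_set _|; apply/eqP; rewrite eqEsubset (orbit_sub_X actA) //=.
  by apply/subsetP => x xX; have := alln x; rewrite xX /= => /negbFE.
have [e|] := orbit_eq_or_small actA x2X x3X; first by move: x23; rewrite -e orbit_refl.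
have := o1 _ x2X; have := o1 _ x3X; rewrite X5 => h3 h2 h23.
have {}h2 : #|orbit 'Rs A x2| = 2 by move: o3 h3 h2 h23; move: #|orbit _ _ x2| #|orbit _ _ x3|; lia.
have [g gG eg] := rcosetsP x2X; have [h hG eh] := rcosetsP x3X.
rewrite eg card_orbit_rcoset in h2; move: o3 h3; rewrite eh card_orbit_rcoset => o3 h3.
have := index5_orbits_bound sAG sBG eA eB gG hG h2; move: o3 h3; move: #|A : _|; lia.
Qed.

End Conjugacy.

Local Close Scope group_scope.
Local Open Scope ring_scope.

(** * The order Z[X]/(f) and its multiplication matrices *)

Section Companion.
Variables (m : nat) (f : {poly int}).
Hypotheses (f_monic : f \is monic) (f_size : size f = m.+2).
Local Notation n := m.+1.

(** Companion matrix of [f] acting on row vectors from the right: multiplication by X on Z[X]/(f) in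
    the basis 1, X, ..., X^m. *)
Definition comp_mx : 'M[int]_n :=
  \matrix_(i, j) if i == m :> nat then - f`_j else (i.+1 == j :> nat)%:R.
Local Notation C := comp_mx.

(** Multiplication by the class of [x]. The ring Z[X]/(f) is thus modelled by row vectors with
    product [x *m M y] and unit [e0], and [\det (M x)] is the norm. *)
Definition mult_mx (x : 'rV[int]_n) : 'M[int]_n := \sum_j x 0 j *: C ^+ j.
Local Notation M := mult_mx.

Definition e0 : 'rV[int]_n := delta_mx 0 0.

Lemma e0_comp_exp (j : 'I_n) : e0 *m C ^+ j = delta_mx 0 j.
Proof.
case: j => j; elim: j => [|j IH] ltj; first by rewrite expr0 mulmx1; congr delta_mx; apply/val_inj.
rewrite exprSr -mulmxE mulmxA (IH (ltnW ltj)).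
apply/rowP => i; rewrite -rowE !mxE /= (@ltn_eqF j m ltj) eq_sym.
by rewrite -val_eqE.
Qed.

Lemma mult_mxB : {morph M : x y / x - y}.
Proof.
move=> x y; rewrite /M -sumrB; apply: eq_bigr => i _.
by rewrite -scalerBl !mxE.
Qed.

Lemma mult_mxD : {morph M : x y / x + y}.
Proof.
move=> x y; rewrite /M -big_split; apply: eq_bigr => i _ /=.
by rewrite -scalerDl !mxE.
Qed.

Lemma mult_mxZ a x : M (a *: x) = a *: M x.
Proof.
rewrite /M scaler_sumr; apply: eq_bigr => i _ /=.
by rewrite scalerA !mxE.
Qed.

Lemma mult_mx_e0 : M e0 = 1%:M.
Proof.
rewrite /M (bigD1 0) //= big1 ?addr0 ?expr0 => [|i ni]; rewrite mxE eqxx //.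
  by rewrite scale1r.
by rewrite (negPf ni) scale0r.
Qed.

Lemma comp_mult_comm x : C *m M x = M x *m C.
Proof.
rewrite /M mulmx_suml mulmx_sumr; apply: eq_bigr => i _.
by rewrite -scalemxAl -scalemxAr !mulmxE -exprS -exprSr.
Qed.

Lemma comp_exp_comm P i : C *m P = P *m C -> C ^+ i *m P = P *m C ^+ i.
Proof.
move=> h; elim: i => [|i IH]; first by rewrite expr0 mul1mx mulmx1.
by rewrite exprS -mulmxE -mulmxA IH mulmxA h -mulmxA.
Qed.

Lemma mult_mxC x y : M x *m M y = M y *m M x.
Proof.
rewrite {1 4}/M mulmx_suml mulmx_sumr; apply: eq_bigr => i _.
by rewrite -scalemxAl -scalemxAr comp_exp_comm // comp_mult_comm.
Qed.

Lemma e0_mult_mx x : e0 *m M x = x.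
Proof.
rewrite mulmx_sumr; under eq_bigr => i _ do rewrite -scalemxAr e0_comp_exp.
by rewrite [RHS]row_sum_delta.
Qed.

(** [e0] is a cyclic vector of the companion matrix, so a matrix commuting with it is determined by
    the image of [e0]. *)
Lemma mult_mx_of_comm P : C *m P = P *m C -> M (e0 *m P) = P.
Proof.
move=> h; apply/row_matrixP => i; rewrite !rowE -e0_comp_exp -!mulmxA.
by rewrite !comp_exp_comm ?comp_mult_comm // !mulmxA e0_mult_mx.
Qed.

Lemma mult_mxM x y : M (x *m M y) = M x *m M y.
Proof.
rewrite -{1}[x]e0_mult_mx -mulmxA mult_mx_of_comm //.
by rewrite mulmxA comp_mult_comm -mulmxA comp_mult_comm mulmxA.
Qed.

Lemma mult_mx_sym x y : x *m M y = y *m M x.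
Proof. by rewrite -{1}[x]e0_mult_mx -mulmxA mult_mxC mulmxA e0_mult_mx. Qed.

Section Eval.
Variables (k : fieldType).
Local Notation toK := (fun z : int => z%:~R : k).
Local Notation "A ^k" := (map_mx toK A) (at level 2, format "A ^k").

(** At a root [r] of [f] this is the ring morphism Z[X]/(f) -> [k] sending X to [r]. *)
Definition evalr (x : 'rV[int]_n) (r : k) : k := \sum_j (x 0 j)%:~R * r ^+ j.
Definition evec (r : k) : 'cV[k]_n := \col_j r ^+ j.

Lemma evalrE x r : evalr x r = (x^k *m evec r) 0 0.
Proof. by rewrite !mxE; apply: eq_bigr => j _; rewrite !mxE. Qed.

Lemma comp_evec r : root (map_poly toK f) r -> C^k *m evec r = r *: evec r.
Proof.
move=> /rootP rt; apply/matrixP => i j; rewrite !mxE.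
case: (eqVneq (i : nat) m) => [im|im].
  under eq_bigr => l _ do rewrite !mxE im eqxx rmorphN mulNr.
  rewrite sumrN im; move: rt; rewrite horner_coef size_map_poly_id0; last first.
    by rewrite (monicP f_monic) oner_eq0.
  rewrite f_size big_ord_recr /= coef_map /=.
  have -> : f`_n = 1 by move/monicP: f_monic; rewrite lead_coefE f_size.
  rewrite mul1r exprS => /eqP; rewrite addrC addr_eq0 => /eqP ->.
  by congr (- _); apply: eq_bigr => l _; rewrite coef_map.
have ltim : (i < m)%N by rewrite ltn_neqAle im -ltnS ltn_ord.
have lti : (i.+1 < n)%N by [].
rewrite (bigD1 (Ordinal lti)) //= !mxE /= (negPf im) eqxx mul1r.
rewrite big1 ?addr0 ?exprS // => l nl; rewrite !mxE (negPf im).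
by rewrite -val_eqE /= eq_sym in nl; rewrite (negPf nl) mul0r.
Qed.

Lemma mult_evec x r : root (map_poly toK f) r -> (M x)^k *m evec r = evalr x r *: evec r.
Proof.
move=> rt; rewrite /M raddf_sum mulmx_suml /evalr scaler_suml.
apply: eq_bigr => j _ /=.
have -> : (x 0 j *: C ^+ j)^k = (x 0 j)%:~R *: (C ^+ j)^k.
  by apply/matrixP => a b; rewrite !mxE rmorphM.
rewrite -scalemxAl -scalerA; congr (_ *: _).
elim: (j : nat) => [|i IH]; first by rewrite !expr0 scale1r map_mx1 mul1mx.
by rewrite exprSr map_mxM -mulmxA comp_evec // -scalemxAr IH scalerA exprS.
Qed.

Lemma evalr_mult x y r : root (map_poly toK f) r -> evalr (x *m M y) r = evalr x r * evalr y r.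
Proof.
move=> rt; rewrite !evalrE map_mxM -mulmxA mult_evec // -scalemxAr mxE mulrC.
by rewrite -!evalrE.
Qed.

Variable rho : 'I_n -> k.
Hypotheses (rho_inj : injective rho) (rho_root : forall i, root (map_poly toK f) (rho i)).

Definition vdm : 'M[k]_n := \matrix_(j, i) rho i ^+ j.

Lemma vdm_unit : vdm \in unitmx.
Proof.
have -> : vdm = Vandermonde n (\row_i rho i).
  by apply/matrixP => i j; rewrite !mxE.
rewrite unitmxE unitfE det_Vandermonde; apply/prodf_neq0 => i _.
by apply/prodf_neq0 => j ij; rewrite !mxE subr_eq0 (inj_eq rho_inj) neq_ltn ij orbT.
Qed.

(** The columns of the Vandermonde matrix are common eigenvectors of all multiplications. This is
    used over [algC] for the size of norms and in characteristic [p] for their valuations. *)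
Lemma mult_vdm x : (M x)^k *m vdm = vdm *m diag_mx (\row_i evalr x (rho i)).
Proof.
apply/matrixP => i j; rewrite mul_mx_diag.
have /matrixP /(_ i 0) := mult_evec x (rho_root j).
rewrite !mxE mulrC => <-.
by apply: eq_bigr => l _; rewrite !mxE.
Qed.

Lemma det_mult x : (\det (M x))%:~R = \prod_i evalr x (rho i).
Proof.
have u : \det vdm != 0 by rewrite -unitfE -unitmxE vdm_unit.
apply: (mulIf u); rewrite -det_map_mx -det_mulmx mult_vdm det_mulmx det_diag mulrC.
by congr (_ * _); apply: eq_bigr => i _; rewrite !mxE.
Qed.

End Eval.
End Companion.

(** * Valuations of norms at a prime where [f] has distinct roots *)

(** By pigeonhole each permutation of the Leibniz expansion meets a zero block with
    [#|J| + #|I| > n], so the determinant would vanish. *)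
Lemma unitmx_zero_block (k : fieldType) n (W : 'M[k]_n) (J I : {set 'I_n}) :
  W \in unitmx -> (forall j i, j \in J -> i \in I -> W j i = 0) -> (#|J| + #|I| <= n)%N.
Proof.
rewrite unitmxE unitfE => uW W0; rewrite leqNgt; apply: contra uW => lt_n.
rewrite /determinant big1 // => s _.
have [j jJ sjI] : exists2 j, j \in J & s j \in I.
  have : (0 < #|(s @: J) :&: I|)%N.
    rewrite -(ltn_add2r #|(s @: J) :|: I|) add0n addnC cardsUI card_imset; last exact: perm_inj.
    by rewrite (leq_ltn_trans _ lt_n) // -[leqRHS]card_ord max_card.
  by case/card_gt0P => i; rewrite inE => /andP[/imsetP[j jJ ->] jI]; exists j.
by rewrite (bigD1 j) //= W0 // mul0r mulr0.
Qed.

Lemma unitmx_int_norm n (U : 'M[int]_n) : U \in unitmx -> `|\det U|%N = 1%N.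
Proof.
move=> uU; have /(congr1 (fun A => `|\det A|%N)) := mulmxV uU.
by rewrite det_mulmx det1 abszM => /eqP; rewrite muln_eq1 => /andP[/eqP].
Qed.

Lemma intr_eq0_pchar (k : fieldType) p (z : int) : p \in [pchar k] ->
  (z%:~R == 0 :> k) = (p %| `|z|)%N.
Proof.
move=> ck; case: z => z; rewrite ?NegzE ?rmorphN ?oppr_eq0 /= ?abszN.
  by rewrite -pmulrn -(dvdn_pcharf ck).
by rewrite -pmulrn -(dvdn_pcharf ck).
Qed.

Lemma absz_prod (I : finType) (F : I -> int) : absz (\prod_i F i) = (\prod_i absz (F i))%N.
Proof. by apply: (big_morph absz abszM). Qed.

Lemma logn_prod (I : finType) (F : I -> nat) p :
  (forall i, 0 < F i)%N -> logn p (\prod_i F i) = (\sum_i logn p (F i))%N.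
Proof.
move=> F0; suff [] : logn p (\prod_i F i) = (\sum_i logn p (F i))%N /\ (0 < \prod_i F i)%N by [].
apply: (big_rec2 (fun a b => logn p a = b /\ (0 < a)%N)) => [|i a b _ [<- a0]].
  by rewrite logn1.
by rewrite lognM // muln_gt0 F0 a0.
Qed.

Lemma logn_le_count_dvd p a K : prime p -> (0 < a)%N -> (logn p a <= K)%N ->
  logn p a = (\sum_(1 <= j < K.+1) (p ^ j %| a))%N.
Proof.
move=> pp a0 le.
have tl : (\sum_((logn p a).+1 <= j < K.+1) (p ^ j %| a) = 0)%N.
  by rewrite big_nat big1 // => i /andP[li _]; rewrite pfactor_dvdn // leqNgt li.
rewrite (big_cat_nat (n := (logn p a).+1)) //= tl addn0.
rewrite big_nat (eq_bigr (fun=> 1%N)) => [|i /andP[_ li]].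
  by rewrite -big_nat sum_nat_const_nat muln1 subn1.
by rewrite pfactor_dvdn // -ltnS li.
Qed.

Lemma dvdn_abszD d (a b : int) : (d %| absz a)%N -> (d %| absz b)%N -> (d %| absz (a + b)%R)%N.
Proof. by rewrite -[d]/(absz d%:Z) -!dvdzE; apply: rpredD. Qed.

Section Local.
Variables (m : nat) (f : {poly int}).
Hypotheses (f_monic : f \is monic) (f_size : size f = m.+2).
Local Notation n := m.+1.
Local Notation M := (mult_mx (m := m) f).
Variables (p : nat) (k : fieldType).
Hypotheses (p_pr : prime p) (pk : p \in [pchar k]).
Local Notation toK := (fun z : int => z%:~R : k).
Local Notation "A ^k" := (map_mx toK A) (at level 2, format "A ^k").
Variable rho : 'I_n -> k.
Hypotheses (rho_inj : injective rho) (rho_root : forall i, root (map_poly toK f) (rho i)).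

Lemma unitmx_toK (U : 'M[int]_n) : U \in unitmx -> U^k \in unitmx.
Proof.
move=> uU; rewrite unitmxE unitfE det_map_mx /= (intr_eq0_pchar _ pk).
by rewrite unitmx_int_norm // dvdn1 neq_ltn prime_gt1 ?orbT.
Qed.

Lemma smith_logn c : \det (M c) != 0 ->
  exists L R : 'M[int]_n, exists d : 'rV[int]_n, [/\ L \in unitmx, R \in unitmx,
    M c = L *m diag_mx d *m R,
    forall i, (0 < absz (d 0%R i))%N & logn p `|\det (M c)| = (\sum_i logn p (absz (d 0%R i)))%N].
Proof.
have [L uL [R uR [d _ DM]]] := int_Smith_normal_form (M c).
set D := (X in L *m X *m R) in DM.
have DE : D = diag_mx (\row_i d`_i).
  by apply/matrixP => i j; rewrite !mxE.
rewrite DE in DM; move: (\row_i _) DM => d1 DM nz; exists L, R, d1.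
rewrite DM !det_mulmx det_diag in nz *.
have nzd i : (0 < absz (d1 0%R i))%N.
  rewrite absz_gt0; apply: contra nz => /eqP d0; apply/eqP.
  by rewrite (bigD1 i) //= d0 !(mul0r, mulr0).
by split=> //; rewrite !abszM !unitmx_int_norm // mul1n muln1 absz_prod logn_prod.
Qed.

(** Write [M c = L D R] in Smith form. In the eigenbasis, a diagonal entry of [D] prime to [p] and a
    root where [c] vanishes meet in a zero entry of the unit [R V]. The zero block bound gives at
    least as many entries divisible by [p] as such roots. *)
Lemma logn_det_ge c : \det (M c) != 0 ->
  (#|[set i | evalr c (rho i) == 0%R]| <= logn p `|\det (M c)|)%N.
Proof.
move=> /smith_logn[L [R [d [uL uR DM nzd ->]]]].
have uV := vdm_unit rho_inj.
have uW : R^k *m vdm rho \in unitmx by rewrite unitmx_mul unitmx_toK.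
pose J := [set j | ~~ (p %| absz (d 0%R j))%N].
have : (#|J| + #|[set i | evalr c (rho i) == 0%R]| <= n)%N.
  apply: unitmx_zero_block uW _ => j i.
  rewrite !inE => dj /eqP ci.
  have /(congr1 (mulmx (invmx L^k))) := mult_vdm f_monic f_size rho_root c.
  rewrite DM !map_mxM !mulmxA mulVmx ?unitmx_toK // mul1mx map_diag_mx.
  move=> /matrixP /(_ j i); rewrite -mulmxA mul_diag_mx mul_mx_diag !mxE ci mulr0 => /eqP.
  by rewrite mulf_eq0 (intr_eq0_pchar _ pk) (negPf dj) => /eqP.
rewrite -[leqRHS]card_ord -(cardsC J) leq_add2l => /leq_trans; apply.
rewrite -sum1_card big_mkcond; apply: leq_sum => j _; case: ifP => //.
by rewrite !inE negbK => dj; rewrite logn_gt0 mem_primes p_pr nzd.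
Qed.

(* The contraction to Z[X]/(f) of the [j]-th power of the maximal ideal at [r]. *)
Definition in_pow (r : k) (j : nat) (c : 'rV[int]_n) : Prop :=
  exists2 x : 'rV[int]_n, evalr x r != 0 & forall i, (p ^ j %| absz ((x *m M c) 0%R i))%N.

(** The converse estimate at every level [j]: row [a] of the inverse of [L] multiplies [c] into the
    multiples of [d_a]. If [p ^ j] divides [d_a], this row witnesses [in_pow] at each root where its
    value is nonzero, so the other roots form a zero block. [K] only truncates the sum over
    levels. *)
Lemma logn_det_le c K : \det (M c) != 0 -> (logn p `|\det (M c)| <= K)%N ->
  (logn p `|\det (M c)| <= \sum_(1 <= j < K.+1) \sum_i `[< in_pow (rho i) j c >])%N.
Proof.
move=> /smith_logn[L [R [d [uL uR DM nzd ->]]]] leK.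
rewrite (eq_bigr (fun i => (\sum_(1 <= j < K.+1) (p ^ j %| absz (d 0%R i)))%N)); last first.
  move=> i _; apply: logn_le_count_dvd => //; apply: leq_trans leK.
  by rewrite (bigD1 i) //= leq_addr.
rewrite exchange_big /=; apply: leq_sum => j _.
have uV := vdm_unit rho_inj.
have uW : (invmx L)^k *m vdm rho \in unitmx.
  by rewrite unitmx_mul unitmx_toK ?unitmx_inv.
pose J := [set i | (p ^ j %| absz (d 0%R i))%N].
pose I := [set i | ~~ `[< in_pow (rho i) j c >]].
have : (#|J| + #|I| <= n)%N.
  apply: unitmx_zero_block uW _ => a i.
  rewrite !inE => da; apply: contraNeq => nz; apply/asboolP.
  exists (row a (invmx L)).
    rewrite evalrE; apply: contra nz => /eqP <-; rewrite !mxE; apply/eqP.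
    by apply: eq_bigr => b _; rewrite !mxE.
  move=> b; rewrite -row_mul DM !mulmxA mulVmx // mul1mx mul_diag_mx !mxE abszM.
  exact: dvdn_mulr.
rewrite -[leqRHS]card_ord -(cardsC I) addnC leq_add2l => le.
suff [-> ->] : (\sum_i (p ^ j %| absz (d 0%R i)) = #|J|)%N /\
      (\sum_i `[< in_pow (rho i) j c >] = #|~: I|)%N by [].
by split; rewrite -sum1_card [RHS]big_mkcond; apply: eq_bigr => i _; rewrite !inE ?negbK; case: ifP => // ->.
Qed.

(** The product of the two witnesses serves both elements, and its value at [r] is nonzero because
    [k] is a field. *)
Lemma in_powB r j c c' : root (map_poly toK f) r ->
  in_pow r j c -> in_pow r j c' -> in_pow r j (c - c').
Proof.
move=> rt [x xr xc] [y yr yc]; exists (x *m M y).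
  by rewrite (evalr_mult f_monic f_size) // mulf_neq0.
have sw (u v w : 'rV[int]_n) : u *m M v *m M w = u *m M w *m M v.
  by rewrite -!mulmxA mult_mxC.
move=> i; rewrite mult_mxB mulmxBr sw [x *m M y]mult_mx_sym [y *m _ *m M c']sw.
have dv (u v : 'rV[int]_n) (hu : forall i, (p ^ j %| absz (u 0%R i))%N) a : (p ^ j %| absz ((u *m M v) 0%R a))%N.
  rewrite mxE; apply: (@big_ind int (fun z => (p ^ j %| absz z)%N)) => [|u1 u2|b _] //; last first.
    by rewrite abszM dvdn_mulr.
  exact: dvdn_abszD.
rewrite mxE; apply: dvdn_abszD; first exact: dv.
by rewrite mxE abszN; apply: dv.
Qed.

Lemma in_powM r j c q : in_pow r j c -> in_pow r j (q *m M c).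
Proof.
move=> [x xr xc]; exists x => // i.
rewrite mult_mxM mult_mxC mulmxA mxE.
apply: (@big_ind int (fun z => (p ^ j %| absz z)%N)) => [|u1 u2|b _] //; last first.
  by rewrite abszM dvdn_mulr.
exact: dvdn_abszD.
Qed.

Lemma in_pow1 r c : root (map_poly toK f) r -> in_pow r 1 c -> evalr c r = 0.
Proof.
move=> rt [x xr xc]; apply/eqP.
suff: evalr x r * evalr c r == 0 by rewrite mulf_eq0 (negPf xr).
rewrite -(evalr_mult f_monic f_size) // /evalr big1 // => j _.
have /eqP -> : ((x *m M c) 0 j)%:~R == 0 :> k by rewrite (intr_eq0_pchar _ pk) -(expn1 p) xc.
by rewrite mul0r.
Qed.

Lemma in_powZ r j (D : int) c : coprime p (absz D) -> in_pow r j (D *: c) -> in_pow r j c.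
Proof.
move=> cD [x xr xc]; exists x => // i.
have := xc i; rewrite mult_mxZ -scalemxAr mxE abszM Gauss_dvdr //.
exact: coprimeXl.
Qed.

(** A witness has a coordinate prime to [p]. Hence 0, ..., p^j - 1 lie in distinct classes modulo
    the ideal, whose index is at least [p ^ j]. *)
Lemma in_pow_const r j (a : int) : in_pow r j (a *: e0 m) -> (p ^ j %| absz a)%N.
Proof.
move=> [x xr xc].
have [i xi] : exists i, ~~ (p %| absz (x 0%R i))%N.
  apply/existsP; apply: contraR xr; rewrite negb_exists => /forallP xi.
  rewrite /evalr big1 // => i _.
  by have := xi i; rewrite negbK -(intr_eq0_pchar _ pk) => /eqP ->; rewrite mul0r.
have := xc i; rewrite mult_mxZ mult_mx_e0 -scalemxAr mulmx1 mxE abszM mulnC Gauss_dvdr //.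
by apply: coprimeXl; rewrite prime_coprime.
Qed.

End Local.

(** * Sizes of norms, and packing of residue classes into boxes *)

Lemma leq_absz_sum (I : finType) (P : pred I) (F : I -> int) (G : I -> nat) :
  (forall i, P i -> (absz (F i) <= G i)%N) ->
  (absz (\sum_(i | P i) F i)%R <= \sum_(i | P i) G i)%N.
Proof.
move=> h; apply: (big_rec2 (fun a b => (absz a <= b)%N)) => // i a b Pi le.
have := h i Pi; lia.
Qed.

Lemma leq_absz_det n (A : 'M[int]_n) u : (forall i j, (absz (A i j) <= u)%N) ->
  (absz (\det A) <= n`! * u ^ n)%N.
Proof.
move=> hA; apply: (@leq_trans (\sum_(s : 'S_n) (u ^ n)))%N; last first.
  by rewrite sum_nat_const card_Sn.
rewrite /determinant; apply: leq_absz_sum => s _; rewrite abszM abszX abszN1 exp1n mul1n absz_prod.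
rewrite -[n in (u ^ n)%N]card_ord -prod_nat_const; exact: leq_prod.
Qed.

Lemma shift_bound (a R y : nat) (u : int) : (a < y)%N -> (absz u <= R)%N ->
  (absz (a%:Z + u + R%:Z)%R < (y + 2 * R).+1)%N.
Proof. lia. Qed.

Lemma shift_inj (a b R : nat) (u v : int) : (absz u <= R)%N -> (absz v <= R)%N ->
  absz (a%:Z + u + R%:Z) = absz (b%:Z + v + R%:Z) -> a%:Z + u = b%:Z + v.
Proof. lia. Qed.

Section Size.
Variables (m : nat) (f : {poly int}).
Local Notation n := m.+1.
Local Notation M := (mult_mx (m := m) f).
Local Notation C := (comp_mx m f).

Definition comp_max : nat := \max_(j < n) \max_(a < n) \max_(b < n) absz ((C ^+ j)%R a b).
Definition mult_cst : nat := (n * comp_max).+1.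

Lemma leq_absz_mult (x : 'rV[int]_n) t a b : (forall j, (absz (x 0%R j) <= t)%N) ->
  (absz (M x a b) <= mult_cst * t)%N.
Proof.
move=> hx; rewrite /mult_mx summxE.
apply: (@leq_trans (\sum_(j < n) (t * comp_max))%N); last first.
  by rewrite sum_nat_const card_ord /mult_cst; nia.
apply: leq_absz_sum => j _; rewrite mxE abszM leq_mul //.
apply: (bigop.bigmax_sup j) => //; apply: (bigop.bigmax_sup a) => //.
exact: (bigop.bigmax_sup b).
Qed.

Definition det_cst : nat := n`! * mult_cst ^ n.

Lemma leq_absz_det_mult (x : 'rV[int]_n) t : (forall j, (absz (x 0%R j) <= t)%N) ->
  (absz (\det (M x)) <= det_cst * t ^ n)%N.
Proof.
move=> hx; rewrite /det_cst -mulnA -expnMn; apply: leq_absz_det => i j.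
exact: leq_absz_mult.
Qed.

(** Division with remainder by [w]: take the integer part of each coordinate of the quotient
    [s / w], computed with the adjugate. The remainder is [w] times a vector with coordinates in [0,
    1), so its size depends on [w] alone. *)
Lemma reduce_mod_mult (w : 'rV[int]_n) t (s : 'rV[int]_n) : \det (M w) != 0 ->
  (forall j, (absz (w 0%R j) <= t)%N) ->
  exists q : 'rV[int]_n, forall i, (absz ((s - q *m M w)%R 0%R i) <= n * (mult_cst * t))%N.
Proof.
set D := \det _ => D0 hw; pose u := s *m \adj (M w).
exists (\row_i (u 0%R i %/ D)%Z) => i; set q := \row_i _.
have e : D *: (s - q *m M w) = (\row_j (u 0%R j %% D)%Z) *m M w.
  have mod_e (v : 'rV[int]_n) :
      \row_j (v 0%R j %% D)%Z = v - D *: \row_j (v 0%R j %/ D)%Z.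
    by apply/rowP => j; rewrite !mxE /modz mulrC.
  rewrite mod_e -/q.
  rewrite mulmxBl /u -mulmxA mul_adj_mx -/D mul_mx_scalar scalerBr.
  by rewrite -scalemxAl.
have D0' : (0 < absz D)%N by rewrite absz_gt0.
rewrite -(leq_pmul2l D0') -abszM.
have -> : D * (s - q *m M w) 0 i = (D *: (s - q *m M w)) 0 i by rewrite !mxE.
rewrite e mxE; apply: (@leq_trans (\sum_(j < n) (absz D * (mult_cst * t)))%N); last first.
  by rewrite sum_nat_const card_ord mulnCA.
apply: leq_absz_sum => j _; rewrite abszM leq_mul ?leq_absz_mult // mxE.
have := modz_ge0 (u 0 j) D0; have := ltz_mod (u 0 j) D0; lia.
Qed.

Definition box y := {ffun 'I_n -> 'I_y}.
Definition vec y (a : box y) : 'rV[int]_n := \row_j (a j : nat)%:Z.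

Lemma card_box y : #|{: box y}| = (y ^ n)%N.
Proof. by rewrite card_ffun !card_ord. Qed.

Lemma vec_inj y : injective (@vec y).
Proof.
move=> a b /rowP e; apply/ffunP => j; apply: val_inj.
by have := e j; rewrite !mxE => -[].
Qed.

Lemma vecB_neq0 y (a b : box y) : a != b -> vec a - vec b != 0.
Proof. by rewrite subr_eq0 (inj_eq (@vec_inj y)). Qed.

Lemma vecB_le y (a b : box y) j : (absz ((vec a - vec b)%R 0%R j) <= y)%N.
Proof.
rewrite !mxE; have := ltn_ord (a j); have := ltn_ord (b j); lia.
Qed.

(** Packing. The representatives [s] are first reduced modulo [w] to size at most [R]; then the sums
    of a point of [A] and a representative are pairwise distinct, since their classes modulo [I]
    recover the representative. After a shift by [R] they lie in a box of side [y + 2 R + 1]. *)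
Lemma card_coset_box (I : 'rV[int]_n -> Prop) (w : 'rV[int]_n) t y (T : finType)
    (s : T -> 'rV[int]_n) (A : {set box y}) :
  (forall u v, I u -> I v -> I (u - v)) -> (forall q u, I u -> I (q *m M u)) ->
  I w -> \det (M w) != 0 -> (forall j, (absz (w 0%R j) <= t)%N) ->
  (forall a b, I (s a - s b) -> a = b) ->
  (forall a b, a \in A -> b \in A -> I (vec a - vec b)) ->
  (#|A| * #|T| <= (y + 2 * (n * (mult_cst * t))).+1 ^ n)%N.
Proof.
move=> IB IM Iw w0 wt sI AI; set R := (n * _)%N.
have /choice[q hq] := fun a => reduce_mod_mult (s a) w0 wt.
pose s' a := s a - q a *m M w.
have hs a j : (absz (s' a 0%R j) <= R)%N by apply: hq.
clearbody R.
have I0 : I 0 by rewrite -(subrr w); apply: IB.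
have IN u : I u -> I (- u) by rewrite -sub0r => Iu; apply: IB.
have s'I a b : I (s' a - s' b) -> a = b.
  move=> Iab; apply: sI.
  have -> : s a - s b = (s' a - s' b) - ((q b - q a) *m M w).
    by rewrite /s' mulmxBl; move: (q a *m _) (q b *m _) => u v; apply/rowP => j; rewrite !mxE; ring.
  by apply: IB => //; apply: IM.
pose g (at_ : box y * T) : box (y + 2 * R).+1 :=
  [ffun j => inord (absz ((vec at_.1 + s' at_.2) 0%R j + R%:Z)%R)].
have ginj : {in setX A [set: T] &, injective g}.
  move=> [a c] [b d]; rewrite !inE /= !andbT => aA bA /ffunP e.
  have {}e : vec a + s' c = vec b + s' d.
    apply/rowP => j; have := congr1 val (e j); rewrite !ffunE /=.
    have sE (a0 : box y) u : (vec a0 + u) 0 j = (a0 j : nat)%:Z + u 0 j by rewrite !mxE.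
    rewrite !sE !inordK ?shift_bound //.
    exact: shift_inj.
  have cd : c = d.
    apply: s'I; have -> : s' c - s' d = vec b - vec a.
      have -> : s' c = vec b + s' d - vec a by rewrite -e addrAC subrr add0r.
      by rewrite addrAC addrK.
    exact: AI.
  by move: e; rewrite cd => /addIr /vec_inj ->.
rewrite -cardsT -cardsX -(card_in_imset ginj).
by rewrite -card_box max_card.
Qed.
(** The element 1 + D z. With [D] a factorial its norm is prime to all small primes, so the
    discarded primes do not enter the factorization. *)
Definition shifted D y (z : box y) : 'rV[int]_n := e0 m + D%:Z *: vec z.

Lemma evalr_shifted (k : fieldType) D y (z : box y) (r : k) :
  evalr (shifted D z) r = 1 + D%:R * evalr (vec z) r.
Proof.
rewrite /evalr /shifted; under eq_bigr => j _ do rewrite !mxE rmorphD rmorphM mulrDl /= -mulrA.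
rewrite big_split /= -mulr_sumr; congr (_ + _ * _).
  rewrite (bigD1 0) //= big1 ?addr0 ?expr0 ?mulr1 // => j /negPf j0.
  by rewrite j0 mul0r.
by apply: eq_bigr => j _; rewrite !mxE.
Qed.

Lemma shifted_neq0 D y (z : box y) : shifted D z != 0.
Proof.
apply/eqP => /rowP/(_ 0); rewrite !mxE eqxx => /eqP.
by rewrite -PoszM eqxx /=; move: (D * _)%N => a; lia.
Qed.

(** The packing bound when [w] is itself of size [D.+1 * y]; the first 2 absorbs [y + 1 <= 2 y]. *)
Definition crude_cst (D : nat) : nat := ((2 + 2 * (n * (mult_cst * D.+1))) ^ n)%N.

Lemma shifted_le D y (z : box y) j : (absz (shifted D z 0%R j) <= D.+1 * y)%N.
Proof.
case: y z => [|y] z; first by case: (z 0).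
rewrite !mxE; have := ltn_ord (z j); case: (_ && _) => /= h; nia.
Qed.

Lemma crude_le D y : (0 < y)%N ->
  ((y + 2 * (n * (mult_cst * (D.+1 * y)))).+1 ^ n <= crude_cst D * y ^ n)%N.
Proof. by move=> y0; rewrite /crude_cst -expnMn leq_exp2r //; move: mult_cst; nia. Qed.

End Size.

(** * Nonvanishing of norms and rarity of small norms *)

Lemma card_near (y s : nat) (D : nat) (w : algC) : (0 < D)%N ->
  (#|[set a : 'I_y | (`|(D * a)%N%:R + w| < s%:R :> algC)%R]| <= 2 * s)%N.
Proof.
move=> D0; set A := [set a | _].
have [->|[a0 a0A]] := set_0Vmem A; first by rewrite cards0.
pose a1 := [arg min_(a < a0 in A) (a : nat)]%N.
have [a1A a1m] : a1 \in A /\ forall b, b \in A -> (a1 <= b)%N.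
  by rewrite /a1; case: arg_minnP => //= i iA im.
have bd b : b \in A -> (b - a1 < 2 * s)%N.
  move=> bA; have le := a1m b bA.
  rewrite -(ltr_nat algC) natrM mulr_natl mulr2n.
  apply: le_lt_trans (_ : `|(D * b)%N%:R + w| + `|(D * a1)%N%:R + w| < _); last first.
    by apply: ltrD; [move: bA|move: a1A]; rewrite inE.
  rewrite -[X in _ + X]normrN; apply: le_trans (ler_normD _ _).
  rewrite opprD addrACA subrr addr0 -natrB ?leq_mul2l ?le ?orbT // -mulnBr normr_nat ler_nat.
  exact: leq_pmull.
rewrite cardE -(size_map val) -[(2 * s)%N](size_iota a1).
apply: uniq_leq_size; first by rewrite map_inj_uniq ?enum_uniq //; apply: val_inj.
move=> _ /mapP[b + ->]; rewrite mem_enum mem_iota => bA /=.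
by have := bd b bA; have := a1m b bA; lia.
Qed.

Section Nonvanishing.
Variables (m : nat) (f : {poly int}).
Hypotheses (f_monic : f \is monic) (f_size : size f = m.+2).
Hypothesis f_irr : irreducible_poly (map_poly intr f : {poly rat}).
Local Notation n := m.+1.
Local Notation M := (mult_mx (m := m) f).

(** Irreducibility makes [f] coprime to every nonzero rational polynomial of smaller degree: to its
    derivative, so the roots are distinct, and to the polynomial with coefficients [x]. *)
Lemma complex_roots : exists theta : 'I_n -> algC, [/\ injective theta,
  forall i, root (map_poly intr f) (theta i) &
  forall (x : 'rV[int]_n) i, x != 0 -> evalr x (theta i) != 0].
Proof.
pose fQ : {poly rat} := map_poly intr f; pose fC : {poly algC} := map_poly intr f.
have fCE : fC = map_poly ratr fQ.
  by rewrite /fQ -map_poly_comp; apply: eq_map_poly => z /=; rewrite rmorph_int.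
have szQ : size fQ = n.+1.
  by rewrite size_map_poly_id0 ?f_size // (monicP f_monic) oner_eq0.
have cop (q : {poly rat}) : q != 0 -> (size q <= n)%N -> coprimep fC (map_poly ratr q).
  move=> q0 sq; rewrite fCE coprimep_map irreducible_poly_coprime //.
  by apply/negP => /dvdp_leq -/(_ q0); rewrite szQ leqNgt ltnS sq.
have [rs Ers] := closed_field_poly_normal fC.
have mC : fC \is monic by apply: monic_map.
rewrite (monicP mC) scale1r in Ers.
have szr : size rs = n.
  apply/eqP; rewrite -eqSS -(size_prod_XsubC _ id) -Ers fCE size_map_poly szQ //.
have sep : uniq rs.
  rewrite -separable_prod_XsubC -Ers unlock fCE deriv_map -fCE cop //.
    apply/eqP => /polyP/(_ m); rewrite coef_deriv coef_map coef0 /=.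
    have -> : f`_n = 1 by move/monicP: f_monic; rewrite lead_coefE f_size.
    by move/eqP; rewrite pnatr_eq0.
  by rewrite -ltnS -szQ lt_size_deriv // -size_poly_gt0 szQ.
exists (fun i => rs`_i); split.
- move=> i j /eqP; rewrite nth_uniq ?szr ?ltn_ord // => /eqP; exact: val_inj.
- by move=> i; rewrite -/fC Ers root_prod_XsubC mem_nth ?szr.
move=> x i x0.
pose q : {poly rat} := \poly_(j < n) (x 0 (inord j))%:~R.
have q0 : q != 0.
  apply: contra x0 => /eqP/polyP q0; apply/eqP/rowP => j.
  have := q0 j; rewrite coef_poly coef0 ltn_ord inord_val mxE => /eqP.
  by rewrite intr_eq0 => /eqP.
have := coprimep_root (cop q q0 (size_poly _ _)).
move=> /(_ rs`_i); rewrite Ers root_prod_XsubC mem_nth ?szr // => /(_ isT).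
rewrite (@horner_coef_wide _ n) ?size_map_poly ?size_poly //.
under eq_bigr => j _.
  rewrite coef_map coef_poly ltn_ord inord_val /= ratr_int; over.
by [].
Qed.

Lemma det_mult_neq0 (x : 'rV[int]_n) : x != 0 -> \det (M x) != 0.
Proof.
move=> x0; have [th [thI thr thn]] := complex_roots.
rewrite -(intr_eq0 algC) (det_mult f_monic f_size thI thr).
by apply/prodf_neq0 => i _; apply: thn.
Qed.

Definition upd0 y (z : box m y) (a : 'I_y) : box m y := [ffun j => if j == 0 then a else z j].

(** A norm below [s ^ n] forces some conjugate to have modulus below [s]. With the other coordinates
    fixed, this conjugate is [D * a + w i] in coordinate 0, so at most [2 * s] values of [a] qualify
    for each of the [n] conjugates. *)
Lemma card_small_norm y s D : (0 < D)%N ->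
  (y * #|[set z : box m y | absz (\det (M (shifted D z))) < s ^ n]| <= y ^ n * (n * (2 * s)))%N.
Proof.
move=> D0; have [th [thI thr thn]] := complex_roots.
pose bad (z : box m y) := (absz (\det (M (shifted D z))) < s ^ n)%N.
rewrite -/(bad _) -[y in (y * _)%N]card_ord -cardsT mulnC -cardsX.
(* Exchanging the free value [a] with coordinate 0 is an involution; it turns [y] copies of the bad
   set into a count along lines. *)
have sw : (#|setX [set z | bad z] [set: 'I_y]| = \sum_z #|[set a | bad (upd0 z a)]|)%N.
  pose g (za : box m y * 'I_y) := (upd0 za.1 za.2, za.1 0).
  have gK : involutive g.
    move=> [z a]; rewrite /g /=; congr (_, _); last by rewrite ffunE eqxx.
    by apply/ffunP => j; rewrite !ffunE; case: eqP => // ->.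
  rewrite -sum1_card (reindex_inj (inv_inj gK)) /=.
  rewrite (eq_bigl (fun za => bad (upd0 za.1 za.2))); last by move=> [z a]; rewrite !inE andbT.
  rewrite -(pair_big_dep xpredT (fun z a => bad (upd0 z a)) (fun _ _ => 1%N)) /=.
  by apply: eq_bigr => z _; rewrite -sum1_card; apply: eq_bigl => a; rewrite inE.
rewrite sw -card_box -sum_nat_const; apply: leq_sum => z _.
pose w i := 1 + D%:R * \sum_(j < n | j != 0) (z j)%:R * th i ^+ j.
apply: (@leq_trans (\sum_(i < n) #|[set a : 'I_y | (`|(D * a)%N%:R + w i| < s%:R :> algC)%R]|)%N); last first.
  rewrite -[n in (n * _)%N]card_ord -sum_nat_const; apply: leq_sum => i _; exact: card_near.
under [leqRHS]eq_bigr => i _ do rewrite -sum1_card big_mkcond.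
rewrite exchange_big -sum1_card big_mkcond; apply: leq_sum => a _ /=.
case: ifP => //; rewrite inE => ba.
suff [i hi] : exists i, a \in [set a : 'I_y | (`|(D * a)%N%:R + w i| < s%:R :> algC)%R].
  by rewrite (bigD1 i) //= hi.
apply/existsP; move: ba; apply: contraLR; rewrite negb_exists => /forallP hi.
rewrite /bad -leqNgt -(ler_nat algC) natr_absz intr_norm (det_mult f_monic f_size thI thr).
rewrite normr_prod natrX -[n in _ ^+ n]card_ord -prodr_const; apply: ler_prod => i _.
rewrite ler0n /=; have := hi i; rewrite inE.
suff -> : evalr (shifted D (upd0 z a)) (th i) = (D * a)%N%:R + w i.
  by rewrite -real_leNgt ?rpredD ?realn.
rewrite evalr_shifted /w addrCA; congr (_ + _).
rewrite natrM -mulrDr; congr (_ * _); rewrite /evalr (bigD1 0) //= !mxE ffunE eqxx expr0 mulr1.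
by congr (_ + _); apply: eq_bigr => j j0; rewrite !mxE ffunE (negPf j0).
Qed.
End Nonvanishing.

(** * Counting box points in the ideals above a prime *)

Lemma natr_inj_lt (k : fieldType) p (a b : nat) : p \in [pchar k] ->
  (a < p)%N -> (b < p)%N -> a%:R = b%:R :> k -> a = b.
Proof.
move=> pk la lb e; wlog le : a b la lb e / (a <= b)%N.
  by move=> H; case: (leqP a b) => [|/ltnW] le; [apply: H | apply/esym/H].
apply/eqP; rewrite eqn_leq le /= leqNgt -subn_gt0; apply/negP => b0.
have : (p %| b - a)%N by rewrite (dvdn_pcharf pk) natrB // e subrr.
by rewrite gtnNdvd //; apply: leq_ltn_trans (leq_subr _ _) lb.
Qed.

Lemma frob_fixed_nat (k : fieldType) p (r : k) : p \in [pchar k] -> r ^+ p = r ->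
  exists2 a, (a < p)%N & r = a%:R.
Proof.
move=> pk rp; have p_pr := pcharf_prime pk; have p1 := prime_gt1 p_pr.
pose q : {poly k} := 'X^p - 'X.
have szq : size q = p.+1.
  by rewrite size_polyDl size_polyXn // size_polyN size_polyX.
have q0 : q != 0 by rewrite -size_poly_gt0 szq.
have rootq x : (x \in root q) = (x ^+ p == x).
  by rewrite -topredE /= rootE !hornerE subr_eq0.
pose rs := [seq a%:R : k | a <- iota 0 p].
have urs : uniq rs.
  rewrite map_inj_in_uniq ?iota_uniq // => a b; rewrite !mem_iota !add0n /=.
  exact: natr_inj_lt pk.
have rs_root : all (root q) rs.
  apply/allP => _ /mapP[a _ ->]; rewrite rootE !hornerE subr_eq0.
  by rewrite -(pFrobenius_autE pk) pFrobenius_aut_nat.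
have [/mapP[a]|rN] := boolP (r \in rs); first by rewrite mem_iota => la ->; exists a.
have := @max_poly_roots _ q (r :: rs) q0; rewrite /= rN urs rs_root szq size_map size_iota.
by rewrite rootE !hornerE subr_eq0 rp eqxx => /(_ isT isT); rewrite ltnn.
Qed.

(** Cauchy-Schwarz for the sizes of the fibres of [h]. *)
Lemma card_collisions (T : finType) p (h : T -> 'I_p) :
  (#|T| ^ 2 <= p * #|[set ab : T * T | h ab.1 == h ab.2]|)%N.
Proof.
pose c v := #|[set a | h a == v]|.
have cT : #|T| = (\sum_v c v)%N.
  rewrite -sum1_card (partition_big h xpredT) //=; apply: eq_bigr => v _.
  by rewrite /c -sum1_card; apply: eq_bigl => a; rewrite inE.
have c2 : #|[set ab : T * T | h ab.1 == h ab.2]| = (\sum_v c v ^ 2)%N.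
  rewrite -sum1_card (partition_big (fun ab => h ab.1) xpredT) //=; apply: eq_bigr => v _.
  rewrite /c expnS expn1 -cardsX -sum1_card; apply: eq_bigl => -[a b]; rewrite !inE /=.
  by apply/andP/andP => -[/eqP e1 /eqP e2]; rewrite ?e1 ?e2 -?e1 -?e2 ?e1 ?e2 eqxx.
rewrite cT c2 -(leq_pmul2l (isT : 0 < 2)%N) expnS expn1 big_distrl /=.
have -> : (2 * (p * \sum_v c v ^ 2) = \sum_u \sum_v (c u ^ 2 + c v ^ 2))%N.
  under [RHS]eq_bigr => u _ do rewrite big_split sum_nat_const card_ord /=.
  by rewrite big_split /= sum_nat_const card_ord -big_distrr /= mul2n addnn.
rewrite big_distrr; apply: leq_sum => u _ /=; rewrite !big_distrr; apply: leq_sum => v _ /=.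
exact: nat_Cauchy.
Qed.

Section Counts.
Variables (m : nat) (f : {poly int}).
Hypotheses (f_monic : f \is monic) (f_size : size f = m.+2).
Hypothesis f_irr : irreducible_poly (map_poly intr f : {poly rat}).
Local Notation n := m.+1.
Local Notation M := (mult_mx (m := m) f).
Variables (p : nat) (k : fieldType).
Hypotheses (p_pr : prime p) (pk : p \in [pchar k]).
Local Notation toK := (fun z : int => z%:~R : k).
Variable r : k.
Hypothesis r_root : root (map_poly toK f) r.

Lemma evalrB (x y : 'rV[int]_n) : evalr (x - y) r = evalr x r - evalr y r.
Proof.
by rewrite /evalr -sumrB; apply: eq_bigr => j _; rewrite !mxE rmorphB mulrBl.
Qed.

Lemma evalrZ (a : int) (x : 'rV[int]_n) : evalr (a *: x) r = a%:~R * evalr x r.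
Proof.
by rewrite /evalr mulr_sumr; apply: eq_bigr => j _; rewrite !mxE rmorphM mulrA.
Qed.

Lemma evalr_e0 : evalr (e0 m) r = 1.
Proof.
rewrite /evalr (bigD1 0) //= big1 ?addr0 => [|j /negPf j0]; rewrite mxE ?eqxx /=.
  by rewrite mulr1.
by rewrite j0 mul0r.
Qed.

Variables (D y : nat).
Hypotheses (pD : coprime p D) (y0 : (0 < y)%N).
Local Notation shifted := (shifted (m := m) D).

Definition zeros : {set box m y} := [set z | evalr (shifted z) r == 0].

Lemma zeros_coset a b : a \in zeros -> b \in zeros -> evalr (vec a - vec b) r = 0.
Proof.
rewrite !inE !evalr_shifted => /eqP ea /eqP eb; rewrite evalrB; apply/eqP.
suff: D%:R * (evalr (vec a) r - evalr (vec b) r) == 0.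
  rewrite mulf_eq0 => /orP[|//]; rewrite -(dvdn_pcharf pk) => pd.
  by move: pD; rewrite prime_coprime // pd.
by rewrite mulrBr -(addrKA 1) ![_ + 1]addrC ea eb subrr.
Qed.

(** [#|T|] bounds the index of the ideal from below. An element of the counted set serves as [w] in
    the packing, so the reduction costs only a constant factor. *)
Lemma crude_count (I : 'rV[int]_n -> Prop) (T : finType) (s : T -> 'rV[int]_n) :
  (forall u v, I u -> I v -> I (u - v)) -> (forall q u, I u -> I (q *m M u)) ->
  (forall u, I (D%:Z *: u) -> I u) ->
  (forall a b, I (s a - s b) -> a = b) ->
  (#|[set z : box m y | `[< I (shifted z) >]]| * #|T| <= crude_cst m f D * y ^ n)%N.
Proof.
move=> IB IM ID sI; set A := [set z | _].
have [->|[z0 z0A]] := set_0Vmem A; first by rewrite cards0.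
apply: leq_trans (crude_le _ _ _ y0); apply: (card_coset_box (I := I) (w := shifted z0) (s := s)) => //.
- by move: z0A; rewrite inE => /asboolP.
- by apply: det_mult_neq0 => //; apply: shifted_neq0.
- exact: shifted_le.
move=> a b; rewrite !inE => /asboolP ha /asboolP hb; apply: ID.
have -> : D%:Z *: (vec a - vec b) = shifted a - shifted b.
  by rewrite scalerBr /shifted opprD addrACA subrr add0r.
exact: IB.
Qed.

Lemma zerosE : zeros = [set z | `[< evalr (shifted z) r = 0 >]].
Proof. by apply/setP => z; rewrite !inE; apply/eqP/asboolP. Qed.

Lemma evalr_ideal q u : evalr u r = 0 -> evalr (q *m M u) r = 0.
Proof. by move=> u0; rewrite (evalr_mult f_monic f_size) // u0 mulr0. Qed.

Lemma evalr_unscale (u : 'rV[int]_n) : evalr (D%:Z *: u) r = 0 -> evalr u r = 0.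
Proof.
rewrite evalrZ => /eqP; rewrite mulf_eq0 (intr_eq0_pchar _ pk) /= => /orP[pd|/eqP //].
by move: pD; rewrite prime_coprime // pd.
Qed.

Lemma card_zeros1 : (#|zeros| * p <= crude_cst m f D * y ^ n)%N.
Proof.
have := @crude_count (fun u => evalr u r = 0) 'I_p (fun a => (a : nat)%:Z *: e0 m).
rewrite card_ord -zerosE; apply => [u v u0 v0|||a b].
- by rewrite evalrB u0 v0 subrr.
- exact: evalr_ideal.
- exact: evalr_unscale.
rewrite evalrB !evalrZ evalr_e0 !mulr1 => /eqP; rewrite subr_eq0 => /eqP e.
by apply: val_inj; apply: (natr_inj_lt pk (ltn_ord _) (ltn_ord _)).
Qed.

Lemma evalr_e0_comp : evalr (e0 m *m comp_mx m f) r = r.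
Proof.
rewrite evalrE map_mxM -mulmxA (comp_evec f_monic f_size) // -scalemxAr mxE.
by rewrite -evalrE evalr_e0 mulr1.
Qed.

(** A root outside F_p makes the values a - b r, with a, b < p, distinct, so the ideal has index at
    least p^2. Such roots contribute a convergent sum. *)
Lemma card_zeros2 : r ^+ p != r -> (#|zeros| * p ^ 2 <= crude_cst m f D * y ^ n)%N.
Proof.
move=> rp.
have := @crude_count (fun u => evalr u r = 0) ('I_p * 'I_p)%type
  (fun a => (a.1 : nat)%:Z *: e0 m - (a.2 : nat)%:Z *: (e0 m *m comp_mx m f)).
rewrite card_prod card_ord -zerosE; apply => [u v u0 v0|||[a b] [c d] /=].
- by rewrite evalrB u0 v0 subrr.
- exact: evalr_ideal.
- exact: evalr_unscale.
rewrite !evalrB !evalrZ evalr_e0 evalr_e0_comp !mulr1 => e.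
have {}e : (a : nat)%:R - (c : nat)%:R = ((b : nat)%:R - (d : nat)%:R) * r.
  by apply/eqP; rewrite -subr_eq0 mulrBl -e; apply/eqP; ring.
have bd : b = d.
  apply: val_inj; apply: (natr_inj_lt pk (ltn_ord _) (ltn_ord _)); apply/eqP; rewrite -subr_eq0.
  apply: contraNT rp => nz; apply/eqP.
  have -> : r = ((a : nat)%:R - (c : nat)%:R) / ((b : nat)%:R - (d : nat)%:R).
    by rewrite e mulrAC divff ?mul1r.
  by rewrite -(pFrobenius_autE pk) rmorphM fmorphV !rmorphB !rmorph_nat.
rewrite bd subrr mul0r in e; rewrite bd; congr (_, _); apply: val_inj; apply: (natr_inj_lt pk (ltn_ord _) (ltn_ord _)).
by apply/eqP; rewrite -subr_eq0 e.
Qed.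

Lemma card_in_pow j : (#|[set z : box m y | `[< in_pow (m := m) f p r j (shifted z) >]]| * p ^ j
  <= crude_cst m f D * y ^ n)%N.
Proof.
have := @crude_count (in_pow f p r j) 'I_(p ^ j) (fun a => (a : nat)%:Z *: e0 m).
rewrite card_ord; apply => [u v|||a b].
- exact: in_powB.
- by move=> q u; apply: in_powM.
- by move=> u; apply: in_powZ.
rewrite -scalerBl => /(in_pow_const p_pr pk); have := ltn_ord a; have := ltn_ord b => lb la dv.
apply: val_inj => /=; case: (ltngtP a b) => // ab.
  have : (0 < b - a)%N by rewrite subn_gt0.
  by move=> /dvdn_leq; move: dv; rewrite distnEr ?(ltnW ab) // => dv /(_ _ dv); lia.
have : (0 < a - b)%N by rewrite subn_gt0.
by move=> /dvdn_leq; move: dv; rewrite distnEl ?(ltnW ab) // => dv /(_ _ dv); lia.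
Qed.

Lemma evalr_rational y' (z : box m y') : r ^+ p = r -> exists2 a, (a < p)%N & evalr (vec z) r = a%:R.
Proof.
move=> rp; apply: (frob_fixed_nat pk).
rewrite /evalr -(pFrobenius_autE pk) rmorph_sum; apply: eq_bigr => j _.
by rewrite rmorphM rmorphXn rmorph_int /= pFrobenius_autE rp.
Qed.

(** By pigeonhole two of the [t ^ n > p] vectors of a small box agree at [r]. Their difference is a
    nonzero element of the ideal of size at most [t], and using it as [w] brings the leading
    constant close to 1 when [y] is large against [t]. *)
Lemma card_zeros_sharp t : r ^+ p = r -> (p < t ^ n)%N ->
  (#|zeros| * p <= (y + 2 * (n * (mult_cst m f * t))).+1 ^ n)%N.
Proof.
move=> rp lt_p.
have p0 : (0 < p)%N by apply: prime_gt0.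
have /choice[h hh] : forall z : box m t, exists a : 'I_p, evalr (vec z) r = (a : nat)%:R.
  by move=> z; have [a la ea] := evalr_rational z rp; exists (Ordinal la).
have [a [b ab hab]] : exists a, exists2 b : box m t, a != b & h a = h b.
  apply: contrapT => H; have hI : injective h.
    move=> a b hab; apply/eqP; apply: contrapT => /negP ab; apply: H; exists a; exists b => //.
  by have := leq_card h hI; rewrite card_box card_ord leqNgt lt_p.
rewrite -[p in (_ * p)%N]card_ord.
apply: (card_coset_box (I := fun u => evalr u r = 0) (w := vec a - vec b)
          (s := fun a : 'I_p => (a : nat)%:Z *: e0 m)).
- by move=> u v u0 v0; rewrite evalrB u0 v0 subrr.
- exact: evalr_ideal.
- by rewrite evalrB !hh hab subrr.
- by apply: det_mult_neq0 => //; apply: vecB_neq0.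
- exact: vecB_le.
- move=> c d; rewrite evalrB !evalrZ evalr_e0 !mulr1 => /eqP; rewrite subr_eq0 => /eqP e.
  by apply: val_inj; apply: (natr_inj_lt pk (ltn_ord _) (ltn_ord _)).
exact: zeros_coset.
Qed.

(** At a rational root the values lie in F_p, so the pigeonhole estimate for [p] fibres applies. *)
Lemma card_pairs : r ^+ p = r ->
  (y ^ n * y ^ n <= p * #|[set ab : box m y * box m y | evalr (vec ab.1 - vec ab.2)%R r == 0%R]|)%N.
Proof.
move=> rp; have /choice[h hh] : forall z : box m y, exists a : 'I_p, evalr (vec z) r = (a : nat)%:R.
  by move=> z; have [a la ea] := evalr_rational z rp; exists (Ordinal la).
have := card_collisions h; rewrite card_box mulnn => /leq_trans; apply.
rewrite leq_mul2l; apply/orP; right; apply: subset_leq_card; apply/subsetP => -[a b].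
by rewrite !inE /= evalrB !hh => /eqP ->; rewrite subrr.
Qed.

End Counts.

(** * Sums of logarithms over primes *)

Lemma prime_dvd_fact p h : prime p -> (p %| h`!)%N -> (p <= h)%N.
Proof.
move=> pp; elim: h => [|h IH]; first by rewrite fact0 dvdn1 => /eqP p1; rewrite p1 in pp.
rewrite factS Euclid_dvdM // => /orP[/dvdn_leq -> //|/IH/leq_trans]; exact.
Qed.

Definition primorial n := (\prod_(0 <= p < n.+1 | prime p) p)%N.

(** The primes in (h, 2h] divide the central binomial coefficient, which is at most [4 ^ h]; the
    rest follows by induction on the half. *)
Lemma primorial_le n : (primorial n <= 16 ^ n)%N.
Proof.
elim/ltn_ind: n => n IH; case: (leqP n 2) => [|n2].
  by rewrite /primorial; case: n {IH} => [|[|[|]]] // _; rewrite unlock.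
pose h := uphalf n.
have hn : (h < n)%N by rewrite /h; lia.
have nh : (n <= 2 * h)%N by rewrite /h; lia.
have step j : (j <= 2 * h)%N -> (\prod_(h.+1 <= p < j.+1 | prime p) p %| 'C(2 * h, h))%N.
  elim: j => [|j IHj] jh; first by rewrite big_geq.
  case: (leqP j.+1 h) => [jh'|hj]; first by rewrite big_geq // ltnS.
  rewrite big_mkcond big_nat_recr //= -big_mkcond /=; case: ifP => [pr|_]; last first.
    by rewrite muln1 IHj // ltnW.
  rewrite Gauss_dvd ?IHj ?(ltnW jh) //=.
    have := bin_fact (_ : h <= 2 * h)%N => /(_ ltac:(lia)).
    have -> : (2 * h - h = h)%N by lia.
    move=> e; have : (j.+1 %| (2 * h)`!)%N by apply: dvdn_fact.
    rewrite -e Euclid_dvdM // => /orP[//|].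
    by rewrite Euclid_dvdM // orbb => /(prime_dvd_fact pr); rewrite leqNgt hj.
  rewrite coprime_sym prime_coprime // big_nat_cond; apply/negP.
  apply: (big_ind (fun x => (j.+1 %| x)%N -> False)).
  - by rewrite dvdn1 => /eqP e; rewrite e in pr.
  - by move=> x y hx hy; rewrite Euclid_dvdM // => /orP[].
  move=> p /andP[/andP[h1 h2] pp]; rewrite dvdn_prime2 // => /eqP e.
  by rewrite -e ltnn in h2.
have bin_le : ('C(2 * h, h) <= 4 ^ h)%N.
  rewrite -[4%N]/(2 ^ 2)%N -expnM -[2%N in leqRHS]/(1 + 1)%N expnDn.
  have lt_h : (h < (2 * h).+1)%N by lia.
  by rewrite (bigD1 (Ordinal lt_h)) //= !exp1n !muln1 leq_addr.
have -> : primorial n = (primorial h * \prod_(h.+1 <= p < n.+1 | prime p) p)%N.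
  by rewrite /primorial -big_cat_nat // ltnS ltnW.
apply: (@leq_trans (16 ^ h * 4 ^ h)%N).
  apply: leq_mul; first exact: IH.
  by apply: leq_trans bin_le; apply: dvdn_leq (step n nh); rewrite bin_gt0; lia.
(* The base 16, rather than 4, absorbs the rounding up of [n / 2]: 6 h <= 4 n holds for n > 2. *)
rewrite -expnMn -[(16 * 4)%N]/(2 ^ 6)%N -[16%N]/(2 ^ 4)%N -!expnM leq_exp2l // /h; lia.
Qed.

Section Logs.
Variable R : realType.
Local Notation lnN n := (ln (n%:R : R)).

Lemma lnN_ge0 n : (0 < n)%N -> 0 <= lnN n.
Proof. by move=> n0; rewrite ln_ge0 // ler1n. Qed.

Lemma lnNM a b : (0 < a)%N -> (0 < b)%N -> lnN (a * b)%N = lnN a + lnN b.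
Proof. by move=> a0 b0; rewrite natrM lnM // posrE ltr0n. Qed.

Lemma lnNX a j : (0 < a)%N -> lnN (a ^ j)%N = j%:R * lnN a.
Proof. by move=> a0; rewrite natrX lnXn ?ltr0n // mulr_natl. Qed.

Lemma lnN_le a b : (0 < a)%N -> (a <= b)%N -> lnN a <= lnN b.
Proof.
move=> a0 ab; rewrite ler_ln ?posrE ?ltr0n ?ler_nat //; exact: leq_trans ab.
Qed.

Lemma lnN_prod (r : seq nat) (P : pred nat) (F : nat -> nat) :
  (forall i, P i -> (0 < F i)%N) ->
  lnN (\prod_(i <- r | P i) F i)%N = \sum_(i <- r | P i) lnN (F i).
Proof.
move=> F0; suff [] : lnN (\prod_(i <- r | P i) F i)%N = \sum_(i <- r | P i) lnN (F i) /\
   (0 < \prod_(i <- r | P i) F i)%N by [].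
apply: (big_rec2 (fun a b => lnN a = b /\ (0 < a)%N)) => [|i a b Pi [<- a0]].
  by rewrite ln1.
by rewrite lnNM ?F0 // muln_gt0 F0.
Qed.

Lemma lnN_factor N Z : (0 < N)%N -> (N <= Z)%N ->
  lnN N = \sum_(0 <= p < Z.+1 | prime p) (logn p N)%:R * lnN p.
Proof.
move=> N0 NZ; rewrite -{1}(part_pnat_id (pi := predT) (n := N)); last first.
  by apply/pnatP.
rewrite (widen_partn _ NZ) lnN_prod => [|p _]; last first.
  by case: p => [|p]; [rewrite lognE | rewrite expn_gt0].
rewrite [RHS]big_mkcond; apply: eq_bigr => p _; case: ifP => pp.
  by rewrite lnNX // prime_gt0.
by rewrite lognE pp expn0 ln1.
Qed.

Lemma sum_ln_primes Z : \sum_(0 <= p < Z.+1 | prime p) lnN p <= Z%:R * lnN 16.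
Proof.
rewrite -lnNX // -lnN_prod; last by move=> p /prime_gt0.
by apply: lnN_le (primorial_le Z); rewrite prodn_cond_gt0 // => p /prime_gt0.
Qed.

(** Telescoping against (ln n + 2) / n, modelled on the antiderivative -(ln x + 1) / x of ln x /
    x^2; the extra 1 pays for differences in place of derivatives. *)
Lemma sum_ln_sq Z : \sum_(2 <= n < Z) lnN n / n%:R ^+ 2 <= 2.
Proof.
pose g n : R := (lnN n + 2) / n%:R.
have g0 n : (0 < n)%N -> 0 <= g n by move=> n0; rewrite divr_ge0 // addr_ge0 // lnN_ge0.
have step k : (0 < k)%N -> lnN k.+1 / k.+1%:R ^+ 2 <= g k - g k.+1.
  move=> k0; have k0' : 1 <= k%:R :> R by rewrite ler1n.
  have a0 : 0 <= lnN k.+1 by apply: lnN_ge0.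
  have : lnN k.+1 - 1 / k%:R <= lnN k.
    rewrite lerBlDr -lerBlDl -ln_div ?posrE ?ltr0n //.
    have -> : k.+1%:R / k%:R = 1 + 1 / k%:R :> R by rewrite -natr1; field; lra.
    apply: le_ln1Dx; have : 0 <= 1 / k%:R :> R by apply: divr_ge0.
    by move=> h; apply: lt_le_trans h; lra.
  rewrite /g; move: (lnN k) (lnN k.+1) a0 => b a a0 ab.
  rewrite -natr1; move: (k%:R : R) k0' ab => x x1 ab.
  apply: (@le_trans _ _ ((a - 1 / x + 2) / x - (a + 2) / (x + 1))); last first.
    by rewrite lerB // ler_wpM2r ?invr_ge0; lra.
  rewrite -subr_ge0.
  have -> : (a - 1 / x + 2) / x - (a + 2) / (x + 1) - a / (x + 1) ^+ 2 =
     (a * x + (x - 1) * (x + 1)) / (x ^+ 2 * (x + 1) ^+ 2) by field; lra.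
  apply: divr_ge0; first by nra.
  by rewrite mulr_ge0 // sqr_ge0.
case: (leqP Z 2) => [Z2|Z2]; first by rewrite big_geq //.
have -> : 2 = g 1 by rewrite /g ln1 add0r divr1.
suff H j : \sum_(2 <= n < j.+2) lnN n / n%:R ^+ 2 <= g 1 - g j.+1.
  case: Z Z2 => [|[|Z]] // _; apply: le_trans (H Z) _.
  by rewrite gerBl g0.
elim: j => [|j IH]; first by rewrite big_geq // subrr.
rewrite big_nat_recr //=; apply: le_trans (lerD IH (step j.+1 isT)) _.
by rewrite addrA subrK.
Qed.

Lemma sum_geom (x : R) K : 2 <= x -> \sum_(2 <= j < K.+1) x ^- j <= 2 / x ^+ 2.
Proof.
move=> x2; have x0 : 0 < x by lra.
suff H j : \sum_(2 <= i < j.+2) x ^- i <= 2 / x ^+ 2 - 2 / x ^+ j.+2.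
  case: K => [|K]; first by rewrite big_geq // divr_ge0 // exprn_ge0 // ltW.
  by apply: le_trans (H K) _; rewrite gerBl divr_ge0 // exprn_ge0 // ltW.
elim: j => [|j IH]; first by rewrite big_geq // subrr.
rewrite big_nat_recr //=; apply: le_trans (lerD IH (lexx _)) _.
rewrite -addrA lerD2l -subr_ge0.
have -> : - (2 / x ^+ j.+3) - (- (2 / x ^+ j.+2) + x ^- j.+2) = (x - 2) / x ^+ j.+3.
  rewrite [x ^+ j.+3]exprS; have := exprn_gt0 j.+2 x0; move: (x ^+ j.+2) => w w0.
  by field; rewrite !lt0r_neq0.
by apply: divr_ge0; [lra | rewrite exprn_ge0 // ltW].
Qed.

Lemma bernoulli_upper (a : R) j : 0 <= a -> j%:R * a <= 1 / 2 -> (1 + a) ^+ j <= 1 + 2 * (j%:R * a).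
Proof.
move=> a0; elim: j => [|j IH]; first by rewrite expr0; lra.
rewrite -natr1 => h; have j0 : 0 <= j%:R :> R by [].
have {}IH := IH ltac:(nra).
rewrite exprSr; apply: (@le_trans _ _ ((1 + 2 * (j%:R * a)) * (1 + a))).
  by apply: ler_wpM2r => //; lra.
nra.
Qed.
End Logs.

(** * Mertens sums over the degree-one primes of a number field *)

(** [f] has [m.+1] distinct roots in characteristic [p], and [c] of them are fixed by Frobenius,
    hence lie in F_p. The field [k] is left free so that the residue field of any place can supply
    it. *)
Definition splits (m : nat) (f : {poly int}) (p c : nat) : Prop :=
  exists (k : fieldType) (rho : 'I_m.+1 -> k),
    [/\ p \in [pchar k], injective rho,
        forall i, root (map_poly intr f) (rho i)
      & #|[set i | rho i ^+ p == rho i]| = c].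

Section Bounds.
Variable R : realType.
Local Notation lnN n := (ln (n%:R : R)).
Variables (m : nat) (f : {poly int}).
Hypotheses (f_monic : f \is monic) (f_size : size f = m.+2).
Hypothesis f_irr : irreducible_poly (map_poly intr f : {poly rat}).
Local Notation n := m.+1.
Local Notation M := (mult_mx (m := m) f).
Variables (B : nat) (c : nat -> nat).
Hypothesis f_splits : forall p, prime p -> (B < p)%N -> splits m f p (c p).

(** For each rational root, pairs of box points with equal values are frequent; off the diagonal
    each such root raises the valuation of the norm of the difference by at least 1. The last term
    accounts for the diagonal. *)
Lemma pairs_logn p y : prime p -> (B < p)%N ->
  (c p * (y ^ n * y ^ n) <= p * (\sum_(ab : box m y * box m y | ab.1 != ab.2)
     logn p (absz (\det (M (vec ab.1 - vec ab.2)%R))) + c p * y ^ n))%N.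
Proof.
move=> pp Bp; have [k [rho [pk rI rr <-]]] := f_splits pp Bp.
set A := [set i | _].
apply: (@leq_trans (\sum_(i in A) p * #|[set ab : box m y * box m y | evalr (vec ab.1 - vec ab.2)%R (rho i) == 0%R]|)%N).
  rewrite -sum_nat_const; apply: leq_sum => i; rewrite inE => /eqP ri.
  exact: card_pairs.
rewrite -big_distrr leq_mul2l /=; apply/orP; right.
under eq_bigr => i _ do rewrite -sum1_card big_mkcond /=.
rewrite exchange_big /= (bigID (fun ab : box m y * box m y => ab.1 != ab.2)) /= leq_add //.
  apply: leq_sum => -[a b] /= ab.
  have d0 : \det (M (vec a - vec b)) != 0 by apply: det_mult_neq0 => //; apply: vecB_neq0.
  apply: leq_trans (logn_det_ge f_monic f_size pp pk rI rr d0).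
  rewrite -[leqRHS]sum1_card [leqRHS]big_mkcond [leqLHS]big_mkcond; apply: leq_sum => i _ /=.
  by rewrite !inE; case: ifP.
rewrite (eq_bigl (fun ab : box m y * box m y => ab.2 == ab.1)); last by move=> ab; rewrite negbK eq_sym.
apply: (@leq_trans (\sum_(ab : box m y * box m y | ab.2 == ab.1) #|A|)%N).
  apply: leq_sum => ab _; rewrite -sum1_card; apply: leq_sum => i _; by case: ifP.
rewrite -(pair_big_dep xpredT (fun a b => b == a) (fun _ _ => #|A|)) /=.
under eq_bigr => a _ do rewrite big_pred1_eq.
by rewrite sum_nat_const card_box mulnC.
Qed.

Definition wsum (Z : nat) : R :=
  \sum_(0 <= p < Z | prime p && (B < p)%N) (c p)%:R * lnN p / p%:R.

(** Compare the sum of ln of the norms of all differences with its part at the primes below [Z]. The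
    diagonal costs [c p * X] against the main term [c p * X^2 / p]; as [8 p <= X] this is at most
    one eighth, whence 7/8. *)
Lemma wsum_upper y Z : (0 < y)%N -> (8 * Z <= y ^ n)%N ->
  7 / 8 * wsum Z <= lnN (det_cst m f * y ^ n)%N.
Proof.
move=> y0 ZX; set X := (y ^ n)%N; set W := (det_cst m f * X)%N.
have X0 : (0 < X)%N by rewrite expn_gt0 y0.
have XR : 0 < X%:R :> R by rewrite ltr0n.
pose N (ab : box m y * box m y) := absz (\det (M (vec ab.1 - vec ab.2))).
have N0 ab : ab.1 != ab.2 -> (0 < N ab)%N.
  by move=> h; rewrite absz_gt0; apply: det_mult_neq0 => //; apply: vecB_neq0.
have NW ab : (N ab <= W)%N by apply: leq_absz_det_mult => j; apply: vecB_le.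
have up : \sum_(ab | ab.1 != ab.2) lnN (N ab) <= X%:R ^+ 2 * lnN W.
  have W0 : (0 < W)%N.
    by rewrite muln_gt0 X0 andbT /det_cst muln_gt0 fact_gt0 expn_gt0.
  apply: (@le_trans _ _ (\sum_(ab : box m y * box m y) lnN W)).
    rewrite big_mkcond; apply: ler_sum => ab _; case: ifP => [h|_]; last exact: lnN_ge0.
    by apply: lnN_le => //; apply: N0.
  by rewrite sumr_const card_prod !card_box -[leLHS]mulr_natl natrM expr2.
have lo : \sum_(0 <= p < Z | prime p && (B < p)%N)
    lnN p * (\sum_(ab | ab.1 != ab.2) logn p (N ab))%N%:R <= \sum_(ab | ab.1 != ab.2) lnN (N ab).
  have -> : \sum_(0 <= p < Z | prime p && (B < p)%N) lnN p *
       (\sum_(ab | ab.1 != ab.2) logn p (N ab))%N%:R =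
      \sum_(ab | ab.1 != ab.2) \sum_(0 <= p < Z | prime p && (B < p)%N) (logn p (N ab))%:R * lnN p.
    rewrite exchange_big /=; apply: eq_bigr => p _.
    by rewrite natr_sum mulr_sumr; apply: eq_bigr => ab _; rewrite mulrC.
  apply: ler_sum => ab h; pose Z' := maxn Z W.
  rewrite (lnN_factor (Z := Z') R (N0 _ h)); last by rewrite leq_max NW orbT.
  have tn p : prime p -> 0 <= (logn p (N ab))%:R * lnN p.
    by move=> pp; rewrite mulr_ge0 // lnN_ge0 // prime_gt0.
  rewrite [leRHS](big_cat_nat (n := Z)) //=; last by rewrite leqW // leq_maxl.
  rewrite -[leLHS]addr0 lerD //; last by apply: sumr_ge0.
  rewrite big_mkcond [leRHS]big_mkcond; apply: ler_sum => p _ /=.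
  by case: (boolP (prime p)) => //= pp; case: ifP => // _; apply: tn.
have key p : (p < Z)%N -> prime p -> (B < p)%N ->
   7 / 8 * X%:R ^+ 2 * ((c p)%:R * lnN p / p%:R) <=
     lnN p * (\sum_(ab | ab.1 != ab.2) logn p (N ab))%N%:R.
  move=> pZ pp Bp; have := pairs_logn y pp Bp; rewrite -/X -(ler_nat R).
  rewrite !(natrM, natrD) -/(N _); set S := (\sum_(_ | _) _)%N.
  have p0 : 0 < p%:R :> R by rewrite ltr0n prime_gt0.
  have pX : 8 * p%:R <= X%:R :> R.
    by rewrite -natrM ler_nat; apply: leq_trans ZX; rewrite leq_mul2l ltnW.
  have c0 : 0 <= (c p)%:R :> R by [].
  have l0 : 0 <= lnN p by apply/lnN_ge0/prime_gt0.
  move: (c p)%:R (S%:R : R) (p%:R : R) (X%:R : R) p0 pX c0 XR (lnN p) l0.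
  move=> {S} cc S q x q0 qx c0 x0 l l0 h.
  have -> : 7 / 8 * x ^+ 2 * (cc * l / q) = l * (7 / 8 * x ^+ 2 * cc / q) by field; lra.
  apply: ler_wpM2l => //; rewrite ler_pdivrMr //.
  by have := ler_wpM2r (mulr_ge0 c0 (ltW x0)) qx; lra.
have : 7 / 8 * X%:R ^+ 2 * wsum Z <= X%:R ^+ 2 * lnN W.
  apply: le_trans (le_trans lo up); rewrite /wsum mulr_sumr big_nat_cond [leRHS]big_nat_cond.
  by apply: ler_sum => p /andP[/andP[_ pZ] /andP[pp Bp]]; apply: key.
move=> h; rewrite -(ler_pM2l (exprn_gt0 2 XR)); apply: le_trans h.
by have -> : X%:R ^+ 2 * (7 / 8 * wsum Z) = 7 / 8 * X%:R ^+ 2 * wsum Z by ring.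
Qed.

End Bounds.

Section Lower.
Variable R : realType.
Local Notation lnN n := (ln (n%:R : R)).
Variables (m : nat) (f : {poly int}).
Hypotheses (f_monic : f \is monic) (f_size : size f = m.+2).
Hypothesis f_irr : irreducible_poly (map_poly intr f : {poly rat}).
Local Notation n := m.+1.
Local Notation M := (mult_mx (m := m) f).
Variables (B : nat) (c : nat -> nat).
Hypothesis f_splits : forall p, prime p -> (B < p)%N -> splits m f p (c p).
Local Notation D := (B`!).
Local Notation N z := (absz (\det (M (shifted D z)))).
Local Notation Cr := (crude_cst m f D).

Lemma norm_shifted_gt0 y (z : box m y) : (0 < N z)%N.
Proof. by rewrite absz_gt0; apply: det_mult_neq0 => //; apply: shifted_neq0. Qed.

(** [p] divides [B!], so the multiplication matrix of 1 + B! z is the identity modulo [p]. *)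
Lemma logn_shifted_small p y (z : box m y) : prime p -> (p <= B)%N -> logn p (N z) = 0%N.
Proof.
move=> pp pB; apply/eqP; rewrite -leqn0 leqNgt logn_gt0 mem_primes pp /=.
apply/negP => /andP[_]; rewrite -(intr_eq0_pchar _ (pchar_Fp pp)) -det_map_mx.
suff -> : map_mx (intr : int -> 'F_p) (M (shifted D z)) = 1%:M by rewrite det1 oner_eq0.
rewrite /shifted mult_mxD mult_mx_e0 mult_mxZ.
have D0 : (D%:Z%:~R = 0 :> 'F_p).
  by apply/eqP; rewrite (intr_eq0_pchar _ (pchar_Fp pp)) dvdn_fact // prime_gt0.
apply/matrixP => i j; rewrite !mxE rmorphD rmorphM /= D0 mul0r addr0.
by rewrite rmorph_nat.
Qed.

Lemma coprime_fact p : prime p -> (B < p)%N -> coprime p D.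
Proof.
by move=> pp Bp; rewrite prime_coprime //; apply/negP => /(prime_dvd_fact pp); rewrite leqNgt Bp.
Qed.

(** At level 1, rational roots give the main term and the other roots an error n Cr y^n / p^2. The
    levels [j >= 2] add a geometric series bounded by twice that error, whence the 3. *)
Lemma sum_logn_shifted p y U : prime p -> (B < p)%N -> (0 < y)%N ->
  (forall (k : fieldType) (r : k), p \in [pchar k] -> root (map_poly intr f) r ->
     r ^+ p = r -> (#|zeros m r D y| * p <= U)%N) ->
  (\sum_(z : box m y) logn p (N z))%N%:R <=
    (c p)%:R * (U%:R / p%:R) + 3 * n%:R * (Cr * y ^ n)%N%:R / p%:R ^+ 2 :> R.
Proof.
move=> pp Bp y0 hU; have [k [rho [pk rI rr <-]]] := f_splits pp Bp.
have pD := coprime_fact pp Bp.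
set A := [set i | _]; set X := (Cr * y ^ n)%N.
have p0 : 0 < p%:R :> R by rewrite ltr0n prime_gt0.
pose K := (\max_(z : box m y) N z).+1.
have step (z : box m y) : (logn p (N z) <= \sum_i (z \in zeros m (rho i) D y) +
     \sum_(2 <= j < K.+1) \sum_i `[< in_pow (m := m) f p (rho i) j (shifted D z) >])%N.
  have K0 : (logn p (N z) <= K)%N.
    apply: leq_trans (ltnW (ltn_logl _ (norm_shifted_gt0 z))) _; apply: leqW.
    exact: (bigop.bigmax_sup z).
  have d0 : \det (M (shifted D z)) != 0 by rewrite -absz_gt0 norm_shifted_gt0.
  apply: leq_trans (logn_det_le pp pk rI d0 K0) _.
  rewrite big_ltn // leq_add2r; apply: leq_sum => i _; case: asboolP => // h.
  by rewrite inE (in_pow1 f_monic f_size pk _ h) ?eqxx.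
apply: (@le_trans _ _ ((\sum_i #|zeros m (rho i) D y| + \sum_(2 <= j < K.+1) \sum_i
    #|[set z : box m y | `[< in_pow (m := m) f p (rho i) j (shifted D z) >]]|)%N%:R)).
  rewrite ler_nat; apply: leq_trans; first by apply: leq_sum => z _; exact: step z.
  rewrite big_split leq_add //.
    rewrite exchange_big; apply: leq_sum => i _; rewrite -sum1_card [leqRHS]big_mkcond.
    by apply: leq_sum => z _; case: ifP.
  rewrite exchange_big; apply: leq_sum => j _; rewrite exchange_big; apply: leq_sum => i _.
  rewrite -sum1_card [leqRHS]big_mkcond; apply: leq_sum => z _; rewrite inE; by case: ifP.
rewrite natrD.
have h1 : (\sum_i #|zeros m (rho i) D y|)%N%:R <= #|A|%:R * (U%:R / p%:R) + n%:R * X%:R / p%:R ^+ 2 :> R.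
  rewrite natr_sum (bigID (mem A)) /= lerD //.
    rewrite mulr_natl -sumr_const; apply: ler_sum => i; rewrite inE => /eqP ri.
    by rewrite ler_pdivlMr // -natrM ler_nat hU.
  apply: (@le_trans _ _ (\sum_(i < n) X%:R / p%:R ^+ 2)); last first.
    by rewrite sumr_const card_ord -[leLHS]mulr_natl mulrA.
  rewrite big_mkcond; apply: ler_sum => i _; rewrite inE; case: ifP => [ri|_]; last first.
    by rewrite divr_ge0 // exprn_ge0 // ltW.
  rewrite ler_pdivlMr ?exprn_gt0 // -natrX -natrM ler_nat.
  exact: card_zeros2.
have h2 : (\sum_(2 <= j < K.+1) \sum_i
    #|[set z : box m y | `[< in_pow (m := m) f p (rho i) j (shifted D z) >]]|)%N%:R
    <= n%:R * X%:R * (2 / p%:R ^+ 2) :> R.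
  apply: (@le_trans _ _ (\sum_(2 <= j < K.+1) n%:R * X%:R * p%:R ^- j)); last first.
    rewrite -mulr_sumr ler_wpM2l //; first by rewrite mulr_ge0.
    by apply: sum_geom; rewrite (ler_nat R 2) prime_gt1.
  rewrite natr_sum; apply: ler_sum => j _; rewrite natr_sum.
  apply: (@le_trans _ _ (\sum_(i < n) X%:R / p%:R ^+ j)); last first.
    by rewrite sumr_const card_ord -[leLHS]mulr_natl mulrA.
  apply: ler_sum => i _; rewrite ler_pdivlMr ?exprn_gt0 // -natrX -natrM ler_nat.
  exact: card_in_pow.
apply: le_trans (lerD h1 h2) _; rewrite -addrA lerD2l.
by rewrite le_eqVlt; apply/orP; left; apply/eqP; field; rewrite lt0r_neq0.
Qed.

(** With [s = y / (32 n)] the share of points of norm below [s ^ n] is at most 2 n s / y = 1/16. *)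
Lemma sum_ln_norm_ge y s : (0 < s)%N -> y = (32 * n * s)%N ->
  15 / 16 * (y ^ n)%N%:R * (lnN (y ^ n)%N - lnN ((32 * n) ^ n)%N) <= \sum_(z : box m y) lnN (N z).
Proof.
move=> s0 ys; have y0 : (0 < y)%N by rewrite ys !muln_gt0.
pose bad := [set z : box m y | (N z < s ^ n)%N].
have bad_le : (16 * #|bad| <= y ^ n)%N.
  have := card_small_norm f_monic f_size f_irr y s (fact_gt0 B); rewrite -/bad.
  move=> h; rewrite -(leq_pmul2l y0) mulnCA.
  apply: leq_trans (_ : 16 * (y ^ n * (n * (2 * s))) <= _)%N; first by rewrite leq_mul2l.
  have -> // : (16 * (y ^ n * (n * (2 * s))) = y * y ^ n)%N.
  by move: (y ^ n)%N => P; rewrite ys; ring.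
have -> : lnN (y ^ n)%N - lnN ((32 * n) ^ n)%N = lnN (s ^ n)%N.
  by rewrite {1}ys expnMn lnNM ?expn_gt0 ?s0 // addrC addKr.
have ls : 0 <= lnN (s ^ n)%N by apply: lnN_ge0; rewrite expn_gt0 s0.
apply: (@le_trans _ _ (\sum_(z in ~: bad) lnN (s ^ n)%N)).
  rewrite sumr_const -[leRHS]mulr_natl ler_wpM2r //.
  have -> : #|~: bad| = (y ^ n - #|bad|)%N by rewrite -card_box -(cardsC bad) addKn.
  have bX : (#|bad| <= y ^ n)%N by rewrite -card_box max_card.
  rewrite natrB //; move: bad_le; rewrite -(ler_nat R) natrM; lra.
rewrite big_mkcond; apply: ler_sum => z _; case: ifP => [|_]; last first.
  exact/lnN_ge0/norm_shifted_gt0.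
by rewrite !inE -leqNgt => h; apply: lnN_le => //; rewrite expn_gt0 s0.
Qed.

Lemma splits_le p : prime p -> (B < p)%N -> (c p <= n)%N.
Proof.
move=> pp Bp; have [k [rho [_ _ _ <-]]] := f_splits pp Bp.
by rewrite -[leqRHS]card_ord max_card.
Qed.

(** [kappa * t] bounds the enlargement of the box in the sharp count. [q] is a multiple of [32 * n],
    as the small norm estimate requires, and n kappa / q = 1 / (32 n) keeps (1 + kappa / q)^n below
    9/8. *)
Let kappa := (2 * (n * mult_cst m f)).+1.
Let q := (32 * n * (n * kappa))%N.

Lemma sharp_ratio t : (0 < t)%N ->
  ((q * t + 2 * (n * (mult_cst m f * t))).+1 ^ n)%N%:R <= 9 / 8 * ((q * t) ^ n)%N%:R :> R.
Proof.
move=> t0; apply: (@le_trans _ _ (((q + kappa) * t) ^ n)%N%:R).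
  by rewrite ler_nat leq_exp2r // mulnDl /kappa; move: (q * t)%N => qt; nia.
have q0 : 0 < q%:R :> R by rewrite ltr0n /q /kappa !muln_gt0.
rewrite (expnMn (q + kappa)) (expnMn q) (natrM _ ((q + kappa) ^ n)) (natrM _ (q ^ n)) mulrA.
apply: ler_wpM2r => //.
have -> : ((q + kappa) ^ n)%N%:R = (q ^ n)%N%:R * (1 + kappa%:R / q%:R) ^+ n :> R.
  rewrite !natrX -exprMn mulrDr mulr1 natrD mulrCA divff ?mulr1 //.
  by rewrite lt0r_neq0.
rewrite [leLHS]mulrC; apply: ler_wpM2r => //.
have e : n%:R * (kappa%:R / q%:R) = 1 / (32 * n%:R) :> R.
  have u0 : 0 < kappa%:R :> R by rewrite ltr0n.
  have v0 : 0 < n%:R :> R by rewrite ltr0n.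
  rewrite /q !natrM; move: (kappa%:R : R) (n%:R : R) u0 v0 => u v u0 v0.
  by field; rewrite !lt0r_neq0.
have n1 : 1 <= n%:R :> R by rewrite ler1n.
have le : 1 / (32 * n%:R) <= 1 / 32 :> R by rewrite ler_pdivrMr; nra.
by apply: le_trans (bernoulli_upper _ _) _; rewrite ?e ?divr_ge0 //;
  move: le; move: (1 / (32 * n%:R)) => w; lra.
Qed.

(** The sum of ln of the norms of 1 + B! z over a box of side [q * t] is bounded below by the rarity
    of small norms and above prime by prime. After division by the number [X] of points only the sum
    over primes below [Z = t ^ n] is unbounded. *)
Lemma wsum_lower : exists (q : nat) (C : R), (0 < q)%N /\
  forall t, (0 < t)%N -> 15 / 16 * lnN ((q * t) ^ n)%N <= 9 / 8 * wsum R B c (t ^ n) + C.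
Proof.
pose T := (q ^ n)%N; pose CW := (det_cst m f * D.+1 ^ n)%N.
exists q, (n%:R * Cr%:R * T%:R * CW%:R * lnN 16 + 6 * n%:R * Cr%:R + 15 / 16 * lnN ((32 * n) ^ n)%N).
have q0 : (0 < q)%N by rewrite /q /kappa !muln_gt0.
split=> // t t0; set y := (q * t)%N; set X := (y ^ n)%N; set Z := (t ^ n)%N.
have y0 : (0 < y)%N by rewrite muln_gt0 q0.
have XTZ : X = (T * Z)%N by rewrite /X /y expnMn.
have Z0 : (0 < Z)%N by rewrite expn_gt0 t0.
have X0 : (0 < X)%N by rewrite expn_gt0 y0.
pose W := (CW * X)%N.
have NW (z : box m y) : (N z <= W)%N.
  rewrite /W /CW -mulnA -expnMn; apply: leq_absz_det_mult => j; exact: shifted_le.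
have CW0 : (0 < CW)%N by rewrite /CW /det_cst !muln_gt0 fact_gt0 !expn_gt0.
have ZW : (Z <= W)%N by rewrite /W XTZ mulnA leq_pmull // muln_gt0 CW0 expn_gt0 q0.
have low := sum_ln_norm_ge (y := y) (s := (n * kappa * t)%N).
have {low} low : 15 / 16 * X%:R * (lnN X - lnN ((32 * n) ^ n)%N) <= \sum_(z : box m y) lnN (N z).
  by apply: low; [rewrite !muln_gt0 | rewrite /y /q !mulnA].
have eqs : \sum_(z : box m y) lnN (N z) =
   \sum_(0 <= p < W.+1 | prime p) lnN p * (\sum_(z : box m y) logn p (N z))%N%:R.
  under eq_bigr => z _ do rewrite (lnN_factor R (norm_shifted_gt0 z) (NW z)).
  rewrite exchange_big /=; apply: eq_bigr => p _; rewrite natr_sum mulr_sumr.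
  by apply: eq_bigr => z _; rewrite mulrC.
(* [E1] is the main term, from the sharp count below [Z]. [E2] covers [p >= Z] by the crude count:
   there X / p <= X / Z = T, and Chebyshev's bound sums ln p up to [W], a constant multiple of [X].
   [E3] collects the errors in 1 / p^2. *)
pose E1 p : R := if (p < Z)%N && (B < p)%N then 9 / 8 * X%:R * ((c p)%:R * lnN p / p%:R) else 0.
pose E2 p : R := lnN p * (n%:R * Cr%:R * T%:R).
pose E3 p : R := 3 * n%:R * (Cr%:R * X%:R) * (lnN p / p%:R ^+ 2).
have E1_ge0 p : prime p -> 0 <= E1 p.
  move=> pp; rewrite /E1; case: ifP => // _.
  have : 0 <= (c p)%:R * lnN p / p%:R by rewrite !mulr_ge0 ?invr_ge0 ?lnN_ge0 ?prime_gt0.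
  by move=> h; rewrite mulr_ge0 // mulr_ge0 //; lra.
have E2_ge0 p : prime p -> 0 <= E2 p.
  by move=> pp; rewrite /E2 !mulr_ge0 // lnN_ge0 // prime_gt0.
have E3_ge0 p : prime p -> 0 <= E3 p.
  by move=> pp; rewrite /E3 !mulr_ge0 ?invr_ge0 ?exprn_ge0 // lnN_ge0 // prime_gt0.
have term p : prime p -> lnN p * (\sum_(z : box m y) logn p (N z))%N%:R <= E1 p + E2 p + E3 p.
  move=> pp; have p0 : 0 < p%:R :> R by rewrite ltr0n prime_gt0.
  have l0 : 0 <= lnN p by apply/lnN_ge0/prime_gt0.
  case: (leqP p B) => [pB|Bp].
    rewrite big1 => [|z _]; last exact: logn_shifted_small.
    by rewrite mulr0 !addr_ge0 ?E1_ge0 ?E2_ge0 ?E3_ge0.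
  have pD := coprime_fact pp Bp.
  case: (ltnP p Z) => pZ.
    have h := @sum_logn_shifted p y ((y + 2 * (n * (mult_cst m f * t))).+1 ^ n) pp Bp y0
     ltac:(by move=> k r pk rt rp; apply: card_zeros_sharp).
    apply: le_trans (ler_wpM2l l0 h) _.
    rewrite /E1 pZ Bp /= natrM -/X mulrDr -[_ + E3 p]addrA; apply: lerD.
      have := sharp_ratio t0; rewrite -/y -/X; set U := (_ ^ n)%N%:R => hU.
      have -> : 9 / 8 * X%:R * ((c p)%:R * lnN p / p%:R) = lnN p * ((c p)%:R * (9 / 8 * X%:R / p%:R)).
        by field; rewrite lt0r_neq0.
      by rewrite !ler_wpM2l // ler_wpM2r // invr_ge0.
    rewrite -[leLHS]add0r; apply: lerD; first exact: E2_ge0.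
    by rewrite le_eqVlt; apply/orP; left; apply/eqP; rewrite /E3; field; rewrite lt0r_neq0.
  have h := @sum_logn_shifted p y (Cr * X) pp Bp y0
     ltac:(by move=> k r pk rt rp; apply: card_zeros1).
  apply: le_trans (ler_wpM2l l0 h) _.
  rewrite /E1 ltnNge pZ /= add0r mulrDr -/X; apply: lerD.
    rewrite /E2; apply: ler_wpM2l => //.
    rewrite -mulrA; apply: ler_pM => //; first by rewrite divr_ge0.
      by rewrite ler_nat splits_le.
    rewrite natrM -mulrA ler_wpM2l // ler_pdivrMr // XTZ natrM ler_wpM2l // ler_nat //.
  by rewrite le_eqVlt; apply/orP; left; apply/eqP; rewrite /E3 natrM; field; rewrite lt0r_neq0.
have high : \sum_(z : box m y) lnN (N z) <=
    9 / 8 * X%:R * wsum R B c Z + n%:R * Cr%:R * T%:R * (W%:R * lnN 16) + 3 * n%:R * (Cr%:R * X%:R) * 2.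
  rewrite eqs; apply: le_trans (_ : \sum_(0 <= p < W.+1 | prime p) (E1 p + E2 p + E3 p) <= _).
    exact: ler_sum.
  rewrite !big_split; apply: lerD; first apply: lerD.
  - rewrite (big_cat_nat (n := Z)) //=; last exact: leqW.
    rewrite [X in _ + X <= _]big_nat_cond [X in _ + X <= _]big1 ?addr0; last first.
      by move=> p /andP[/andP[Zp _] _]; rewrite /E1 ltnNge Zp.
    rewrite /wsum mulr_sumr big_nat_cond [leRHS]big_nat_cond big_mkcond [leRHS]big_mkcond.
    apply: ler_sum => p _ /=; rewrite /E1; case: (p < Z)%N => //=.
    by case: (prime p); case: (B < p)%N.
  - by rewrite -mulr_suml mulrC ler_wpM2l ?mulr_ge0 // sum_ln_primes.
  rewrite -mulr_sumr ler_wpM2l ?mulr_ge0 //.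
  apply: le_trans (sum_ln_sq R W.+1); rewrite [leRHS]big_nat_cond.
  rewrite big_mkcond; case: (W) => [|W']; first by rewrite big_nat1 /= big_geq.
  rewrite big_ltn // big_ltn //= !add0r -big_mkcond big_nat_cond big_mkcond [leRHS]big_mkcond.
  apply: ler_sum => p _; case: ifP => [/andP[h pp]|_]; rewrite ?h //=.
  by case: ifP => // /andP[/andP[h _] _]; rewrite divr_ge0 ?exprn_ge0 // lnN_ge0 // (ltnW h).
have := le_trans low high.
rewrite /W natrM; have XR : 0 < X%:R :> R by rewrite ltr0n.
move: (wsum _ _ _ _) (lnN X) (lnN _) (lnN 16) => S lX l32 l16.
move: (n%:R : R) (Cr%:R : R) (T%:R : R) (CW%:R : R) (X%:R : R) XR => a b d e x x0 h.
rewrite -(ler_pM2l x0); lra.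
Qed.

End Lower.

(** The lower bound for [f1] and the upper bound for [f2] have leading constants 5/6 and 8/7, so
    S_f2 >= 2 S_f1 fails for large arguments. *)
Lemma no_double_split (m1 m2 : nat) (f1 f2 : {poly int}) (B : nat) :
  f1 \is monic -> size f1 = m1.+2 -> irreducible_poly (map_poly intr f1 : {poly rat}) ->
  f2 \is monic -> size f2 = m2.+2 -> irreducible_poly (map_poly intr f2 : {poly rat}) ->
  ~ (forall p, prime p -> (B < p)%N ->
       exists c1 c2, [/\ splits m1 f1 p c1, splits m2 f2 p c2 & (2 * c1 <= c2)%N]).
Proof.
move=> mon1 sz1 irr1 mon2 sz2 irr2 H; pose R : realType := Rdefinitions.R.
have /choice[c hc] : forall p, exists c : nat * nat, prime p -> (B < p)%N ->
    [/\ splits m1 f1 p c.1, splits m2 f2 p c.2 & (2 * c.1 <= c.2)%N].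
  move=> p; have [/andP[pp Bp]|h] := boolP (prime p && (B < p)%N).
    by have [c1 [c2 h]] := H p pp Bp; exists (c1, c2).
  by exists (0, 0)%N => pp Bp; rewrite pp Bp in h.
have s1 p (pp : prime p) (Bp : (B < p)%N) : splits m1 f1 p (c p).1 by have [] := hc p pp Bp.
have s2 p (pp : prime p) (Bp : (B < p)%N) : splits m2 f2 p (c p).2 by have [] := hc p pp Bp.
have [q [C [q0 low]]] := wsum_lower R mon1 sz1 irr1 s1.
set w1 := wsum R B _ in low; pose w2 := wsum R B (fun p => (c p).2).
have w12 Z : 2 * w1 Z <= w2 Z.
  rewrite /w1 /w2 /wsum mulr_sumr; apply: ler_sum => p /andP[pp Bp].
  have [_ _] := hc p pp Bp; rewrite -(ler_nat R) natrM !mulrA => h.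
  rewrite ler_wpM2r ?invr_ge0 // ler_wpM2r // lnN_ge0 // prime_gt0 //.
pose K := (det_cst m2 f2 * 8 ^ m2.+1)%N.
have K0 : (0 < K)%N by rewrite /K /det_cst !muln_gt0 fact_gt0 !expn_gt0.
(* Both estimates are evaluated at Z = x^(n1 n2): [t = x ^ n2] in the lower one, side [8 * x ^ n1]
   in the upper one. Eliminating the sums leaves 7/8 (5/3 - 8/7) = 11/24 as the coefficient of ln
   Z. *)
have bound x : (0 < x)%N -> 11 / 24 * ln ((x ^ (m1.+1 * m2.+1))%N%:R : R) <= ln (K%:R : R) + 14 / 9 * C.
  move=> x0; have t0 : (0 < x ^ m2.+1)%N by rewrite expn_gt0 x0.
  have := low _ t0; rewrite -expnM [(m2.+1 * _)%N]mulnC; set Z := (x ^ (m1.+1 * m2.+1))%N.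
  have Z0 : (0 < Z)%N by rewrite expn_gt0 x0.
  have le : ln (Z%:R : R) <= ln (((q * x ^ m2.+1) ^ m1.+1)%N%:R : R).
    by apply: lnN_le => //; rewrite expnMn -expnM [(m2.+1 * _)%N]mulnC -/Z leq_pmull // expn_gt0 q0.
  have y0 : (0 < 8 * x ^ m1.+1)%N by rewrite muln_gt0 expn_gt0 x0.
  have := @wsum_upper R m2 f2 mon2 sz2 irr2 B _ s2 _ Z y0.
  rewrite expnMn -expnM -/Z mulnA -/K lnNM // => /(_ _) up.
  have {}up : 7 / 8 * w2 Z <= ln (K%:R : R) + ln (Z%:R : R).
    by apply: up; rewrite leq_mul2r expnS leq_pmulr ?orbT // expn_gt0.
  move: (w12 Z) le up; move: (w1 Z) (w2 Z) (ln (Z%:R : R)) (ln (K%:R : R)) (ln _).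
  move=> a b lz lk l; lra.
have l2 : 0 < ln (2%:R : R) by rewrite ln_gt0 // ltr1n.
pose C' : R := 24 / 11 * (ln (K%:R : R) + 14 / 9 * C) / ln (2%:R : R).
pose j := Num.bound `|C'|.
have := bound (2 ^ j)%N; rewrite expn_gt0 => /(_ isT).
have : ln ((2 ^ j)%N%:R : R) <= ln (((2 ^ j) ^ (m1.+1 * m2.+1))%N%:R : R).
  by apply: lnN_le; rewrite ?expn_gt0 // -[leqLHS]expn1 leq_pexp2l ?expn_gt0.
rewrite lnNX //.
have : C' < j%:R by apply: le_lt_trans (ler_norm _) _; apply: archi_boundP; apply: normr_ge0.
rewrite /C' ltr_pdivrMr //; move: (ln (2%:R : R)) l2 => l l0.
move: (ln (K%:R : R)) (ln _) (j%:R : R) => lk lz jj; lra.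
Qed.

(** * Integral elements *)

Section Integral.
Variable L : fieldExtType rat.
Local Notation toL := (map_poly (intr : int -> L)).
Implicit Types (x y : L).

Lemma integralP x : integral x <-> integralOver (intr : int -> L) x.
Proof. by split=> [[p [mp rp]]|[p mp rp]]; exists p. Qed.

Lemma integralD x y : integral x -> integral y -> integral (x + y).
Proof. by rewrite !integralP; apply: integral_add. Qed.
Lemma integralM x y : integral x -> integral y -> integral (x * y).
Proof. by rewrite !integralP; apply: integral_mul. Qed.
Lemma integralN x : integral x -> integral (- x).
Proof. by rewrite !integralP; apply: integral_opp. Qed.
Lemma integralB x y : integral x -> integral y -> integral (x - y).
Proof. by move=> hx hy; apply: integralD => //; apply: integralN. Qed.
Lemma integral_int (z : int) : integral (z%:~R : L).
Proof. by rewrite integralP; apply: integral_id. Qed.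
Lemma integral_nat (n : nat) : integral (n%:R : L).
Proof. exact: (integral_int n%:Z). Qed.
Lemma integral0 : integral (0 : L). Proof. exact: (integral_nat 0). Qed.
Lemma integral1 : integral (1 : L). Proof. exact: (integral_nat 1). Qed.
Lemma integralX x n : integral x -> integral (x ^+ n).
Proof.
move=> hx; elim: n => [|n IH]; first exact: integral1.
by rewrite exprS; apply: integralM.
Qed.
Lemma integral_sum (I : Type) (r : seq I) (P : pred I) (F : I -> L) :
  (forall i, P i -> integral (F i)) -> integral (\sum_(i <- r | P i) F i).
Proof.
by move=> h; apply: (big_ind (@integral L)) => //; [apply: integral0 | apply: integralD].
Qed.
Lemma integral_horner (u : {poly int}) x : integral x -> integral (toL u).[x].
Proof.
move=> hx; rewrite horner_coef; apply: integral_sum => i _.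
by apply: integralM; [rewrite coef_map; apply: integral_int | apply: integralX].
Qed.

Lemma intr_inj_ext (a b : int) : a%:~R = b%:~R :> L -> a = b.
Proof.
have e (z : int) : z%:~R = (z%:~R : rat)%:A :> L by rewrite scaler_int.
rewrite !e => /(fmorph_inj (in_alg L)); exact: intr_inj.
Qed.

Lemma natr_ext_eq0 (n : nat) : (n%:R == 0 :> L) = (n == 0)%N.
Proof.
by apply/eqP/eqP => [h|->//]; have := @intr_inj_ext n%:Z 0; rewrite -pmulrn h => /(_ erefl) [].
Qed.

Lemma natr_ext_neq0 (n : nat) : (0 < n)%N -> n%:R != 0 :> L.
Proof. by rewrite natr_ext_eq0 lt0n. Qed.

(** Once powers of X are divided out, an equation of [x] has a nonzero constant term, and [x]
    divides it. *)
Lemma integral_dvd_int x : integral x -> x != 0 ->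
  exists (n : nat) y, [/\ (0 < n)%N, integral y & x * y = n%:R].
Proof.
move=> hx x0.
suff [c [y [c0 hy e]]] : exists (c : int) y, [/\ c != 0, integral y & x * y = c%:~R].
  case: (intP c) c0 e => [|n|n] // _ e; first by exists n.+1, y.
  exists n.+1, (- y); split=> //; first exact: integralN.
  by rewrite mulrN e rmorphN opprK.
have [p [mp]] := hx; have := monic_neq0 mp => {mp}.
elim/poly_ind: p => [|p c IH]; first by rewrite eqxx.
move=> pc0; rewrite rmorphD rmorphM /= map_polyX map_polyC /= rootE !hornerE => e.
have [c0|c0] := eqVneq c 0.
  move: e pc0; rewrite c0 !addr0 mulf_eq0 (negPf x0) orbF => e pc0.
  by apply: IH e; apply: contraNneq pc0 => ->; rewrite mul0r.
exists (- c), (toL p).[x]; split; rewrite ?oppr_eq0 //; first exact: integral_horner.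
by move: e; rewrite addr_eq0 mulrC rmorphN => /eqP.
Qed.

Definition int_minpoly x (f : {poly int}) :=
  [/\ f \is monic, irreducible_poly (map_poly intr f : {poly rat}) & root (toL f) x].

Lemma toL_toQ (f : {poly int}) : toL f = map_poly (in_alg L) (map_poly intr f).
Proof.
by rewrite -map_poly_comp; apply: eq_map_poly => z /=; rewrite scaler_int.
Qed.

Lemma int_minpoly_integral x f : int_minpoly x f -> integral x.
Proof. by case=> mf _ rf; exists f. Qed.

Lemma exists_int_minpoly x : exists2 a : int, a != 0 & exists f, int_minpoly (a%:~R * x) f.
Proof.
have /polyOver1P[q Dq] := minPolyOver 1%AS x.
have [u [a a0 qu]] := rat_poly_scale q.
pose n := adjoin_degree 1%AS x.
have sq : size q = n.+1 by rewrite -(size_map_poly (in_alg L)) -Dq size_minPoly.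
have mq : q \is monic by rewrite -(map_monic (in_alg L)) -Dq monic_minPoly.
have qi i : q`_i = a%:~R^-1 * (u`_i)%:~R by rewrite qu coefZ coef_map.
have aQ : a%:~R != 0 :> rat by rewrite intr_eq0.
(* The minimal polynomial of [a * x] has coefficients q_i a^(n - i), and [u] is [a] times [q]. At i
   = n the truncated exponent [n - i.+1] would be one too large, hence the separate leading 1. *)
pose f : {poly int} := \poly_(i < n.+1) (if i == n then 1 else u`_i * a ^+ (n - i.+1)).
have fi i : (map_poly intr f : {poly rat})`_i = q`_i * a%:~R ^+ (n - i).
  rewrite coef_map coef_poly; case: ltnP => hi; last by rewrite nth_default ?mul0r ?sq.
  case: eqVneq => [->|ni].
    by rewrite subnn expr0 mulr1; have /monicP := mq; rewrite lead_coefE sq => ->.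
  have lt_i : (i < n)%N by rewrite ltn_neqAle ni -ltnS hi.
  rewrite /= intrM rmorphXn /= qi -(subnSK lt_i) exprS.
  by rewrite [a%:~R^-1 * _]mulrC -mulrA mulKf.
have fn : f`_n = 1 by rewrite coef_poly ltnSn eqxx.
have sf : size f = n.+1.
  by apply/eqP; rewrite eqn_leq size_poly /= ltnNge; apply/negP => /(nth_default 0); rewrite fn => /eqP; rewrite oner_eq0.
have mf : f \is monic by rewrite monicE lead_coefE sf fn.
pose y := a%:~R * x.
have aL : a%:~R != 0 :> L by apply: contra a0 => /eqP h; apply/eqP/intr_inj_ext.
have ry : root (toL f) y.
  have sfL : size (toL f) = n.+1 by rewrite size_map_poly_id0 ?sf // (monicP mf) oner_eq0.
  have := minPolyxx 1%AS x; rewrite Dq horner_coef size_map_poly sq => e.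
  rewrite rootE horner_coef sfL; apply/eqP.
  transitivity (a%:~R ^+ n * \sum_(i < n.+1) (map_poly (in_alg L) q)`_i * x ^+ i); last first.
    by rewrite e mulr0.
  rewrite mulr_sumr; apply: eq_bigr => i _; rewrite toL_toQ coef_map fi coef_map.
  change (in_alg L (q`_i * a%:~R ^+ (n - i)) * y ^+ i = a%:~R ^+ n * (in_alg L q`_i * x ^+ i)).
  rewrite rmorphM rmorphXn rmorph_int /y exprMn.
  have -> : a%:~R ^+ n = a%:~R ^+ (n - i) * a%:~R ^+ i :> L by rewrite -exprD subnK // -ltnS.
  by move: (a%:~R ^+ _) (a%:~R ^+ _) => b c; ring.
exists a => //; exists f; split => //.
have yE : y = (a%:~R : rat) *: x by rewrite scaler_int /y mulrzl.
have Ey : (<<1; y>> = <<1; x>>)%VS.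
  apply/eqP; rewrite eqEsubv; apply/andP; split; apply/FadjoinP; split; rewrite ?sub1v //.
    by rewrite yE memvZ // memv_adjoin.
  by have -> : x = (a%:~R : rat)^-1 *: y; [rewrite yE scalerK // | rewrite memvZ // memv_adjoin].
have Df : map_poly (in_alg L) (map_poly intr f) = minPoly 1%AS y.
  rewrite -toL_toQ; apply/eqP; rewrite -eqp_monic ?monic_minPoly ?monic_map // eqp_sym.
  rewrite -dvdp_size_eqp; last first.
    by apply: minPoly_dvdp => //; rewrite toL_toQ; apply/polyOver1P; exists (map_poly intr f).
  rewrite size_minPoly size_map_poly_id0 ?sf ?(monicP mf) ?oner_eq0 // adjoin_degreeE Ey -adjoin_degreeE.
  by rewrite eqxx.
split=> [|r sr dr].
  by rewrite size_map_poly_id0 ?sf ?(monicP mf) ?oner_eq0 // ltnS /n adjoin_degreeE; rewrite divn_gt0 ?adim_gt0 // dimvS // subv_adjoin.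
have rO : map_poly (in_alg L) r \is a polyOver 1%VS by apply/polyOver1P; exists r.
have := @minPoly_irr _ _ 1%AS y _ rO; rewrite -Df dvdp_map => /(_ dr).
move=> /orP[]; first by rewrite eqp_map.
by move/eqp_size; rewrite size_map_poly size_poly1 => sr1; rewrite sr1 in sr.
Qed.

Section IntMinpoly.
Variables (x : L) (f : {poly int}).
Hypothesis xf : int_minpoly x f.

Let f_monic : f \is monic. Proof. by case: xf. Qed.

(** Division by a monic polynomial stays over the integers; the remainder vanishes at [x] and has
    too small a degree. *)
Lemma int_minpoly_dvd (v : {poly int}) : (toL v).[x] = 0 -> exists w, v = w * f.
Proof.
have [mf irr rf] := xf => vx.
have e := Pdiv.RingMonic.rdivp_eq f_monic v.
exists (Pdiv.Ring.rdivp v f); rewrite {1}e; apply/eqP; rewrite addrC -subr_eq0 addrK.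
set r := Pdiv.Ring.rmodp v f in e *.
have rx : (toL r).[x] = 0.
  move: vx; rewrite {1}e rmorphD rmorphM /= hornerD hornerM (rootP rf) mulr0 add0r //.
apply: contraT => r0.
have rQ0 : (map_poly intr r : {poly rat}) != 0.
  by rewrite map_poly_eq0_id0 // intr_eq0 lead_coef_eq0.
have : coprimep (map_poly intr f : {poly rat}) (map_poly intr r).
  rewrite irreducible_poly_coprime //; apply/negP => /dvdp_leq -/(_ rQ0).
  rewrite size_map_poly_id0 ?(monicP f_monic) ?oner_eq0 // size_map_poly_id0 ?intr_eq0 ?lead_coef_eq0 //.
  by rewrite leqNgt Pdiv.Ring.ltn_rmodp monic_neq0.
rewrite -(coprimep_map (in_alg L)) -!toL_toQ => /coprimep_root /(_ rf).
by rewrite rx eqxx.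
Qed.

End IntMinpoly.
End Integral.

(** A Bezout relation between [f] and its derivative over Q, cleared of denominators, has a constant
    right-hand side that stays invertible modulo every larger prime. *)
Lemma separable_mod_large (f : {poly int}) :
  f \is monic -> irreducible_poly (map_poly intr f : {poly rat}) ->
  exists B, forall p, (B < p)%N -> forall k : fieldType, p \in [pchar k] ->
    separable_poly (map_poly intr f : {poly k}).
Proof.
move=> mf irr.
have : coprimep (map_poly intr f : {poly rat}) (map_poly intr f)^`().
  have szQ : size (map_poly intr f : {poly rat}) = size f.
    by rewrite size_map_poly_id0 // (monicP mf) oner_eq0.
  have f1 : (1 < size f)%N by rewrite -szQ; case: irr.
  have d0 : (map_poly intr f : {poly rat})^`() != 0.
    apply/eqP => /polyP/(_ (size f).-2); rewrite coef_deriv coef_map coef0 /=.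
    rewrite prednK -?subn1 ?subn_gt0 // subn1.
    have -> : f`_(size f).-1 = 1 by apply/monicP.
    by move/eqP; rewrite pnatr_eq0; move: f1; case: (size f) => [|[|]].
  rewrite irreducible_poly_coprime //; apply/negP => /dvdp_leq -/(_ d0); rewrite leqNgt.
  by rewrite lt_size_deriv // -size_poly_gt0 szQ ltnW.
move=> /Bezout_eq1_coprimepP[[u v] /= e].
have [U [a a0 Du]] := rat_poly_scale u; have [V [b b0 Dv]] := rat_poly_scale v.
have eZ : (b%:P * U) * f + (a%:P * V) * f^`() = (a * b)%:P.
  apply: (map_inj_poly (f := intr : int -> rat)) => //; first exact: intr_inj.
  rewrite rmorphD !rmorphM /= -deriv_map !map_polyC /= -[RHS]mulr1 -e Du Dv.
  rewrite mulrDr -!mul_polyC; set A := a%:~R; set B := b%:~R.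
  have aA : A%:P * A^-1%:P = 1 by rewrite -polyCM divff // intr_eq0.
  have bB : B%:P * B^-1%:P = 1 by rewrite -polyCM divff // intr_eq0.
  by congr (_ + _); [rewrite -[LHS]mul1r -aA | rewrite -[LHS]mul1r -bB]; ring.
exists (absz (a * b)) => p lt_p k pk.
have ab0 : (a * b)%:~R != 0 :> k.
  rewrite (intr_eq0_pchar _ pk); apply/negP => /dvdn_leq; rewrite absz_gt0 mulf_neq0 // => /(_ isT).
  by rewrite leqNgt lt_p.
rewrite unlock; apply/Bezout_eq1_coprimepP.
exists (((a * b)%:~R)^-1 *: map_poly intr (b%:P * U), ((a * b)%:~R)^-1 *: map_poly intr (a%:P * V)).
have eK : map_poly intr (b%:P * U) * map_poly intr f +
    map_poly intr (a%:P * V) * map_poly intr f^`() = ((a * b)%:~R)%:P :> {poly k}.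
  by rewrite -(rmorphM (map_poly intr)) -(rmorphM (map_poly intr)) -rmorphD eZ /= map_polyC.
by rewrite /= -!scalerAl -scalerDr deriv_map eK -mul_polyC -polyCM mulVf.
Qed.

(** With f = t d and d the gcd of [f] and [u], separability makes [t] coprime to [d], hence to [u];
    as [t] divides a power of [u], it is a unit. *)
Lemma separable_dvdp_exp (k : fieldType) (f u : {poly k}) e :
  separable_poly f -> f %| u ^+ e -> f %| u.
Proof.
move=> sf fu; have f0 := separable_poly_neq0 sf.
pose d := gcdp f u; have [t Dt] : exists t, f = t * d.
  by exists (f %/ d); rewrite divpK // dvdp_gcdl.
have td : coprimep t d by have /separable_polyP[h _] := sf; apply: h; rewrite -Dt.
have tu : coprimep t u.
  apply/coprimepP => h ht hu; apply: (coprimepP _ _ td) => //.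
  by rewrite dvdp_gcd hu andbT (dvdp_trans ht) // Dt dvdp_mulr.
have : t %| 1.
  rewrite -(Gauss_dvdpr _ (coprimep_expr e tu)) mulr1; apply: dvdp_trans fu.
  by rewrite Dt dvdp_mulr.
rewrite dvdp1 => t1; rewrite Dt.
have d0 : d != 0 by rewrite gcdp_eq0 (negPf f0).
have : t * d %= 1 * d by rewrite eqp_mul2r // -size_poly_eq1.
rewrite mul1r => /eqp_dvdl ->; exact: dvdp_gcdr.
Qed.

Section Local.
Variable L : fieldExtType rat.
Local Notation toL := (map_poly (intr : int -> L)).
Variables (x : L) (f : {poly int}).
Hypothesis xf : int_minpoly x f.
Variable p : nat.
Hypothesis p_pr : prime p.
Local Notation toF := (map_poly (intr : int -> 'F_p)).
Hypothesis f_sep : separable_poly (toF f).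

Lemma toF_eq0 (u : {poly int}) : toF u = 0 -> exists v, u = p%:R *: v.
Proof.
move=> u0; exists (map_poly (fun z => (z %/ p)%Z) u).
apply/polyP => i; rewrite coefZ coef_map_id0 ?div0z // mulrC natz divzK //.
have /polyP/(_ i)/eqP := u0; rewrite coef_map coef0 /= (intr_eq0_pchar _ (pchar_Fp p_pr)).
by rewrite dvdzE.
Qed.

(* [Z_(p)[x]] is integrally closed when [f] stays separable modulo [p]. *)
Lemma integral_local y : y \in <<1; x>>%VS -> integral y ->
  exists2 d : nat, coprime p d & exists u, d%:R * y = (toL u).[x].
Proof.
have [mf irr rf] := xf.
move=> xy hy.
have [D D0 [u Du]] : exists2 D : nat, (0 < D)%N & exists u, D%:R * y = (toL u).[x].
  have /Fadjoin1_polyP[q Dq] := xy.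
  have [u [a a0 Dqu]] := rat_poly_scale q.
  have eu : a%:~R * y = (toL u).[x].
    rewrite toL_toQ; have -> : map_poly intr u = a%:~R *: q by rewrite Dqu scalerA divff ?scale1r // intr_eq0.
    by rewrite map_polyZ hornerZ rmorph_int Dq.
  exists (absz a); first by rewrite absz_gt0.
  case: (intP a) a0 eu => [|n|n] // _ eu; first by exists u.
  by exists (- u); rewrite rmorphN hornerN -eu rmorphN mulNr opprK.
move: D D0 u Du; elim/ltn_ind => D IH D0 u Du.
have [cop|] := boolP (coprime p D); first by exists D => //; exists u.
rewrite prime_coprime // negbK => /dvdnP[D' eD].
pose r := Pdiv.Ring.rmodp u f.
have Dr : D%:R * y = (toL r).[x].
  rewrite Du [in LHS](Pdiv.RingMonic.rdivp_eq mf u) rmorphD rmorphM /= hornerD hornerM.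
  by rewrite (rootP rf) mulr0 add0r.
have D'0 : (0 < D')%N by move: D0; rewrite eD muln_gt0 => /andP[].
pose y' := D'%:R * y.
have py' : p%:R * y' = (toL r).[x] by rewrite -Dr eD mulnC natrM mulrA.
have [P [mP rP]] : integral y' by apply: integralM => //; apply: integral_nat.
pose e := (size P).-1.
have eP : size P = e.+1 by rewrite /e prednK // size_poly_gt0 monic_neq0.
(* [P] is a monic equation of y' = r(x) / p. Multiplied by p^e it reads r(x)^e + p v(x) = 0, so [f]
   divides r^e modulo [p]. Being separable, it divides [r], which has smaller degree, and [p]
   cancels from the denominator. *)
pose v : {poly int} := \sum_(i < e) (P`_i * (p%:R) ^+ (e - i.+1)) *: r ^+ i.
have vx : (toL (r ^+ e + p%:R *: v)).[x] = 0.
  have Py : (toL P).[y'] = \sum_(i < e.+1) (P`_i)%:~R * y' ^+ i.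
    rewrite (@horner_coef_wide _ e.+1) ?(leq_trans (size_poly _ _)) ?eP //.
    by apply: eq_bigr => i _; rewrite coef_map.
  rewrite rmorphD hornerD rmorphXn horner_exp /= -py' map_polyZ hornerZ raddf_sum horner_sum /=.
  transitivity (p%:R ^+ e * (toL P).[y']); last by rewrite (rootP rP) mulr0.
  have Pe : P`_e = 1 by move/monicP: mP; rewrite lead_coefE eP.
  rewrite Py big_ord_recr /= Pe mul1r mulrDr addrC exprMn; congr (_ + _).
  rewrite !mulr_sumr; apply: eq_bigr => i _; rewrite map_polyZ hornerZ rmorphXn horner_exp /= -py'.
  rewrite intrM rmorphXn /= !rmorph_nat exprMn.
  have -> : p%:R ^+ e = p%:R * p%:R ^+ (e - i.+1) * p%:R ^+ i :> L.
    by rewrite -exprS subnSK // -exprD subnK // ltnW.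
  by move: (p%:R ^+ _) (p%:R ^+ i) (y' ^+ i) => a b c; ring.
have [w ew] := int_minpoly_dvd xf vx.
have : toF f %| toF r ^+ e.
  have /(congr1 toF) := ew; rewrite rmorphD rmorphXn /= map_polyZ rmorph_nat.
  by rewrite (pcharf0 (pchar_Fp p_pr)) scale0r addr0 rmorphM /= => ->; apply: dvdp_mull.
move=> /(separable_dvdp_exp f_sep) fr.
have /toF_eq0[s es] : toF r = 0.
  apply/eqP; apply: contraT => r0; have := dvdp_leq r0 fr.
  rewrite size_map_poly_id0 ?(monicP mf) ?oner_eq0 // => /leq_trans/(_ (size_poly _ _)).
  by rewrite leqNgt Pdiv.Ring.ltn_rmodp monic_neq0.
apply: (IH D' _ D'0 s).
  by rewrite eD ltn_Pmulr // prime_gt1.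
have p0 : p%:R != 0 :> L by rewrite natr_ext_neq0 // prime_gt0.
apply: (mulfI p0); by rewrite -/y' py' es map_polyZ hornerZ rmorph_nat.
Qed.
End Local.

(** * Places and Frobenius elements *)

Section Generators.
Variable L : fieldExtType rat.
Local Notation toL := (map_poly (intr : int -> L)).

Lemma num_separable (K : {subfield L}) (x : L) : separable_element K x.
Proof.
apply: pcharf0_separable; apply/pcharf0P => n.
by rewrite natr_ext_eq0.
Qed.

Lemma num_primitive (K E : {subfield L}) : (K <= E)%VS -> exists a, E = <<K; a>>%AS.
Proof.
move=> sKE; exists (separable_generator K E); apply: val_inj => /=.
apply: eq_adjoin_separable_generator => //; apply/separableP => x _; exact: num_separable.
Qed.

Lemma adjoin_scale (K : {subfield L}) (a : int) (x : L) : a != 0 ->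
  (<<K; a%:~R * x>> = <<K; x>>)%VS.
Proof.
move=> a0; have aQ : a%:~R != 0 :> rat by rewrite intr_eq0.
have -> : a%:~R * x = (a%:~R : rat) *: x by rewrite scaler_int mulrzl.
apply/eqP; rewrite eqEsubv; apply/andP; split; apply/FadjoinP; split; rewrite ?subv_adjoin //.
  by rewrite memvZ // memv_adjoin.
have {1}-> : x = (a%:~R : rat)^-1 *: (a%:~R *: x) by rewrite scalerK.
by rewrite memvZ // memv_adjoin.
Qed.

Lemma int_primitive (K E : {subfield L}) : (K <= E)%VS ->
  exists x f, int_minpoly x f /\ E = <<K; x>>%AS.
Proof.
move=> sKE; have [y Ey] := num_primitive sKE.
have [a a0 [f hf]] := exists_int_minpoly y.
exists (a%:~R * y), f; split=> //; apply: val_inj => /=.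
by rewrite adjoin_scale // Ey.
Qed.

Lemma int_minpolyE x f : int_minpoly x f -> toL f = minPoly 1%AS x.
Proof.
move=> [mf irr rf]; apply/eqP; rewrite -eqp_monic ?monic_minPoly ?monic_map //.
rewrite eqp_sym; set q := minPoly 1%AS x.
have fO : toL f \is a polyOver 1%VS by rewrite toL_toQ; apply/polyOver1P; eexists.
have /polyOver1P[r Dr] := minPolyOver 1%AS x.
have : q %| toL f by apply: minPoly_dvdp.
rewrite toL_toQ /q Dr dvdp_map eqp_map => rf'; have [_ h] := irr; apply: h => //.
rewrite -(size_map_poly (in_alg L)) -Dr size_minPoly eqSS -lt0n adjoin_degreeE.
by rewrite divn_gt0 ?adim_gt0 // dimvS // subv_adjoin.
Qed.

Lemma int_minpoly_size (x : L) f : int_minpoly x f -> size f = (adjoin_degree 1%AS x).+1.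
Proof.
move=> xf; rewrite -size_minPoly -(int_minpolyE xf) size_map_poly_id0 //.
by have [mf _ _] := xf; rewrite (monicP mf) oner_eq0.
Qed.

End Generators.

Section Place.
Variable N : splittingFieldType rat.
Local Notation toN := (map_poly (intr : int -> N)).
Local Notation gT := (gal_of {:N}).

(** Reduction modulo a prime of [N] above [p], as a total function on [N] constrained only on
    integral elements. *)
Record place (p : nat) (k : fieldType) (Phi : N -> k) : Prop := Place {
  place_char : p \in [pchar k];
  place1 : Phi 1 = 1;
  placeD : forall x y, integral x -> integral y -> Phi (x + y) = Phi x + Phi y;
  placeM : forall x y, integral x -> integral y -> Phi (x * y) = Phi x * Phi y }.

Lemma num_galois (K : {subfield N}) : galois K {:N}.
Proof.
rewrite /galois subvf normalFieldf andbT /=; apply/separableP => x _; exact: num_separable.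
Qed.

Lemma integral_gal (g : gT) x : integral x -> integral (g x).
Proof.
move=> [p [mp rp]]; exists p; split => //.
have -> : toN p = map_poly g (toN p).
  by rewrite -map_poly_comp; apply: eq_map_poly => z /=; rewrite rmorph_int.
by rewrite rootE horner_map (rootP rp) rmorph0.
Qed.

Section PlaceTheory.
Variables (p : nat) (k : fieldType) (Phi : N -> k).
Hypothesis PhiP : place p Phi.

Lemma place0 : Phi 0 = 0.
Proof.
have := placeD PhiP (integral0 N) (integral0 N); rewrite addr0 => /eqP.
by rewrite -subr_eq0 opprD addrA subrr sub0r oppr_eq0 => /eqP.
Qed.

Lemma placeN x : integral x -> Phi (- x) = - Phi x.
Proof.
move=> hx; apply/eqP; rewrite -addr_eq0 -(placeD PhiP) ?addNr ?place0 //.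
exact: integralN.
Qed.

Lemma placeB x y : integral x -> integral y -> Phi (x - y) = Phi x - Phi y.
Proof. by move=> hx hy; rewrite (placeD PhiP) ?placeN //; apply: integralN. Qed.

Lemma place_nat n : Phi n%:R = n%:R.
Proof.
elim: n => [|n IH]; first exact: place0.
by rewrite -natr1 (placeD PhiP) ?IH ?(place1 PhiP) ?natr1 //; [apply: integral_nat | apply: integral1].
Qed.

Lemma place_int (z : int) : Phi z%:~R = z%:~R.
Proof.
case: (intP z) => [|n|n]; [exact: place0 | exact: place_nat |].
by rewrite !rmorphN placeN ?place_nat //; apply: integral_nat.
Qed.

Lemma placeX x n : integral x -> Phi (x ^+ n) = Phi x ^+ n.
Proof.
move=> hx; elim: n => [|n IH]; first exact: place1 PhiP.
by rewrite !exprS (placeM PhiP) ?IH //; apply: integralX.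
Qed.

Lemma place_sum (I : Type) (r : seq I) (F : I -> N) :
  (forall i, integral (F i)) -> Phi (\sum_(i <- r) F i) = \sum_(i <- r) Phi (F i).
Proof.
move=> hF; elim: r => [|i r IH]; first by rewrite !big_nil place0.
by rewrite !big_cons (placeD PhiP) ?IH //; apply: integral_sum.
Qed.

Lemma place_horner (u : {poly int}) x : integral x ->
  Phi (toN u).[x] = (map_poly intr u).[Phi x].
Proof.
move=> hx; have sz (R : nzRingType) : (size (map_poly intr u : {poly R}) <= size u)%N.
  exact: size_poly.
rewrite (horner_coef_wide _ (sz _)) (horner_coef_wide _ (sz _)) place_sum => [|i].
  apply: eq_bigr => i _; rewrite !coef_map /= (placeM PhiP) ?place_int ?placeX //.
    exact: integral_int.
  exact: integralX.
by apply: integralM; [rewrite coef_map; apply: integral_int | apply: integralX].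
Qed.

Lemma place_gal (g : gT) : place p (Phi \o g).
Proof.
split=> /=; first exact: place_char PhiP.
- by rewrite rmorph1 (place1 PhiP).
- by move=> x y hx hy; rewrite rmorphD (placeD PhiP) //; apply: integral_gal.
- by move=> x y hx hy; rewrite rmorphM (placeM PhiP) //; apply: integral_gal.
Qed.

End PlaceTheory.

(** [x] divides a positive integer, so [Phi x = 0] puts [p] among the divisors of that integer. *)
Lemma place_neq0 (x : N) : integral x -> x != 0 ->
  exists B, forall p (k : fieldType) (Phi : N -> k), (B < p)%N -> place p Phi -> Phi x != 0.
Proof.
move=> hx x0; have [n [y [n0 hy e]]] := integral_dvd_int hx x0.
exists n => p k Phi lt_p PhiP; apply/eqP => Px.
have := placeM PhiP hx hy; rewrite e Px mul0r (place_nat PhiP) => /eqP.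
rewrite -(dvdn_pcharf (place_char PhiP)) => /dvdn_leq -/(_ n0).
by rewrite leqNgt lt_p.
Qed.

Lemma place_inj_seq (s : seq N) : (forall x, x \in s -> integral x) ->
  exists B, forall p (k : fieldType) (Phi : N -> k), (B < p)%N -> place p Phi -> {in s &, injective Phi}.
Proof.
move=> hs.
have /choice[B hB] : forall xy : N * N, exists B, xy.1 \in s -> xy.2 \in s -> xy.1 != xy.2 ->
    forall p (k : fieldType) (Phi : N -> k), (B < p)%N -> place p Phi -> Phi xy.1 != Phi xy.2.
  move=> [x y] /=; case: (boolP (x \in s)) => xs; last by exists 0%N.
  case: (boolP (y \in s)) => ys; last by exists 0%N.
  have [xy|xy] := eqVneq x y; first by exists 0%N.
  have [|B hB] := @place_neq0 (x - y) (integralB (hs _ xs) (hs _ ys)); first by rewrite subr_eq0.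
  exists B => _ _ _ p k Phi lt_p PhiP; have := hB p k Phi lt_p PhiP.
  by rewrite (placeB PhiP) ?subr_eq0 //; apply: hs.
exists (\max_(xy <- [seq (x, y) | x <- s, y <- s]) B xy) => p k Phi lt_p PhiP x y xs ys e.
apply/eqP; apply: contraT => xy; have := hB (x, y) xs ys xy p k Phi _ PhiP.
rewrite /= e eqxx; apply; apply: leq_ltn_trans lt_p.
by apply: (@leq_bigmax_seq _ _ xpredT B (x, y)) => //; apply/allpairsP; exists (x, y).
Qed.

End Place.

Lemma exists_root_ext p (f : {poly 'F_p}) : prime p -> (1 < size f)%N ->
  exists (k : fieldType) (phi : {rmorphism 'F_p -> k}) (r : k), root (map_poly phi f) r.
Proof.
move=> pp f1; have f0 : f != 0 by rewrite -size_poly_gt0 ltnW.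
have [K [rs Ers _]] := FinSplittingFieldFor f0.
exists K, (in_alg K).
case: rs Ers => [|r rs] Ers.
  move/eqp_size: Ers; rewrite big_nil size_poly1 size_map_poly => s1; rewrite s1 in f1.
  by [].
by exists r; rewrite (eqp_root Ers) root_prod_XsubC inE eqxx.
Qed.

Section PlaceExists.
Variable N : splittingFieldType rat.
Local Notation toN := (map_poly (intr : int -> N)).
Local Notation gT := (gal_of {:N}).

Lemma int_conjugates (x : N) f : int_minpoly x f ->
  exists2 r : seq gT, uniq [seq (g : gT) x | g <- r] &
    toN f = \prod_(b <- [seq (g : gT) x | g <- r]) ('X - b%:P).
Proof.
move=> xf; have /(galois_factors (sub1v _)) h := num_galois (N := N) 1%AS.
by have [r [_ ur er]] := h x (memvf x); exists r => //; rewrite (int_minpolyE xf).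
Qed.

Variables (x : N) (f : {poly int}).
Hypotheses (xf : int_minpoly x f) (x_gen : <<1; x>>%VS = fullv).

(** Every integral [y] is u(x) / d with [d] prime to [p], and is sent to u(r) / d for a root [r] of
    [f] in characteristic [p]. Two such expressions differ by a multiple of [f], so the value is
    well defined. *)
Lemma place_construct p : prime p ->
  separable_poly (map_poly intr f : {poly 'F_p}) ->
  exists (k : fieldType) (Phi : N -> k), place p Phi.
Proof.
move=> pp sep; have [mf irr rf] := xf.
have szf : size (map_poly intr f : {poly 'F_p}) = size f.
  by rewrite size_map_poly_id0 // (monicP mf) oner_eq0.
have f1 : (1 < size f)%N.
  by rewrite (int_minpoly_size xf) ltnS adjoin_degreeE divn_gt0 ?adim_gt0 // dimvS // subv_adjoin.
rewrite -szf in f1; have [k [phi [r rr]]] := exists_root_ext pp f1.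
have pk : p \in [pchar k] by rewrite (fmorph_pchar phi) pchar_Fp.
have {}rr : root (map_poly intr f) r.
  rewrite -map_poly_comp in rr; rewrite (_ : map_poly intr f = map_poly (phi \o intr) f) //.
  by apply: eq_map_poly => z /=; rewrite rmorph_int.
pose ev (u : {poly int}) : k := (map_poly intr u).[r].
have evD u v : ev (u + v) = ev u + ev v by rewrite /ev rmorphD hornerD.
have evM u v : ev (u * v) = ev u * ev v by rewrite /ev rmorphM hornerM.
have evZ (n : nat) u : ev (n%:R *: u) = n%:R * ev u by rewrite /ev map_polyZ rmorph_nat hornerZ.
have copk d : coprime p d -> d%:R != 0 :> k.
  by rewrite -(dvdn_pcharf pk) prime_coprime.
have uniq_ev d u d' u' y : coprime p d -> coprime p d' ->
    d%:R * y = (toN u).[x] -> d'%:R * y = (toN u').[x] -> ev u / d%:R = ev u' / d'%:R.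
  move=> cd cd' e e'.
  have [w ew] : exists w, d'%:R *: u - d%:R *: u' = w * f.
    apply: (int_minpoly_dvd xf).
    by rewrite rmorphB /= !map_polyZ !rmorph_nat hornerD hornerN !hornerZ -e -e'; ring.
  have : d'%:R * ev u - d%:R * ev u' = 0.
    by rewrite -!evZ /ev -hornerN -hornerD -rmorphN -rmorphD ew rmorphM hornerM (rootP rr) mulr0.
  move/eqP; rewrite subr_eq0 => /eqP h; apply/eqP; rewrite eqr_div ?copk //.
  by rewrite mulrC h mulrC.
have /choice[Phi hPhi] : forall y : N, exists z : k, integral y ->
    exists d u, [/\ coprime p d, d%:R * y = (toN u).[x] & z = ev u / d%:R].
  move=> y; have [hy|hy] := EM (integral y); last by exists 0.
  have [|d cd [u du]] := integral_local xf pp sep (y := y) _ hy; first by rewrite x_gen memvf.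
  by exists (ev u / d%:R) => _; exists d, u.
have PhiE y d u : integral y -> coprime p d -> d%:R * y = (toN u).[x] -> Phi y = ev u / d%:R.
  by move=> hy cd du; have [d' [u' [cd' du' ->]]] := hPhi y hy; apply: (uniq_ev _ _ _ _ y).
exists k, Phi; split=> //.
- have e1 : 1%:R * 1 = (toN 1%:P).[x] by rewrite map_polyC hornerC mulr1.
  by rewrite (PhiE 1 1%N _ (integral1 N) (coprimen1 p) e1) /ev map_polyC hornerC divr1.
- move=> y z hy hz; have [d [u [cd du ->]]] := hPhi y hy; have [d' [u' [cd' du' ->]]] := hPhi z hz.
  rewrite (@PhiE _ (d * d')%N (d'%:R *: u + d%:R *: u')) ?coprimeMr ?cd //; last 2 first.
  + exact: integralD.
  + by rewrite rmorphD /= !map_polyZ !rmorph_nat hornerD !hornerZ -du -du' natrM; ring.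
  by rewrite evD !evZ natrM; field; rewrite !copk.
move=> y z hy hz; have [d [u [cd du ->]]] := hPhi y hy; have [d' [u' [cd' du' ->]]] := hPhi z hz.
rewrite (@PhiE _ (d * d')%N (u * u')) ?coprimeMr ?cd //; last 2 first.
- exact: integralM.
- by rewrite natrM (rmorphM (map_poly intr)) hornerM /= -du -du'; ring.
by rewrite evM natrM; field; rewrite !copk.
Qed.

Definition frob_at p (k : fieldType) (Phi : N -> k) (t : gT) : Prop :=
  forall y, integral y -> Phi (t y) = Phi y ^+ p.

(** For large [p] the conjugates of [x] reduce injectively, hence onto the roots of [f]; so the root
    [Phi x ^+ p] is [Phi (t x)] for some [t]. The relation extends to every integral [y] through y =
    u(x) / d. *)
Lemma frob_exists : exists B, forall p, prime p -> (B < p)%N ->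
  exists (k : fieldType) (Phi : N -> k) (t : gT), place p Phi /\ frob_at p Phi t.
Proof.
have [mf irr rf] := xf; have hx := int_minpoly_integral xf.
have [B1 hB1] := separable_mod_large mf irr.
have [r ur er] := int_conjugates xf.
have hr y : y \in [seq (g : gT) x | g <- r] -> integral y.
  by move=> /mapP[g _ ->]; apply: integral_gal.
have [B2 hB2] := place_inj_seq hr.
exists (maxn B1 B2) => p pp; rewrite gtn_max => /andP[lt1 lt2].
have sep := hB1 p lt1 _ (pchar_Fp pp).
have [k [Phi PhiP]] := place_construct pp sep.
have pk := place_char PhiP; pose fk : {poly k} := map_poly intr f.
have Phi_root y : y \in [seq (g : gT) x | g <- r] -> root fk (Phi y).
  move=> yr; have ry : root (toN f) y by rewrite er root_prod_XsubC.
  by rewrite rootE -[fk.[_]](place_horner PhiP _ (hr y yr)) (rootP ry) (place0 PhiP).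
have xr : x \in [seq (g : gT) x | g <- r] by rewrite -root_prod_XsubC -er.
have : root fk (Phi x ^+ p).
  have ef : map_poly (pFrobenius_aut pk) fk = fk.
    by rewrite -map_poly_comp; apply: eq_map_poly => z /=; rewrite rmorph_int.
  by rewrite rootE -ef -(pFrobenius_autE pk) horner_map (rootP (Phi_root x xr)) rmorph0.
move=> rxp; set cs := [seq (g : gT) x | g <- r] in ur er hr hB2 Phi_root xr.
have /mapP[y /mapP[t _ ->] ePhi] : Phi x ^+ p \in map Phi cs.
  apply: contraT => nin.
  have szf : size fk = (size cs).+1.
    rewrite size_map_poly_id0 ?(monicP mf) ?oner_eq0 // -(size_prod_XsubC cs id) -er.
    by rewrite size_map_poly_id0 ?(monicP mf) ?oner_eq0.
  have fk0 : fk != 0 by rewrite -size_poly_gt0 szf.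
  have := @max_poly_roots _ fk (Phi x ^+ p :: map Phi cs) fk0.
  rewrite /= nin rxp map_inj_in_uniq; last exact: hB2 lt2 PhiP.
  rewrite ur szf size_map ltnn; apply => //.
  by apply/allP => _ /mapP[y ycs ->]; apply: Phi_root.
exists k, Phi, t; split=> // {}y hy.
have [|d cd [u du]] := integral_local xf pp sep (y := y) _ hy; first by rewrite x_gen memvf.
have d0 : d%:R != 0 :> k by rewrite -(dvdn_pcharf pk) -prime_coprime.
have e1 : d%:R * Phi y = (map_poly intr u).[Phi x].
  rewrite -(place_horner PhiP) // -du (placeM PhiP) ?(place_nat PhiP) //; exact: integral_nat.
have e2 : d%:R * Phi (t y) = (map_poly intr u).[Phi x ^+ p].
  rewrite ePhi -(place_horner PhiP); last exact: integral_gal.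
  rewrite -(place_nat PhiP) -(placeM PhiP); [|exact: integral_nat|exact: integral_gal].
  have -> : d%:R * t y = t (d%:R * y) by rewrite rmorphM rmorph_nat.
  rewrite du -horner_map -map_poly_comp; congr (Phi _.[_]).
  by apply: eq_map_poly => z /=; rewrite rmorph_int.
apply: (mulfI d0); rewrite e2.
have -> : d%:R = d%:R ^+ p :> k by rewrite -(pFrobenius_autE pk) rmorph_nat.
rewrite -exprMn e1 -!(pFrobenius_autE pk) -horner_map -map_poly_comp; congr _.[_].
by apply: eq_map_poly => z /=; rewrite rmorph_int.
Qed.

End PlaceExists.

(** In a cyclic [l]-group the powers of [s ^+ l] form the unique maximal subgroup, so everything
    outside it generates. *)
Lemma cycle_pelt_generator (gT : finGroupType) (s a : gT) l :
  prime l -> (l.-elt s)%g -> a \in <[s]>%g -> a \notin <[s ^+ l]>%g -> <[a]>%g = <[s]>%g.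
Proof.
move=> pl ls /cycleP[i ->] ni; apply/esym/eqP; rewrite -[_ == _]/(generator _ _) generator_coprime.
have ci : coprime l i.
  by rewrite prime_coprime //; apply: contra ni => /dvdnP[j ->]; rewrite mulnC expgM mem_cycle.
by have [e ->] := p_natP ls; apply: coprimeXl.
Qed.

Section Frobenius.
Variable N : splittingFieldType rat.
Local Notation toN := (map_poly (intr : int -> N)).
Local Notation gT := (gal_of {:N}).

Lemma gal_mulE (g h : gT) (x : N) : (g * h)%g x = h (g x).
Proof. by rewrite galM ?memvf. Qed.

Lemma gal_invK (g : gT) (x : N) : (g^-1)%g (g x) = x.
Proof. by rewrite -gal_mulE mulgV gal_id. Qed.

Lemma gal_Kinv (g : gT) (x : N) : g ((g^-1)%g x) = x.
Proof. by rewrite -gal_mulE mulVg gal_id. Qed.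

(** Products in the Galois group act left factor first, so the condition on [h] says that [t] fixes
    [h y], that is, that the reduction of [h y] is rational. Each conjugate arises from one coset of
    the stabilizer of [y]. *)
Lemma splits_of_place (y : N) g m : int_minpoly y g -> size g = m.+2 ->
  exists B, forall p (k : fieldType) (Phi : N -> k) (t : gT), (B < p)%N ->
    place p Phi -> frob_at p Phi t ->
    exists2 c, splits m g p c &
      (c * #|[set h : gT | h y == y]| = #|[set h : gT | ((h * t * h^-1)%g : gT) y == y]|)%N.
Proof.
move=> yg sg; have [mg irr rg] := yg; have hy := int_minpoly_integral yg.
have [r ur er] := int_conjugates yg; set cs := map _ r in ur er.
have hcs z : z \in cs -> integral z by move=> /mapP[h _ ->]; apply: integral_gal.
have szcs : size cs = m.+1.
  apply/eqP; rewrite -eqSS -(size_prod_XsubC cs id) -er size_map_poly_id0 ?sg //.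
  by rewrite (monicP mg) oner_eq0.
have rootcs z : root (toN g) z = (z \in cs) by rewrite er root_prod_XsubC.
have galcs (h : gT) z : z \in cs -> h z \in cs.
  rewrite -!rootcs => rz.
  have -> : toN g = map_poly h (toN g).
    by rewrite -map_poly_comp; apply: eq_map_poly => w /=; rewrite rmorph_int.
  by rewrite rootE horner_map (rootP rz) rmorph0.
have ycs : y \in cs by rewrite -rootcs.
have [B hB] := place_inj_seq hcs.
exists B => p k Phi t lt_p PhiP frob; have Pinj := hB p k Phi lt_p PhiP.
pose z (i : 'I_m.+1) := cs`_i.
have zcs i : z i \in cs by rewrite mem_nth ?szcs.
pose rho i := Phi (z i).
have rhoE i : (rho i ^+ p == rho i) = (t (z i) == z i).
  rewrite /rho -frob; last exact/hcs.
  by apply/eqP/eqP => [e|->//]; apply: (Pinj _ _ (galcs _ _ (zcs i)) (zcs i) e).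
exists #|[set i | t (z i) == z i]|.
  exists k, rho; split; first exact: place_char PhiP.
  - move=> i j /Pinj e; have /eqP := e (zcs i) (zcs j).
    by rewrite nth_uniq ?szcs // => /eqP/val_inj.
  - move=> i; rewrite rootE /rho -(place_horner PhiP); last exact/hcs.
    have rz : root (toN g) (z i) by rewrite rootcs zcs.
    by rewrite (rootP rz) (place0 PhiP).
  by apply: eq_card => i; rewrite !inE rhoE.
have cE : [set h : gT | ((h * t * h^-1)%g : gT) y == y] = [set h : gT | t (h y) == h y].
  apply/setP => h; rewrite !inE !gal_mulE.
  by apply/eqP/eqP => [e|->]; [rewrite -{2}e gal_Kinv | rewrite gal_invK].
rewrite cE; pose idx (h : gT) : 'I_m.+1 := inord (index (h y) cs).
have zidx h : z (idx h) = h y.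
  have hc := galcs h y ycs.
  by rewrite /z /idx inordK ?nth_index // -szcs index_mem.
rewrite -[RHS]sum1_card (partition_big idx (fun i => t (z i) == z i)) /=; last first.
  by move=> h; rewrite inE zidx.
rewrite -sum_nat_const big_mkcond [RHS]big_mkcond /=; apply: eq_bigr => i _; rewrite inE.
case: ifP => // ti.
have [h0 eh0] : exists h0 : gT, z i = h0 y by have /mapP[h _ e] := zcs i; exists h.
rewrite -(card_imset _ (mulIg h0)) -sum1_card; apply: eq_bigl => h.
rewrite !inE; apply/imsetP/andP => [[h1]|[_ /eqP e]].
  rewrite inE => /eqP e ->; rewrite gal_mulE e -eh0 ti; split=> //.
  apply/eqP/val_inj/eqP; rewrite -(nth_uniq 0 _ _ ur) ?szcs ?ltn_ord //; apply/eqP.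
  by change (z (idx (h1 * h0)%g) = z i); rewrite zidx gal_mulE e eh0.
exists (h * h0^-1)%g; last by rewrite mulgKV.
by rewrite inE gal_mulE -zidx e eh0 gal_invK eqxx.
Qed.

Lemma gal_stab (H : {group gT}) : exists (y : N) g, int_minpoly y g /\
  [set h : gT | h y == y] = H.
Proof.
have [y [g [yg eM]]] := int_primitive (sub1v (fixedField_aspace H)).
exists y, g; split=> //; apply/setP => h; rewrite inE -[in RHS](gal_fixedField H).
have sM := fixedField_bound H.
have yM : y \in fixedField H by have /= -> := congr1 val eM; apply: memv_adjoin.
rewrite gal_kHom //; apply/eqP/kAHomP => [e a|]; last by apply.
have /= -> := congr1 val eM => /Fadjoin1_polyP[q ->].
have eh : map_poly h (map_poly (in_alg N) q) = map_poly (in_alg N) q.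
  by rewrite -map_poly_comp; apply: eq_map_poly => c /=; rewrite rmorph_alg.
transitivity (map_poly h (map_poly (in_alg N) q)).[h y]; first by rewrite horner_map.
by rewrite eh e.
Qed.

Lemma frobenius_element (s : gT) l B : prime l -> (l.-elt s)%g -> s != 1%g ->
  exists p (k : fieldType) (Phi : N -> k) (t : gT),
    [/\ prime p, (B < p)%N, place p Phi, frob_at p Phi t & <[t]>%g = <[s]>%g].
Proof.
move=> pl ls s1; apply: contrapT => noP.
have [x [f [xf xgen]]] := int_primitive (sub1v {:N}%AS).
have {}xgen : <<1; x>>%VS = fullv by have /= <- := congr1 val xgen.
have [B0 hB0] := frob_exists xf xgen.
have [y1 [g1 [yg1 st1]]] := gal_stab <[s]>%G.
have [y2 [g2 [yg2 st2]]] := gal_stab <[s ^+ l]>%G.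
have szg y g : int_minpoly (L := N) y g -> exists m, size g = m.+2.
  by move=> yg; exists (adjoin_degree 1%AS y).-1; rewrite (int_minpoly_size yg).
have [m1 sz1] := szg _ _ yg1; have [m2 sz2] := szg _ _ yg2.
have [B1 hB1] := splits_of_place yg1 sz1; have [B2 hB2] := splits_of_place yg2 sz2.
have [mo1 ir1 _] := yg1; have [mo2 ir2 _] := yg2.
apply: (@no_double_split m1 m2 g1 g2 (maxn B (maxn B0 (maxn B1 B2)))) => // p pp.
rewrite !gtn_max => /and4P[ltB lt0 lt1 lt2].
have [k [Phi [t [PhiP frob]]]] := hB0 p pp lt0.
have [c1 sp1 e1] := hB1 p k Phi t lt1 PhiP frob.
have [c2 sp2 e2] := hB2 p k Phi t lt2 PhiP frob.
exists c1, c2; split=> //.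
have stE y (H : {group gT}) : [set h : gT | h y == y] = H ->
   [set h : gT | ((h * t * h^-1)%g : gT) y == y] = [set h | (h * t * h^-1)%g \in H].
  by move=> <-; apply/setP => h; rewrite !inE.
rewrite (stE _ _ st1) st1 in e1; rewrite (stE _ _ st2) st2 in e2.
(* A conjugate of [t] in <s> but outside <s^l> would generate <s>, and it is a Frobenius for the
   place [Phi \o h], contrary to [noP]. Dividing the two counts by the stabilizer orders then gives
   c2 = l c1. *)
have eqs : [set h | (h * t * h^-1)%g \in <[s]>%g] = [set h | (h * t * h^-1)%g \in <[s ^+ l]>%g].
  apply/setP => h; rewrite !inE; apply/idP/idP => [hs|]; last first.
    by apply/subsetP; rewrite cycle_subG mem_cycle.
  apply: contraT => nl; case: noP; exists p, k, (Phi \o h), (h * t * h^-1)%g; split=> //.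
  - exact: place_gal.
  - move=> y hy /=; rewrite -frob; last exact: integral_gal.
    by rewrite !gal_mulE gal_Kinv.
  exact: cycle_pelt_generator nl.
have ls' : (l %| #[s]%g)%N.
  have [[|e] es] := p_natP ls; last by rewrite es expnS dvdn_mulr.
  by move: s1; rewrite -order_eq1 es.
have ord_s : #[s]%g = (l * #[(s ^+ l)%g]%g)%N by rewrite orderXdiv // mulnC divnK.
have : (c1 * #|<[s]>%g| = c2 * #|<[s ^+ l]>%g|)%N by rewrite e1 e2 /= eqs.
rewrite -![#|<[_]>%g|]/(#[_]%g) ord_s mulnA => /eqP; rewrite eqn_pmul2r ?order_gt0 // => /eqP <-.
by rewrite mulnC leq_mul2l prime_gt1 ?orbT.
Qed.

End Frobenius.

(** * Normal closures and fixing groups *)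

Lemma embed_of_root (E N : fieldExtType rat) (x : E) f (r : N) :
  int_minpoly x f -> <<1; x>>%VS = fullv -> root (map_poly intr f) r ->
  exists iota : {lrmorphism E -> N}, iota x = r.
Proof.
move=> xf xgen rr.
pose evE (q : {poly rat}) : E := (map_poly (in_alg E) q).[x].
pose evN (q : {poly rat}) : N := (map_poly (in_alg N) q).[r].
have evE_ex y : exists q, y = evE q.
  by apply/Fadjoin1_polyP; rewrite xgen memvf.
have ker q : evE q = 0 -> evN q = 0.
  move=> q0; have [mf irr rf] := xf.
  have : minPoly 1%AS x %| map_poly (in_alg E) q.
    by apply: minPoly_dvdp; [apply/polyOver1P; exists q | apply/rootP].
  rewrite -(int_minpolyE xf) toL_toQ dvdp_map => /dvdpP[w ->].
  by rewrite /evN rmorphM hornerM /= -toL_toQ (rootP rr) mulr0.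
have evB (q q' : {poly rat}) : (evE (q - q') = evE q - evE q') * (evN (q - q') = evN q - evN q').
  by rewrite /evE /evN !rmorphB !hornerD !hornerN.
have evM (q q' : {poly rat}) : (evE (q * q') = evE q * evE q') * (evN (q * q') = evN q * evN q').
  by rewrite /evE /evN !rmorphM !hornerM.
have evZ a (q : {poly rat}) : (evE (a *: q) = a *: evE q) * (evN (a *: q) = a *: evN q).
  by rewrite /evE /evN !map_polyZ !hornerZ !mulr_algl.
have /choice[i hi] : forall y, exists z, forall q, y = evE q -> z = evN q.
  move=> y; have [q ->] := evE_ex y; exists (evN q) => q' e.
  by apply/eqP; rewrite -subr_eq0 -(evB q q').2 ker // evB e subrr.
have iE q : i (evE q) = evN q by apply: hi.
have iB : zmod_morphism i.
  by move=> y z; have [q ->] := evE_ex y; have [q' ->] := evE_ex z; rewrite -evB !iE evB.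
have iM : monoid_morphism i.
  split=> [|y z].
    have <- : evE 1 = 1 by rewrite /evE rmorph1 hornerC.
    by rewrite iE /evN rmorph1 hornerC.
  by have [q ->] := evE_ex y; have [q' ->] := evE_ex z; rewrite -evM !iE evM.
have iZ : scalable i.
  by move=> a y; have [q ->] := evE_ex y; rewrite -evZ !iE evZ.
pose iBM := GRing.isZmodMorphism.Build _ _ i iB.
pose iMM := GRing.isMonoidMorphism.Build _ _ i iM.
pose iZM := GRing.isScalable.Build _ _ _ _ i iZ.
pose iL : {lrmorphism E -> N} := HB.pack i iBM iMM iZM.
exists iL; change (i x = r).
have {1}-> : x = evE 'X by rewrite /evE map_polyX hornerX.
by rewrite iE /evN map_polyX hornerX.
Qed.

Lemma normal_closure (E : fieldExtType rat) :
  exists (N : splittingFieldType rat) (iota : {lrmorphism E -> N}), True.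
Proof.
have [x [f [xf xgen]]] := int_primitive (sub1v {:E}%AS).
have {}xgen : <<1; x>>%VS = fullv by have /= <- := congr1 val xgen.
have [mf irr rf] := xf.
have [rs Drs] := closed_field_poly_normal (map_poly intr f : {poly algC}).
have mC : (map_poly intr f : {poly algC}) \is monic by apply: monic_map.
rewrite (monicP mC) scale1r in Drs.
have [Q [QC [s1 Ds gen]]] := num_field_exists rs.
have eQ : map_poly intr f = \prod_(z <- s1) ('X - z%:P) :> {poly Q}.
  apply: (map_poly_inj QC); rewrite -map_poly_comp.
  have -> : map_poly (QC \o intr) f = map_poly intr f.
    by apply: eq_map_poly => z /=; rewrite rmorph_int.
  by rewrite Drs -Ds big_map rmorph_prod /=; apply: eq_bigr => z _; rewrite map_polyXsubC.
have ax : SplittingField.axiom Q.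
  exists (map_poly intr f); first by rewrite toL_toQ; apply/polyOver1P; eexists.
  by exists s1; rewrite ?eQ ?eqpxx.
pose NMixin := FieldExt_isSplittingField.Build _ Q ax.
pose N : splittingFieldType rat := HB.pack Q NMixin.
have [z zs] : exists z, z \in s1.
  have : (1 < size (map_poly intr f : {poly Q}))%N.
    by rewrite size_map_poly_id0 ?(monicP mf) ?oner_eq0 // (int_minpoly_size xf).
  by rewrite eQ size_prod_XsubC; case: (s1) => // z s _; exists z; rewrite inE eqxx.
have rz : root (map_poly intr f) (z : N) by rewrite eQ root_prod_XsubC.
have [iota _] := embed_of_root xf xgen rz.
by exists N, iota.
Qed.

Section FixingGroups.
Variables (E : fieldExtType rat) (N : splittingFieldType rat) (iota : {lrmorphism E -> N}).
Local Notation gT := (gal_of {:N}).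
Implicit Types S : {subfield E}.

Definition img S : {vspace N} := (linfun iota @: S)%VS.

Lemma imgP S y : reflect (exists2 x, x \in S & y = iota x) (y \in img S).
Proof.
apply: (iffP memv_imgP) => -[x xS ->]; exists x => //; by rewrite lfunE.
Qed.

Lemma img_is_aspace S : is_aspace (img S).
Proof.
rewrite /is_aspace has_algid1; last by apply/imgP; exists 1; rewrite ?rmorph1 // mem1v.
apply/prodvP => _ _ /imgP[x xS ->] /imgP[y yS ->]; apply/imgP.
by exists (x * y); rewrite ?rmorphM // memvM.
Qed.

Definition imgF S : {subfield N} := ASpace (img_is_aspace S).

Lemma linfun_iota_ker0 : lker (linfun iota) == 0%VS.
Proof. by apply/lker0P => x y; rewrite !lfunE; apply: fmorph_inj. Qed.

Lemma dim_img S : \dim (imgF S) = \dim S.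
Proof. by rewrite /= limg_dim_eq // (eqP linfun_iota_ker0) capv0. Qed.

(** The group H_S of the overview; [S] sits in [E], so it is first carried into [N] by [iota]. *)
Definition fixg S : {group gT} := ('Gal({:N} / imgF S))%G.

Lemma fixgP S (h : gT) : reflect (forall x, x \in S -> h (iota x) = iota x) (h \in fixg S).
Proof.
rewrite gal_kHom ?subvf //; apply: (iffP kAHomP) => [hS x xS|hS _ /imgP[x xS ->]].
  by apply: hS; apply/imgP; exists x.
exact: hS.
Qed.

Lemma fixg_fixed S y : (forall h, h \in fixg S -> h y = y) -> exists2 x, x \in S & y = iota x.
Proof.
move=> hy; apply/imgP; have /galois_fixedField e := num_galois (imgF S).
have -> : img S = fixedField ('Gal({:N} / imgF S))%g by rewrite e.
by apply/fixedFieldP; rewrite ?memvf.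
Qed.

Lemma fixgS S1 S2 : (S1 <= S2)%VS -> fixg S2 \subset fixg S1.
Proof.
move=> s12; apply/subsetP => h /fixgP hS; apply/fixgP => x xS.
by apply: hS; apply: (subvP s12).
Qed.

Lemma card_fixg S : (#|fixg S| * \dim S)%N = \dim {:N}.
Proof.
by rewrite -(galois_dim (num_galois (imgF S))) -dim_img divnK // field_dimS // subvf.
Qed.

Lemma index_fixg S1 S2 : (S1 <= S2)%VS -> #|fixg S1 : fixg S2|%g = \dim_S1 S2.
Proof.
move=> s12; have := Lagrange (fixgS s12); have := card_fixg S1; rewrite -(card_fixg S2) => e1 e2.
have d1 : (0 < \dim S1)%N by apply: adim_gt0.
apply/eqP; rewrite -(eqn_pmul2r d1) (divnK (field_dimS s12)).
by rewrite -(eqn_pmul2l (cardG_gt0 (fixg S2))) mulnA e2 e1.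
Qed.

Lemma integral_iota x : integral x -> integral (iota x).
Proof.
move=> [q [mq rq]]; exists q; split=> //.
have -> : map_poly (fun z : int => z%:~R) q = map_poly iota (map_poly intr q).
  by rewrite -map_poly_comp; apply: eq_map_poly => z /=; rewrite rmorph_int.
by rewrite rootE horner_map (rootP rq) rmorph0.
Qed.

Lemma iota_integral x : integral (iota x) -> integral x.
Proof.
move=> [q [mq rq]]; exists q; split=> //; rewrite rootE -(fmorph_eq0 iota) -horner_map -map_poly_comp.
rewrite (_ : map_poly _ q = map_poly (fun z : int => z%:~R) q) //.
by apply: eq_map_poly => z /=; rewrite rmorph_int.
Qed.

(** The isomorphism is the inverse of [g], transported through [iota]. On [K] its values are fixed
    by the conjugate group [fixg L], so they come from [L]; elsewhere [f] is an arbitrary linear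
    extension. *)
Lemma iso_of_conj (F K L : {subfield E}) g : (F <= K)%VS -> (F <= L)%VS -> g \in fixg F ->
  fixg K :=: (fixg L :^ g)%g -> F_isomorphic F K L.
Proof.
move=> sFK sFL gF eKL.
have mem_conj (h : gT) : (h \in (fixg L :^ g)%g) = ((g * h * g^-1)%g \in fixg L).
  by rewrite mem_conjg conjgE invgK mulgA.
pose i := linfun iota.
have iK x : (i^-1)%VF (iota x) = x by have := lker0_lfunK linfun_iota_ker0 x; rewrite lfunE.
pose f : 'End(E) := ((i^-1)%VF \o (linfun (g^-1)%g : 'End(N)) \o i)%VF.
have fE x : f x = (i^-1)%VF ((g^-1)%g (iota x)) by rewrite !lfunE /= !lfunE /= !lfunE.
have fK x : x \in K -> f x \in L /\ iota (f x) = (g^-1)%g (iota x).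
  move=> xK; suff [y yL e] : exists2 y, y \in L & (g^-1)%g (iota x) = iota y.
    by rewrite fE e iK.
  apply: fixg_fixed => h hL.
  have : (g^-1 * h * g)%g \in fixg K by rewrite eKL mem_conj !mulgA mulgV mul1g mulgK.
  move=> /fixgP/(_ x xK); rewrite !gal_mulE => e.
  by rewrite -{2}e gal_invK.
have fL y : y \in L -> exists2 x, x \in K & f x = y.
  move=> yL; have [|x xK e] := @fixg_fixed K (g (iota y)).
    move=> h; rewrite eKL mem_conj => /fixgP/(_ y yL); rewrite !gal_mulE => e.
    by rewrite -{2}e gal_Kinv.
  by exists x => //; rewrite fE -e gal_invK iK.
exists f; split.
  apply/kHomP_tmp; split=> [x xF|x y xK yK].
    have /fixgP/(_ x xF) e : (g^-1)%g \in fixg F by rewrite groupV.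
    by rewrite fE e iK.
  have [_ ex] := fK x xK; have [_ ey] := fK y yK.
  have [_ exy] := fK (x * y) (memvM xK yK).
  have inj : injective iota by move=> a b; apply: fmorph_inj.
  by apply: inj; rewrite exy [RHS](rmorphM iota) /= ex ey !rmorphM.
apply/eqP; rewrite eqEsubv; apply/andP; split; apply/subvP.
  by move=> _ /memv_imgP[x xK ->]; have [] := fK x xK.
by move=> y /fL[x xK <-]; apply: memv_img.
Qed.

End FixingGroups.

(** * Prime ideals *)

Lemma lift_poly p (u : {poly 'F_p}) : prime p -> exists U : {poly int}, map_poly intr U = u.
Proof.
move=> pp; exists (map_poly (fun a : 'F_p => (a : nat)%:Z) u).
apply/polyP => i; rewrite coef_map coef_map_id0 //=.
by rewrite -pmulrn natr_Zp.
Qed.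

Section PrimeIdeal.
Variable E : fieldExtType rat.
Local Notation toE := (map_poly (intr : int -> E)).
Variables (M : {subfield E}) (Q : E -> Prop).
Local Notation O := (ring_of_integers M).
Hypothesis Qprime : nz_prime_ideal O Q.

Lemma ideal_sub x : Q x -> O x. Proof. by case: Qprime => h _; apply: h. Qed.
Lemma ideal0 : Q 0. Proof. by case: Qprime => _ []. Qed.
Lemma idealD x y : Q x -> Q y -> Q (x + y).
Proof. by case: Qprime => _ [_ [h _]]; apply: h. Qed.
Lemma idealM r x : O r -> Q x -> Q (r * x).
Proof. by case: Qprime => _ [_ [_ [h _]]]; apply: h. Qed.
Lemma ideal1 : ~ Q 1. Proof. by case: Qprime => _ [_ [_ [_ []]]]. Qed.
Lemma ideal_prime x y : O x -> O y -> Q (x * y) -> Q x \/ Q y.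
Proof. by case: Qprime => _ [_ [_ [_ [_ [h _]]]]]; apply: h. Qed.

Lemma oi_int (z : int) : O z%:~R.
Proof.
split; last exact: integral_int.
by rewrite -[z%:~R]scaler_int memvZ // mem1v.
Qed.
Lemma oi_nat (n : nat) : O n%:R. Proof. exact: (oi_int n%:Z). Qed.
Lemma oiM x y : O x -> O y -> O (x * y).
Proof. by move=> [xM hx] [yM hy]; split; [apply: memvM | apply: integralM]. Qed.
Lemma oiD x y : O x -> O y -> O (x + y).
Proof. by move=> [xM hx] [yM hy]; split; [apply: memvD | apply: integralD]. Qed.
Lemma oiN x : O x -> O (- x).
Proof. by move=> [xM hx]; split; [rewrite memvN | apply: integralN]. Qed.
Lemma oiX x n : O x -> O (x ^+ n).
Proof. by move=> [xM hx]; split; [apply: rpredX | apply: integralX]. Qed.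
Lemma oi_horner (u : {poly int}) x : O x -> O (toE u).[x].
Proof.
move=> Ox; have [xM hx] := Ox; split; last exact: integral_horner.
rewrite horner_coef; apply: memv_suml => i _; rewrite memvM ?(oiX _ Ox).1 //.
by rewrite coef_map; have [] := oi_int u`_i.
Qed.

Lemma idealN x : Q x -> Q (- x).
Proof. by move=> Qx; rewrite -mulN1r; apply: idealM => //; apply: (oi_int (-1)). Qed.
Lemma idealB x y : Q x -> Q y -> Q (x - y).
Proof. by move=> Qx Qy; apply: idealD => //; apply: idealN. Qed.
Lemma ideal_sum (I : Type) (r : seq I) (P : pred I) (F : I -> E) :
  (forall i, P i -> Q (F i)) -> Q (\sum_(i <- r | P i) F i).
Proof. by move=> h; apply: big_ind => //; [apply: ideal0 | apply: idealD]. Qed.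

Variable p : nat.
Hypotheses (p_pr : prime p) (Qp : Q p%:R).
Local Notation toF := (map_poly (intr : int -> 'F_p)).

Lemma ideal_toF0 (u : {poly int}) x : O x -> toF u = 0 -> Q (toE u).[x].
Proof.
move=> Ox /(toF_eq0 p_pr)[v ->]; rewrite map_polyZ hornerZ rmorph_nat mulrC.
by apply: idealM => //; apply: oi_horner.
Qed.

Section Unramified.
Variables (x : E) (f : {poly int}).
Hypotheses (xf : int_minpoly x f) (x_gen : <<1; x>>%VS = M).
Hypothesis f_sep : separable_poly (toF f).

Let Ox : O x.
Proof. by split; [rewrite -x_gen memv_adjoin | apply: int_minpoly_integral xf]. Qed.

(* The ideal of [F_p[X]] of all [u] with [u(x)] in [Q] is generated by some [h], and
   [t = f / h] satisfies [t(x) Q <= p O]; if [p] were in [Q^2] then [t(x)^2] would be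
   in [p O], which separability of [f] modulo [p] forbids. *)
Lemma unramified_separable : ~ in_ideal_sq Q p%:R.
Proof.
have [mf irr rf] := xf.
pose inI (v : {poly 'F_p}) := exists2 V, toF V = v & Q (toE V).[x].
have inIE V : inI (toF V) -> Q (toE V).[x].
  move=> [V' e QV']; have -> : V = (V - V') + V' by rewrite subrK.
  rewrite rmorphD hornerD; apply: idealD => //; apply: ideal_toF0 => //.
  by rewrite rmorphB /= e subrr.
have inID u v w : inI u -> inI v -> inI (u - w * v).
  move=> [U <- QU] [V <- QV]; have [W <-] := lift_poly w p_pr.
  exists (U - W * V); first by rewrite rmorphB rmorphM.
  rewrite rmorphB rmorphM hornerD hornerN hornerM; apply: idealB => //.
  by apply: idealM => //; apply: oi_horner.
have inIf : inI (toF f) by exists f => //; rewrite (rootP rf); apply: ideal0.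
have f0 : toF f != 0 by apply: separable_poly_neq0.
have [h [h0 hI hmin]] : exists h, [/\ h != 0, inI h & forall v, inI v -> h %| v].
  pose P n := `[< exists v, [/\ v != 0, inI v & size v = n] >].
  have exP : exists n, P n by exists (size (toF f)); apply/asboolP; exists (toF f).
  case: (ex_minnP exP) => n /asboolP[h [h0 hI hn]] hmin; exists h; split=> // v vI.
  apply: contraT; rewrite /dvdp => vh0.
  have : P (size (v %% h)).
    apply/asboolP; exists (v %% h); split=> //.
    have -> : v %% h = v - (v %/ h) * h by rewrite {2}(divp_eq v h) addrC addKr.
    exact: inID.
  by move/hmin; rewrite -hn leqNgt ltn_modp h0.
(* A constant [h] would put 1 into [Q]. *)
have h1 : (1 < size h)%N.
  rewrite ltnNge; apply/negP => sh.
  have [c ec] : exists c, h = c%:P by exists h`_0; apply: size1_polyC.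
  have c0 : c != 0 by rewrite -polyC_eq0 -ec.
  apply: ideal1; have := inIE 1; rewrite !rmorph1 hornerC; apply.
  have -> : 1 = 0 - (- c^-1)%:P * h.
    by rewrite sub0r polyCN mulNr opprK ec -polyCM mulVf.
  apply: inID hI; exists 0; rewrite ?rmorph0 //; rewrite horner0; apply: ideal0.
have /dvdpP[t et] := hmin _ inIf.
have [T eT] := lift_poly t p_pr.
(* Up to a denominator, a = u(x) with [u] a multiple of [h] modulo [p]. Since t h = f modulo [p] and
   f(x) = 0, the product t(x) u(x) is divisible by [p]. *)
have step a : Q a -> exists2 d : nat, coprime p d & exists v, d%:R * (toE T).[x] * a = p%:R * (toE v).[x].
  move=> Qa; have [aM ha] := ideal_sub Qa; rewrite -x_gen in aM.
  have [d cd [u du]] := integral_local xf p_pr f_sep aM ha.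
  have : inI (toF u) by exists u => //; rewrite -du; apply: idealM => //; apply: oi_nat.
  move/hmin => /dvdpP[w ew].
  have [W eW] := lift_poly w p_pr.
  have /(toF_eq0 p_pr)[v ev] : toF (T * u - f * W) = 0.
    by rewrite rmorphB !rmorphM /= eT ew eW et; ring.
  exists d => //; exists v; rewrite mulrAC du.
  have := congr1 (fun q => (toE q).[x]) ev; rewrite rmorphB !rmorphM /= map_polyZ rmorph_nat.
  by rewrite hornerZ hornerD hornerN !hornerM (rootP rf) mul0r subr0 mulrC.
move=> [s [sQ es]].
have [D cD [V eV]] : exists2 D : nat, coprime p D &
    exists V, D%:R * (toE T).[x] ^+ 2 * (\sum_(ab <- s) ab.1 * ab.2) = p%:R ^+ 2 * (toE V).[x].
  elim: s sQ {es} => [|[a b] s IH] sQ.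
    by exists 1%N; rewrite ?coprimen1 //; exists 0; rewrite big_nil rmorph0 horner0 !mulr0.
  have [|D cD [V eV]] := IH; first by move=> ab hab; apply: sQ; rewrite inE hab orbT.
  have [Qa Qb] := sQ (a, b) (mem_head _ _).
  have [d cd [v ev]] := step a Qa; have [d' cd' [v' ev']] := step b Qb.
  exists (D * (d * d'))%N; first by rewrite !coprimeMr cD cd.
  exists (D%:R *: (v * v') + (d * d')%N%:R *: V).
  rewrite big_cons /= mulrDr rmorphD /= !map_polyZ hornerD !hornerZ !rmorph_nat (rmorphM (map_poly intr) v v') /= hornerM.
  rewrite mulrDr; congr (_ + _).
    transitivity (D%:R * (d%:R * (toE T).[x] * a) * (d'%:R * (toE T).[x] * b)).
      by rewrite !natrM; ring.
    by rewrite ev ev'; ring.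
  transitivity ((d * d')%N%:R * (D%:R * (toE T).[x] ^+ 2 * \sum_(ab <- s) ab.1 * ab.2)).
    by rewrite !natrM; ring.
  by rewrite eV; ring.
have pE : p%:R != 0 :> E by rewrite natr_ext_neq0 // prime_gt0.
have {eV es} eV : D%:R * (toE T).[x] ^+ 2 = p%:R * (toE V).[x].
  by apply: (mulIf pE); rewrite {1}es eV; ring.
have [w ew] : exists w, D%:R *: T ^+ 2 - p%:R *: V = w * f.
  apply: (int_minpoly_dvd xf).
  by rewrite rmorphB /= !map_polyZ !rmorph_nat hornerD hornerN !hornerZ rmorphXn horner_exp eV subrr.
have D0 : D%:R != 0 :> 'F_p by rewrite -(dvdn_pcharf (pchar_Fp p_pr)) -prime_coprime.
have : toF f %| t ^+ 2.
  have := congr1 toF ew; rewrite rmorphB /= !map_polyZ !rmorph_nat rmorphXn rmorphM /= eT.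
  rewrite (pcharf0 (pchar_Fp p_pr)) scale0r subr0 => e.
  by rewrite -(dvdpZr _ _ D0) e dvdp_mull.
(* Now [f] divides [t] modulo [p], although t = f / h has smaller degree. *)
move/(separable_dvdp_exp f_sep); rewrite {1}et => ht.
have t0 : t != 0 by apply: contraNneq f0 => t0; rewrite et t0 mul0r.
have := dvdp_leq t0 ht; rewrite size_mul //; move: h1 (size_poly_gt0 t); rewrite t0.
by case: (size t) (size h) => [|a] [|[|b]] //; lia.
Qed.
End Unramified.
End PrimeIdeal.

(** * Residue rings, and contractions of places to subfields *)

Section Fermat.
Variables (E : fieldExtType rat) (M : {subfield E}) (Q : E -> Prop).
Local Notation O := (ring_of_integers M).
Hypothesis Qprime : nz_prime_ideal O Q.

Lemma ideal_prodB (I : finType) (P : pred I) (F G : I -> E) :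
  (forall i, O (F i)) -> (forall i, O (G i)) -> (forall i, P i -> Q (F i - G i)) ->
  Q (\prod_(i | P i) F i - \prod_(i | P i) G i).
Proof.
move=> hF hG hQ.
have O1 : O 1 := oi_nat M 1.
suff [] : [/\ Q (\prod_(i | P i) F i - \prod_(i | P i) G i), O (\prod_(i | P i) F i)
     & O (\prod_(i | P i) G i)] by [].
apply: (big_rec2 (fun a b => [/\ Q (a - b), O a & O b])) => [|i a b Pi [Qab Oa Ob]].
  by rewrite subrr; split=> //; apply: ideal0 Qprime.
split; [|exact: oiM|exact: oiM].
have -> : F i * a - G i * b = F i * (a - b) + b * (F i - G i) by ring.
by apply: (idealD Qprime); apply: (idealM Qprime) => //; apply: hQ.
Qed.

Lemma ideal_prod_prime (I : finType) (P : pred I) (F : I -> E) :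
  (forall i, O (F i)) -> (forall i, P i -> ~ Q (F i)) -> ~ Q (\prod_(i | P i) F i).
Proof.
move=> hF hQ; suff [] : ~ Q (\prod_(i | P i) F i) /\ O (\prod_(i | P i) F i) by [].
apply: (big_rec (fun a => ~ Q a /\ O a)) => [|i a Pi [Qa Oa]].
  by split; [apply: ideal1 Qprime | apply: (oi_nat M 1)].
split; last exact: oiM.
by move=> /(ideal_prime Qprime (hF i) Oa)[]; [apply: hQ | apply: Qa].
Qed.

(** The classical proof on representatives: for [x] outside [Q], multiplication by [x] permutes the
    classes and fixes the zero class [z0]. Comparing the products over the other classes, which
    avoid [Q] by primality, gives x^(n-1) = 1 modulo [Q]. *)
Lemma ideal_fermat n x : resid_card O Q n -> O x -> Q (x ^+ n - x).
Proof.
move=> [s [sz sO sinj sex]] Ox.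
have O0 : O 0 := oi_nat M 0.
have [i0 lt0] := sex _ O0; rewrite sub0r => Qi0.
have n0 : (0 < n)%N by apply: leq_ltn_trans lt0.
have en : n = n.-1.+1 by rewrite prednK.
rewrite {1}en exprS -[X in _ - X]mulr1 -mulrBr.
have [Qx|Qx] := EM (Q x).
  rewrite mulrC; apply: (idealM Qprime) => //.
  by apply: oiD; [apply: oiX | apply: oiN; apply: (oi_nat M 1)].
apply: (idealM Qprime) => //.
pose S (i : 'I_n) := s`_i.
have SO i : O (S i) by apply: sO; rewrite mem_nth ?sz.
have Sinj i j : Q (S i - S j) -> i = j.
  move=> Qij; apply: val_inj; case: (ltngtP i j) => // ij.
    by case: (sinj i j); rewrite ?ij ?ltn_ord.
  case: (sinj j i); rewrite ?ij ?ltn_ord // -opprB; exact: (idealN Qprime).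
pose z0 : 'I_n := Ordinal lt0.
have Qz0 : Q (S z0) by rewrite -[S z0]opprK; apply: (idealN Qprime).
have /choice[T hT] : forall i, exists j : 'I_n, Q (x * S i - S j).
  by move=> i; have [j lj Qj] := sex _ (oiM Ox (SO i)); exists (Ordinal lj).
have Tinj : injective T.
  move=> i j e; apply: Sinj; have := idealB Qprime (hT i) (hT j).
  have -> : x * S i - S (T i) - (x * S j - S (T j)) = x * (S i - S j) by rewrite e; ring.
  by move/(ideal_prime Qprime Ox (oiD (SO i) (oiN (SO j)))) => [].
have Tz0 : T z0 = z0.
  apply: Sinj; have := idealB Qprime (idealM Qprime Ox Qz0) (hT z0).
  rewrite opprB addrCA subrr addr0 => h; exact: (idealB Qprime).
pose Pi := \prod_(i | i != z0) S i.
have OPi : O Pi by apply: big_ind => //; [apply: (oi_nat M 1) | apply: oiM].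
have nQPi : ~ Q Pi.
  apply: ideal_prod_prime => // i ni Qi; case/eqP: ni; apply: Sinj; exact: (idealB Qprime).
have e1 : \prod_(i | i != z0) (x * S i) = x ^+ n.-1 * Pi.
  rewrite big_split prodr_const; congr (_ ^+ _ * _).
  by rewrite -[n in RHS]card_ord (cardC1 z0).
have e2 : \prod_(i | i != z0) S (T i) = Pi.
  rewrite /Pi [RHS](reindex_inj Tinj) /=; apply: eq_bigl => i.
  by rewrite -{2}Tz0 (inj_eq Tinj).
have : Q (x ^+ n.-1 * Pi - Pi).
  rewrite -e1 -e2; by apply: ideal_prodB => i; [apply: oiM | apply: SO | move=> _; apply: hT].
rewrite -{2}[Pi]mul1r -mulrBl => /(ideal_prime Qprime _ OPi)[] //.
by apply: oiD; [apply: oiX | apply: oiN; apply: (oi_nat M 1)].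
Qed.

End Fermat.

Section PlacePoly.
Variables (N : splittingFieldType rat) (p : nat) (k : fieldType) (Phi : N -> k).
Hypothesis PhiP : place p Phi.

(** [Phi] respects products only on integral elements, so the induction must carry the integrality
    of the coefficients along. *)
Lemma place_prod_XsubC (s : seq N) : (forall z, z \in s -> integral z) ->
  (forall i, integral (\prod_(z <- s) ('X - z%:P))`_i) /\
  map_poly Phi (\prod_(z <- s) ('X - z%:P)) = \prod_(z <- s) ('X - (Phi z)%:P).
Proof.
have P0 := place0 PhiP.
elim: s => [|z s IH] hs.
  rewrite !big_nil; split=> [i|].
    by rewrite coef1; case: eqP => _; [apply: integral1 | apply: integral0].
  apply/polyP => i; rewrite coef_map_id0 // !coef1.
  by case: eqP => _; rewrite ?(place1 PhiP) ?P0.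
have [|hi hm] := IH; first by move=> w ws; apply: hs; rewrite inE ws orbT.
have hz : integral z by apply: hs; rewrite inE eqxx.
rewrite !big_cons; set q := \prod_(_ <- _) _ in hi hm *.
have ci i : (('X - z%:P) * q)`_i = (if i == 0 then 0 else q`_i.-1) - z * q`_i.
  by rewrite mulrBl coefB coefXM coefCM.
have hX i : integral (if (i == 0)%N then 0 else q`_i.-1).
  by case: eqP => _; [apply: integral0 | apply: hi].
split=> [i|]; first by rewrite ci; apply: integralB => //; apply: integralM.
apply/polyP => i; rewrite coef_map_id0 // ci (placeB PhiP) ?(placeM PhiP) //; last exact: integralM.
rewrite mulrBl coefB coefXM coefCM -hm !coef_map_id0 //.
by case: (i == 0)%N; rewrite ?P0.
Qed.

End PlacePoly.

Section Kernel.
Variables (E : fieldExtType rat) (N : splittingFieldType rat) (iota : {lrmorphism E -> N}).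
Variables (p : nat) (k : fieldType) (Phi : N -> k).
Hypotheses (p_pr : prime p) (PhiP : place p Phi).
Local Notation O S := (ring_of_integers S).

(** The prime of [S] below the place. *)
Definition kerI (S : {subfield E}) (x : E) : Prop := O S x /\ Phi (iota x) = 0.

Lemma kerI_prime (S : {subfield E}) : nz_prime_ideal (O S) (kerI S).
Proof.
have i_int x : O S x -> integral (iota x) by move=> [_ hx]; apply: integral_iota.
split; first by move=> x [].
split; first by split; [apply: (oi_nat S 0) | rewrite rmorph0 (place0 PhiP)].
split.
  move=> x y [Ox Px] [Oy Py]; split; first exact: oiD.
  by rewrite rmorphD /= (placeD PhiP (i_int _ Ox) (i_int _ Oy)) Px Py addr0.
split.
  move=> r x Or [Ox Px]; split; first exact: oiM.
  by rewrite rmorphM /= (placeM PhiP (i_int _ Or) (i_int _ Ox)) Px mulr0.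
split; first by move=> [_]; rewrite rmorph1 (place1 PhiP) => /eqP; rewrite oner_eq0.
split.
  move=> x y Ox Oy [_]; rewrite rmorphM /= (placeM PhiP (i_int _ Ox) (i_int _ Oy)) => /eqP.
  by rewrite mulf_eq0 => /orP[/eqP Px|/eqP Py]; [left | right].
exists p%:R; split; last by apply/eqP; rewrite natr_ext_neq0 // prime_gt0.
split; first exact: oi_nat.
by rewrite rmorph_nat (place_nat PhiP) (pcharf0 (place_char PhiP)).
Qed.

Section Rational.
Variable S : {subfield E}.
Hypothesis S_rat : forall x, O S x -> exists2 a, (a < p)%N & Phi (iota x) = a%:R.

Lemma kerI_resid_card : resid_card (O S) (kerI S) p.
Proof.
have pk := place_char PhiP.
have PhiB x y : O S x -> O S y -> Phi (iota (x - y)) = Phi (iota x) - Phi (iota y).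
  by move=> [_ hx] [_ hy]; rewrite rmorphB /= (placeB PhiP) //; apply: integral_iota.
have Pnat (a : nat) : Phi (iota a%:R) = a%:R by rewrite rmorph_nat (place_nat PhiP).
have sE i : (i < p)%N -> nth 0 [seq a%:R : E | a <- seq.iota 0 p] i = i%:R.
  by move=> lt; rewrite (nth_map 0%N) ?size_iota // nth_iota.
exists [seq a%:R | a <- seq.iota 0 p]; split.
- by rewrite size_map size_iota.
- by move=> _ /mapP[a _ ->]; apply: oi_nat.
- move=> i j /andP[ij jp]; have ip := ltn_trans ij jp; rewrite !sE // => -[_].
  rewrite PhiB ?Pnat; [|exact: oi_nat|exact: oi_nat].
  move/eqP; rewrite subr_eq0 => /eqP/(natr_inj_lt pk ip jp) e.
  by rewrite e ltnn in ij.
move=> x Ox; have [a ap ea] := S_rat Ox; exists a; rewrite // sE //; split.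
  by apply: oiD => //; apply: oiN; apply: oi_nat.
by rewrite PhiB ?Pnat ?ea ?subrr //; apply: oi_nat.
Qed.

(** [inertia_degree] leaves the size of the residue ring existential; this pins it to [p]. *)
Lemma resid_card_kerI n : resid_card (O S) (kerI S) n -> n = p.
Proof.
have pk := place_char PhiP; move=> [s [sz sO sinj sex]].
have PhiB x y : O S x -> O S y -> Phi (iota (x - y)) = Phi (iota x) - Phi (iota y).
  by move=> [_ hx] [_ hy]; rewrite rmorphB /= (placeB PhiP) //; apply: integral_iota.
have SO (i : 'I_n) : O S s`_i by apply: sO; rewrite mem_nth ?sz.
have /choice[a ha] : forall i : 'I_n, exists a : 'I_p, Phi (iota s`_i) = (a : nat)%:R.
  by move=> i; have [a ap ea] := S_rat (SO i); exists (Ordinal ap).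
have ainj : injective a.
  move=> i j e; apply: val_inj; case: (ltngtP i j) => // ij.
    case: (sinj i j); rewrite ?ij ?ltn_ord //; split; first by apply: oiD => //; apply: oiN.
    by rewrite PhiB // !ha e subrr.
  case: (sinj j i); rewrite ?ij ?ltn_ord //; split; first by apply: oiD => //; apply: oiN.
  by rewrite PhiB // !ha e subrr.
have /choice[b hb] : forall c : 'I_p, exists i : 'I_n, Phi (iota s`_i) = (c : nat)%:R.
  move=> c; have [i li [_]] := sex _ (oi_nat S c); exists (Ordinal li) => /=.
  have Oi : O S s`_i := SO (Ordinal li).
  move: b; rewrite PhiB //; last exact: oi_nat.
  by rewrite rmorph_nat (place_nat PhiP) => /eqP; rewrite subr_eq0 => /eqP.
have binj : injective b.
  move=> c d e; apply: val_inj; apply: (natr_inj_lt pk (ltn_ord _) (ltn_ord _)); by rewrite -!hb e.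
have := leq_card a ainj; have := leq_card b binj; rewrite !card_ord => h1 h2.
by apply/eqP; rewrite eqn_leq h1 h2.
Qed.

End Rational.
End Kernel.

(** * From gcd equivalence to local conjugacy of the fixing groups *)

Lemma exists_Fp_morphism p (k : fieldType) : p \in [pchar k] ->
  exists phi : {rmorphism 'F_p -> k}, True.
Proof.
move=> pk; pose f : {rmorphism 'F_p -> pPrimeCharType pk} := in_alg (pPrimeCharType pk).
by exists (f : {rmorphism 'F_p -> k}).
Qed.

Section Main.
Variables (E : fieldExtType rat) (N : splittingFieldType rat) (iota : {lrmorphism E -> N}).
Variables F K L : {subfield E}.
Hypotheses (sFK : (F <= K)%VS) (sFL : (F <= L)%VS).
Local Notation O S := (ring_of_integers S).
Local Notation gT := (gal_of {:N}).
Local Notation toE := (map_poly (intr : int -> E)).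

(** [t] fixes [iota x], so the reduction of [iota x] equals its own [p]-th power. *)
Lemma frob_rational p (k : fieldType) (Phi : N -> k) (t : gT) (S : {subfield E}) x :
  place p Phi -> frob_at p Phi t -> t \in fixg iota S -> O S x ->
  exists2 a, (a < p)%N & Phi (iota x) = a%:R.
Proof.
move=> PhiP frob /fixgP tS [xS hx]; apply: (frob_fixed_nat (place_char PhiP)).
by rewrite -frob ?tS //; apply: integral_iota.
Qed.

Section Inertia.
Variables (p l : nat) (k : fieldType) (Phi : N -> k) (t : gT) (b : E) (r : seq gT).
Let Z := [seq (g : gT) (iota b) | g <- r].
Hypotheses (p_pr : prime p) (l_pr : prime l) (PhiP : place p Phi) (frob : frob_at p Phi t).
Hypotheses (tF : t \in fixg iota F) (tl : (l.-elt t)%g).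
Hypotheses (hb : integral b) (bL : b \in L).
Hypothesis minb : minPoly (imgF iota F) (iota b) = \prod_(z <- Z) ('X - z%:P).
Hypothesis Zinj : {in Z &, injective Phi}.
Hypothesis Zfree : forall z, z \in Z -> t z != z.
Hypothesis Zgal : forall z, z \in Z -> forall i, (t ^+ i)%g z \in Z.

Lemma frobX z i : integral z -> Phi ((t ^+ i)%g z) = Phi z ^+ (p ^ i).
Proof.
move=> hz; elim: i => [|i IH]; first by rewrite expg0 gal_id expr1.
by rewrite expgSr gal_mulE frob ?IH -?exprM ?expnSr //; apply: integral_gal.
Qed.

(** Argued inside [L], with no prime of [N] above [Q]. Modulo [Q], [b] is a root of X^(p^e) - X by
    Fermat and of the reduction [G] of its minimal polynomial over [F]. If [l] does not divide [e]
    these two are coprime, and Bezout puts 1 into [Q]. *)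
Lemma inertia_degree_dvd Q e : lies_over F L (kerI iota Phi F) Q ->
  inertia_degree F L (kerI iota Phi F) Q e -> (l %| e)%N.
Proof.
move=> [Qpr QP] [n [cP cQ]].
have Frat x : O F x -> exists2 a, (a < p)%N & Phi (iota x) = a%:R := @frob_rational _ _ _ _ F x PhiP frob tF.
have en := resid_card_kerI PhiP Frat cP; rewrite {cP}en in cQ.
have Ob : O L b by [].
have QpF : Q p%:R.
  apply/QP; first exact: oi_nat.
  by split; [apply: oi_nat | rewrite rmorph_nat (place_nat PhiP) (pcharf0 (place_char PhiP))].
have hZ z : z \in Z -> integral z by move=> /mapP[g _ ->]; apply/integral_gal/integral_iota.
have ferm := ideal_fermat Qpr cQ Ob.
apply: contraT => nl.
pose q := \prod_(z <- Z) ('X - z%:P).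
have minq : minPoly (imgF iota F) (iota b) = q := minb.
have [hc mapZ] : (forall i, integral q`_i) /\ map_poly Phi q = \prod_(z <- Z) ('X - (Phi z)%:P).
  exact: (place_prod_XsubC PhiP hZ).
have /choice[c hcF] : forall i, exists x, O F x /\ q`_i = iota x.
  move=> i; have /polyOverP/(_ i) := minPolyOver (imgF iota F) (iota b).
  rewrite minq => /imgP[x xF ex]; exists x; split=> //; split=> //.
  by apply: (iota_integral (iota := iota)); rewrite -ex; apply: hc.
have /choice[a ha] : forall i, exists a : nat, Phi (iota (c i)) = a%:R.
  by move=> i; have [a _ ea] := Frat _ (hcF i).1; exists a.
pose m := size q.
(* The prime of [F] has residue field F_p, so the coefficients of the minimal polynomial are
   congruent to integers modulo it. *)
pose G : {poly int} := \poly_(i < m) (a i)%:Z.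
have [phi _] := exists_Fp_morphism (place_char PhiP).
have GK : map_poly phi (map_poly intr G) = \prod_(z <- Z) ('X - (Phi z)%:P).
  rewrite -mapZ; apply/polyP => i; rewrite [RHS]coef_map_id0 ?(place0 PhiP) //.
  rewrite !coef_map /= rmorph_int coef_poly; case: ltnP => im; last first.
    by rewrite nth_default // (place0 PhiP).
  by rewrite (hcF i).2 ha.
have QG : Q (toE G).[b].
  have z0 : \sum_(i < m) c i * b ^+ i = 0.
    apply/eqP; rewrite -(fmorph_eq0 iota) rmorph_sum; apply/eqP.
    transitivity q.[iota b]; last by rewrite -minq; apply/rootP/root_minPoly.
    rewrite horner_coef; apply: eq_bigr => i _.
    by rewrite rmorphM rmorphXn /= (hcF i).2.
  rewrite (@horner_coef_wide _ m) ?(leq_trans (size_poly _ _)) ?size_poly //.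
  have -> : \sum_(i < m) (toE G)`_i * b ^+ i = \sum_(i < m) ((toE G)`_i - c i) * b ^+ i.
    under [RHS]eq_bigr => i _ do rewrite mulrBl.
    by rewrite sumrB z0 subr0.
  apply: (ideal_sum Qpr) => i _.
  rewrite coef_map coef_poly ltn_ord /= mulrC; apply: (idealM Qpr); first exact: oiX.
  have Oi : O F ((a i)%:~R - c i) by apply: oiD; [apply: oi_nat | apply: oiN; have [] := hcF i].
  apply/QP => //; split=> //.
  rewrite rmorphB /= (placeB PhiP); last 2 first.
  - by rewrite rmorph_int; apply: integral_int.
  - by apply: integral_iota; have [[]] := hcF i.
  by rewrite ha rmorph_int (place_int PhiP) subrr.
pose W : {poly 'F_p} := 'X^(p ^ e) - 'X.
have cop : coprimep (map_poly intr G) W.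
  rewrite -(coprimep_map phi) GK big_seq; apply: (big_ind (fun u => coprimep u (map_poly phi W))).
  - exact: coprime1p.
  - by move=> u v hu hv; rewrite coprimepMl hu.
  move=> z zZ; rewrite coprimep_sym coprimep_XsubC /W rmorphB /= map_polyXn map_polyX.
  have hz := hZ z zZ.
  rewrite rootE !hornerE subr_eq0 -(frobX e hz); apply/eqP => eq1; case/eqP: (Zfree zZ).
  have {eq1} te : (t ^+ e)%g z = z by apply: Zinj => //; apply: Zgal.
  (* A common root means that [t ^+ e] fixes some [z]. As [t] is an [l]-element and [l] does not
     divide [e], [t] is a power of [t ^+ e] and fixes [z] too. *)
  have /cycleP[j ej] : t \in <[t ^+ e]>%g.
    have /eqP <- : generator <[t]>%g (t ^+ e)%g; last exact: cycle_id.
    rewrite generator_coprime; have [d ->] := p_natP tl; apply: coprimeXl.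
    by rewrite prime_coprime.
  rewrite ej; elim: j {ej} => [|j IH]; first by rewrite expg0 gal_id.
  by rewrite expgSr gal_mulE IH.
have /Bezout_eq1_coprimepP[[u v] /= bez] := cop.
have [U eU] := lift_poly u p_pr; have [V eV] := lift_poly v p_pr.
case: (ideal1 Qpr).
have : Q (toE (U * G + V * ('X^(p ^ e) - 'X) - 1)).[b].
  apply: (ideal_toF0 Qpr p_pr) => //.
  by rewrite rmorphB rmorphD !rmorphM rmorphB /= map_polyXn map_polyX eU eV bez rmorph1 subrr.
rewrite rmorphB rmorphD !rmorphM rmorphB /= map_polyXn map_polyX rmorph1 hornerD hornerN hornerC.
rewrite hornerD !hornerM hornerD hornerN hornerXn hornerX => Q1.
have -> : 1 = ((toE U).[b] * (toE G).[b] + (toE V).[b] * (b ^+ (p ^ e) - b)) -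
   ((toE U).[b] * (toE G).[b] + (toE V).[b] * (b ^+ (p ^ e) - b) - 1) by ring.
apply: (idealB Qpr) => //; apply: (idealD Qpr); apply: (idealM Qpr) => //; exact: oi_horner.
Qed.
End Inertia.

Lemma fixg_adjoin b (h : gT) : L = <<F; b>>%AS -> h \in fixg iota F -> h (iota b) = iota b ->
  h \in fixg iota L.
Proof.
move=> eL /fixgP hF hb; apply/fixgP => x; rewrite eL => /Fadjoin_polyP[q qF ->].
rewrite !horner_coef !rmorph_sum; apply: eq_bigr => i _.
rewrite !rmorphM !rmorphXn /= hb hF //; exact: (polyOverP qF).
Qed.

(** For an offending [a] the gcd would be 1 in [K] and a multiple of [l] in [L]. The prime [p] is
    taken large enough that the generators of [K] and [L] have separable reductions, which makes the
    prime of [F] unramified in both. *)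
Lemma locally_conj_fixg : locally_gcd_equivalent F K L ->
  locally_conj (fixg iota F) (fixg iota K) (fixg iota L).
Proof.
move=> eqv l a pl aK la.
have [->|a1] := eqVneq a 1%g; first by exists 1%g; rewrite ?group1.
apply: contrapT => no.
have [b [fb [bf eL]]] := int_primitive sFL.
have hb := int_minpoly_integral bf.
have bL : b \in L by rewrite eL memv_adjoin.
have /(galois_factors (subvf _)) /(_ (iota b) (memvf _)) [r [rF ur minb]] := num_galois (imgF iota F).
pose Z := [seq (g : gT) (iota b) | g <- r].
have hZ z : z \in Z -> integral z by move=> /mapP[g _ ->]; apply/integral_gal/integral_iota.
have ZP z : z \in Z -> exists2 g, g \in fixg iota F & z = g (iota b).
  by move=> /mapP[g gr ->]; exists g => //; apply: (subsetP rF).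
have galZ g : g \in fixg iota F -> g (iota b) \in Z.
  move=> gF; rewrite -root_prod_XsubC -minb.
  by apply: root_minPoly_gal; rewrite ?memvf ?subvf.
have [xK [fK [xfK eK]]] := int_primitive (sub1v K).
have [xL [fL [xfL eL']]] := int_primitive (sub1v L).
have genK : <<1; xK>>%VS = K by rewrite [in RHS]eK.
have genL : <<1; xL>>%VS = L by rewrite [in RHS]eL'.
have [BK sepK] : exists B, forall p, (B < p)%N -> forall k : fieldType, p \in [pchar k] ->
    separable_poly (map_poly intr fK : {poly k}).
  by have [m1 i1 _] := xfK; apply: separable_mod_large.
have [BL sepL] : exists B, forall p, (B < p)%N -> forall k : fieldType, p \in [pchar k] ->
    separable_poly (map_poly intr fL : {poly k}).
  by have [m1 i1 _] := xfL; apply: separable_mod_large.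
have [BZ injZ] := place_inj_seq hZ.
have [p [k [Phi [t [pp]]]]] := frobenius_element (maxn BK (maxn BL BZ)) pl la a1.
rewrite !gtn_max => /and3P[ltK ltL ltZ] PhiP frob eta.
have ta : t \in <[a]>%g by rewrite -eta cycle_id.
have tK : t \in fixg iota K by apply: subsetP ta; rewrite cycle_subG.
have tF : t \in fixg iota F by apply: (subsetP (fixgS iota sFK)).
have tl : (l.-elt t)%g by apply: mem_p_elt ta.
(* If [t] fixed the conjugate of [b] by [g], then [g * t * g^-1] would fix [L]; as <t> = <a>, this
   would conjugate [a] into [fixg iota L]. *)
have Zfree z : z \in Z -> t z != z.
  move=> /ZP[g gF ->]; apply/eqP => e; apply: no; exists g => //.
  have : (g * t * g^-1)%g \in fixg iota L.
    apply: (fixg_adjoin eL); first by rewrite !groupM ?groupV.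
    by rewrite !gal_mulE e gal_invK.
  move=> h; have : t \in (fixg iota L :^ g)%g by rewrite mem_conjg conjgE invgK mulgA.
  by rewrite -cycle_subG eta cycle_subG.
have Zgal z : z \in Z -> forall i, (t ^+ i)%g z \in Z.
  by move=> /ZP[g gF ->] i; rewrite -gal_mulE; apply: galZ; rewrite groupM ?groupX.
pose P := kerI iota Phi F.
have Krat x : O K x -> exists2 a, (a < p)%N & Phi (iota x) = a%:R := @frob_rational _ _ _ _ K x PhiP frob tK.
have Frat x : O F x -> exists2 a, (a < p)%N & Phi (iota x) = a%:R := @frob_rational _ _ _ _ F x PhiP frob tF.
have Pp : P p%:R.
  by split; [apply: oi_nat | rewrite rmorph_nat (place_nat PhiP) (pcharf0 (place_char PhiP))].
have unr (M : {subfield E}) (x : E) f : int_minpoly x f -> <<1; x>>%VS = M ->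
    separable_poly (map_poly intr f : {poly 'F_p}) -> unramified_in F M P.
  move=> xf genM sep Q [Qpr QP]; exists p%:R; split=> //.
  apply: (unramified_separable Qpr pp _ xf genM sep).
  by apply/QP => //; apply: oi_nat.
(* One prime of inertia degree 1 settles the gcd: the contraction of the place to [K], whose residue
   field is F_p because [t] fixes [K]. *)
have gK : is_gcd_split F K P 1.
  move=> d; split=> [d1 Q f _ _|h]; first by apply: dvdn_trans d1 (dvd1n _).
  apply: (h (kerI iota Phi K)).
    split; first exact: (kerI_prime iota pp PhiP K).
    move=> x Ox; have OxK : O K x by case: Ox => xF hx; split=> //; apply: (subvP sFK).
    by split=> -[_ Px]; split.
  exists p; rewrite expn1; split.
  - exact: (kerI_resid_card PhiP Frat).
  exact: (kerI_resid_card PhiP Krat).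
have /(_ l)[_ gL] : is_gcd_split F L P 1.
  apply/(eqv P (kerI_prime iota pp PhiP F)) => //.
    exact: (unr _ _ _ xfK genK (sepK p ltK _ (pchar_Fp pp))).
  exact: (unr _ _ _ xfL genL (sepL p ltL _ (pchar_Fp pp))).
have : (l %| 1)%N.
  apply: gL => Q f lo inertia.
  exact: (inertia_degree_dvd pp pl PhiP frob tF tl hb bL minb (injZ p k Phi ltZ PhiP)
    Zfree Zgal lo inertia).
by rewrite dvdn1 => /eqP l1; rewrite l1 in pl.
Qed.
End Main.

Theorem theorem1 (E : fieldExtType rat) (F K L : {subfield E})
  (hFK : (F <= K)%VS) (hFL : (F <= L)%VS)
  (hK : (\dim_F K <= 5)%N) (hL : (\dim_F L <= 5)%N) :
  locally_gcd_equivalent F K L -> F_isomorphic F K L.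
Proof.
move=> eqv; have [N [iota _]] := normal_closure E.
have eqv' : locally_gcd_equivalent F L K.
  by move=> P Pp uL uK g; apply: iff_sym; apply: eqv.
have [||||||g gF e] := @conj_of_locally_conj _ (fixg iota F) (fixg iota K) (fixg iota L).
- exact: fixgS.
- exact: fixgS.
- by rewrite index_fixg.
- by rewrite index_fixg.
- exact: locally_conj_fixg.
- exact: locally_conj_fixg.
exact: iso_of_conj gF e.
Qed.
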